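(* Let $\mathcal A=\mathcal A(\alpha)\subset\mathbb P^2$ be an arrangement of $n$ lines. Then the dimension of the vector space of minimal (first) syzygies of degree $n-1$ of $D_0(\mathcal A)$, that is, the graded Betti number $b_{1,n-1}(D_0(\mathcal A))$, equals the dimension of the space of non-trivial weak perspective representations of $\mathcal M(\alpha)$ (up to rank $3$).
   Context: $\mathbb K$ is a field of characteristic zero, $V=\mathbb K^3$, $S=\mathbb K[x,y,z]$. A line arrangement $\mathcal A=\mathcal A(\alpha)$ is given by a map $\alpha:\{1,\dots,n\}\to V^*$ whose values are nonzero linear forms defining pairwise distinct lines $H_i=\mathbb V(\alpha_i)\subset\mathbb P^2$; $Q=\prod_i\alpha_i$. $\mathcal M(\alpha)$ is the linear matroid on $\{1,\dots,n\}$ of $\alpha_1,\dots,\alpha_n$. $D_0(\mathcal A)=\{\theta\in\mathrm{Der}_{\mathbb K}(S):\theta(Q)=0\}$, graded so that $\theta=\theta_1\frac{\partial}{\partial x}+\theta_2\frac{\partial}{\partial y}+\theta_3\frac{\partial}{\partial z}$ with all $\theta_i$ homogeneous of degree $d$ has degree $d$. For a finitely generated graded $S$-module $M$ with minimal graded free resolution $F_\bullet$, $F_i=\bigoplus_j S(-j)^{b_{i,j}(M)}$. Truncation: $\mathcal N^{[3]}$ is the matroid whose independent sets are the independent sets of $\mathcal N$ of size at most $3$. A map $\beta:\{1,\dots,n\}\to V^*$ is a weak representation of $\mathcal M(\alpha)$ up to rank $3$ if every dependent set of $\mathcal M(\alpha)^{[3]}$ is dependent in $\mathcal M(\beta)^{[3]}$.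 Fix a line $H_0=\mathbb V(\alpha_0)$ not in $\mathcal A$ and containing no intersection point of two lines of $\mathcal A$. The space of weak perspective representations of $\mathcal M(\alpha)$ is the set of $\lambda\in\mathbb K^n$ such that $\beta_j=\alpha_j+\lambda_j\alpha_0$ is a weak representation of $\mathcal M(\alpha)$ up to rank $3$; it is a linear subspace that does not depend on the choice of $H_0$. The trivial ones are those with $\lambda=(\alpha_1(\mathbf v),\dots,\alpha_n(\mathbf v))$ for some $\mathbf v\in\mathbb K^3$. The space of non-trivial weak perspective representations is the quotient of the former space by the subspace of trivial ones. *)

(* Defs.v *)
From HB Require Import structures.
From mathcomp Require Import all_boot all_order all_algebra.
From mathcomp.multinomials Require Import mpoly.

Set Implicit Arguments.
Unset Strict Implicit.
Unset Printing Implicit Defensive.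

Import GRing.Theory.
Local Open Scope ring_scope.

Section GradedResolutions.
Variables (K : fieldType) (r : nat).
Local Notation S := {mpoly K[r]}.

(* A graded free module S(-e_0) + ... + S(-e_(m-1)) is given by e : 'I_m -> int
   and its elements are row vectors.  The element 0 has every degree. *)
Definition homogeneous_elt m (e : 'I_m -> int) (d : int) (f : 'rV[S]_m) : bool :=
  [forall i, all (fun mon : 'X_{1..r} => (mdeg mon)%:Z + e i == d)
                 (msupp (f 0 i))].

(* The data of a complex ... -> F_2 -> F_1 -> F_0 -> S^m of free S-modules with
   shifted generators; a matrix A stands for the map f |-> f *m A. *)
Record free_complex (m : nat) := FreeComplex {
  rk : nat -> nat;
  deg : forall i, 'I_(rk i) -> int;
  diff : forall i, 'M[S]_(rk i.+1, rk i);
  aug : 'M[S]_(rk 0, m) }.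

Arguments deg {m} F i a : rename.

(* F is a minimal graded free resolution of the graded submodule M of the
   graded free module with generator degrees e: all maps are homogeneous of
   degree 0, the complex ... -> F_1 -> F_0 -> M -> 0 is exact, and the entries
   of the differentials lie in the irrelevant maximal ideal. *)
Record minimal_graded_free_resolution m (e : 'I_m -> int)
    (M : 'rV[S]_m -> Prop) (F : free_complex m) : Prop := {
  aug_homogeneous : forall a, homogeneous_elt e (deg F 0 a) (row a (aug F));
  diff_homogeneous : forall i (a : 'I_(rk F i.+1)),
    homogeneous_elt (deg F i) (deg F i.+1 a) (row a (diff F i));
  aug_image : forall v, M v <-> exists f : 'rV[S]_(rk F 0), v = f *m aug F;
  exact_at_0 : forall f : 'rV[S]_(rk F 0),
    f *m aug F = 0 <-> exists g : 'rV[S]_(rk F 1), f = g *m diff F 0;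
  exact_at_S : forall i (f : 'rV[S]_(rk F i.+1)),
    f *m diff F i = 0 <-> exists g : 'rV[S]_(rk F i.+2), f = g *m diff F i.+1;
  diff_minimal : forall i a b, (diff F i a b)@_0%MM = 0 }.

(* The exponent b_(i,j) in F_i = \bigoplus_j S(-j)^(b_(i,j)). *)
Definition betti m (F : free_complex m) (i : nat) (j : int) : nat :=
  #|[set a : 'I_(rk F i) | deg F i a == j]|.

End GradedResolutions.

Arguments deg {K r m} F i a : rename.

Section Derivations.
Variables (K : fieldType) (r : nat).
Local Notation S := {mpoly K[r]}.

(* The row vector theta stands for \sum_i theta_i d/dx_i. *)
Definition der_app (theta : 'rV[S]_r) (f : S) : S :=
  \sum_(i < r) theta 0 i * f^`M(i).

Lemma der_app_linear (theta : 'rV[S]_r) : linear (der_app theta).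
Proof.
move=> c f g; rewrite /der_app scaler_sumr -big_split /=.
by apply: eq_bigr => i _; rewrite linearP mulrDr scalerAr.
Qed.

Lemma der_app_leibniz (theta : 'rV[S]_r) (f g : S) :
  der_app theta (f * g) = der_app theta f * g + f * der_app theta g.
Proof.
rewrite /der_app mulr_suml mulr_sumr -big_split /=.
by apply: eq_bigr => i _; rewrite mderivM mulrDr mulrA [f * (_ * _)]mulrCA !mulrA.
Qed.

Lemma der_appE (D : {linear S -> S}) :
  (forall f g, D (f * g) = D f * g + f * D g) ->
  forall f, D f = der_app (\row_i D 'X_i) f.
Proof.
move=> DM; set t := \row_i _.
have tL f g : der_app t (f + g) = der_app t f + der_app t g.
  by rewrite -[f]scale1r der_app_linear !scale1r.
have tZ c f : der_app t (c *: f) = c *: der_app t f.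
  have t0 : der_app t 0 = 0.
    by rewrite /der_app big1 // => i _; rewrite linear0 mulr0.
  by rewrite -[c *: f]addr0 der_app_linear t0 addr0.
have D1 : D 1 = 0.
  by have /eqP := DM 1 1; rewrite !mulr1 mul1r -subr_eq subrr => /eqP <-.
have t1 : der_app t 1 = 0.
  by rewrite /der_app big1 // => i _; rewrite -mpolyC1 mderivC mulr0.
have tX i : der_app t 'X_i = D 'X_i.
  rewrite /der_app (bigD1 i) //= big1 => [|j ji]; last first.
    by rewrite mderivX mnmE eq_sym (negPf ji) scale0r mulr0.
  rewrite mderivX mnmE eqxx scale1r mxE addr0.
  have -> : (U_(i) - U_(i))%MM = 0%MM :> 'X_{1..r}.
    by apply/mnmP => j; rewrite !mnmE subnn.
  by rewrite mpolyX0 mulr1.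
have key m : D 'X_[m] = der_app t 'X_[m].
  rewrite mpolyXE_id.
  elim/big_rec: _ => [|i p _ IH]; first by rewrite D1 t1.
  rewrite DM der_app_leibniz IH; congr (_ * _ + _).
  elim: (m i) => [|k IHk]; first by rewrite !expr0 D1 t1.
  by rewrite !exprS DM der_app_leibniz IHk tX.
elim/mpolyind => [|c m p _ _ IH]; last by rewrite linearP tL tZ IH key.
by rewrite linear0 -[X in der_app t X](scale0r (0 : S)) tZ scale0r.
Qed.

End Derivations.

Section Matroids.
Variables (K : fieldType) (vT : vectType K) (n : nat).

(* Matroids on 'I_n are represented by their collection of independent sets.
   [seq alpha i | i in I] keeps repetitions, so that two equal vectors with
   different indices are dependent. *)
Definition linear_matroid (alpha : 'I_n -> vT) : {set {set 'I_n}} :=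
  [set I : {set 'I_n} | free [seq alpha i | i in I]].

Definition truncation (k : nat) (N : {set {set 'I_n}}) : {set {set 'I_n}} :=
  [set I in N | #|I| <= k]%N.

Definition weak_representation (k : nat) (alpha beta : 'I_n -> vT) : Prop :=
  forall I : {set 'I_n},
    I \notin truncation k (linear_matroid alpha) ->
    I \notin truncation k (linear_matroid beta).

End Matroids.

(* W and T are linear subspaces, T is contained in W and dim (W / T) = d. *)
Definition quotient_dim (K : fieldType) (vT : vectType K) (W T : vT -> Prop)
    (d : nat) : Prop :=
  exists U V : {vspace vT},
    [/\ forall v, v \in U <-> W v,
        forall v, v \in V <-> T v,
        (V <= U)%VS
      & \dim U = (\dim V + d)%N].

Section Arrangements.
Variable K : fieldType.
Local Notation form := 'Hom('rV[K]_3, K^o).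

Definition form_poly (a : form) : {mpoly K[3]} :=
  \sum_(i < 3) (a (delta_mx 0 i) : K) *: 'X_i.

(* The line V(a) of P^2 is encoded by the plane lker a of K^3. *)
Definition line_arrangement n (alpha : 'I_n -> form) : Prop :=
  (forall i, alpha i != 0) /\ injective (fun i => lker (alpha i)).

Definition defining_poly n (alpha : 'I_n -> form) : {mpoly K[3]} :=
  \prod_(i < n) form_poly (alpha i).

Definition D0 n (alpha : 'I_n -> form) (theta : 'rV[{mpoly K[3]}]_3) : Prop :=
  der_app theta (defining_poly alpha) = 0.

(* The line V(alpha0) is not in the arrangement and contains no intersection
   point of two of its lines. *)
Definition generic_line n (alpha : 'I_n -> form) (alpha0 : form) : Prop :=
  [/\ alpha0 != 0,
      forall i, lker alpha0 != lker (alpha i)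
    & forall i j, i != j ->
        (lker alpha0 :&: (lker (alpha i) :&: lker (alpha j)))%VS = 0%VS].

Definition weak_perspective n (alpha : 'I_n -> form) (alpha0 : form)
    (lambda : 'rV[K]_n) : Prop :=
  weak_representation 3 alpha (fun j => alpha j + lambda 0 j *: alpha0).

Definition trivial_perspective n (alpha : 'I_n -> form)
    (lambda : 'rV[K]_n) : Prop :=
  exists v : 'rV[K]_3, lambda = \row_j alpha j v.

End Arrangements.

(* Main.v *)
(* Let a_i be the coefficient vector of alpha_i, T the space of trivial weak
   perspective representations and W the space of all of them.  The annihilator
   of T is the space of linear relations mu between the a_i.  The condition on a
   concurrent triple of lines is linear in lambda, and its coefficients form the
   linear relation supported on that triple, so the annihilator of W is spanned
   by these relations.  It remains to map the relations onto the minimal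
   syzygies of degree n - 1 with kernel the annihilator of W.

   These syzygies are the degree n - 1 part of Tor_1(D_0, K), computed by the
   Koszul complex of x, y, z.  As K has characteristic zero, D_0 may be replaced
   by the logarithmic derivations modulo the Euler field.  A relation mu is sent
   to the Koszul cycle \sum_i mu_i alpha_i \otimes theta_i, where
   theta_i = (\prod_(l <> i, l0) alpha_l) a_i \times a_l0 for a fixed line l0.
   Every cycle is of this form up to boundaries, by induction on the number of
   lines.  The cycle of a concurrent triple is visibly a boundary.  Conversely,
   for lambda in W and a logarithmic derivation eta of degree n - 3, the function
   equal to lambda_i f_i on the line i, where xvec \times eta = f_i a_i there, is
   the restriction of a polynomial of degree n - 2.  Applying this to a cochain
   bounding the cycle of mu yields Q \sum_i mu_i lambda_i = 0. *)

Require Import Defs.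
From HB Require Import structures.
From mathcomp Require Import all_boot all_order all_algebra.
From mathcomp.multinomials Require Import mpoly.
From mathcomp Require Import ring zify.

Import Order.TTheory GRing.Theory Num.Theory.
Local Open Scope ring_scope.

Set Implicit Arguments.
Unset Strict Implicit.
Unset Printing Implicit Defensive.

(** * Vectors of length three *)

(** Both inductions on the lines rest on univariate interpolation along one line [m]. In the chart
    with [a0] at infinity, genericity keeps the points where [m] meets the other lines finite. A
    field tangent to [m] has a polynomial trace there ([transv]), which vanishes at the points of
    the other lines it is tangent to. Zero trace means divisibility by the form of [m] modulo
    [xvec], so a line can be removed. The obstacle is concurrency: several lines through one point
    of [m] force only one zero. Fields of the pencil at that point make up for it, and gluing them
    is where [perspective] enters.

    Degrees decide the rest. For k lines, a field of degree k - 3 has a trace of degree at most k -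
    2, and every such trace with the required zeros is attained. Degree k - 2 allows one more
    coefficient, and that coefficient is [mu m].

    The resolution is arbitrary, so Tor_1 is compared by hand: lift a Koszul cycle to F_0, multiply
    by [xvec], write the result through [d0], and take constant terms. What remains is the count n =
    betti number + rank of the [a i] + rank of the triple relations. *)

Definition c0 : 'I_3 := @Ordinal 3 0 isT.
Definition c1 : 'I_3 := @Ordinal 3 1 isT.
Definition c2 : 'I_3 := @Ordinal 3 2 isT.

Lemma ord3P (P : 'I_3 -> Prop) : P c0 -> P c1 -> P c2 -> forall i, P i.
Proof.
move=> h0 h1 h2 [[|[|[|i]]] Hi] //.
- by rewrite (_ : Ordinal Hi = c0) //; apply: val_inj.
- by rewrite (_ : Ordinal Hi = c1) //; apply: val_inj.
- by rewrite (_ : Ordinal Hi = c2) //; apply: val_inj.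
Qed.

Lemma sum3 (V : nmodType) (F : 'I_3 -> V) : \sum_i F i = F c0 + F c1 + F c2.
Proof.
rewrite !big_ord_recr big_ord0 /= add0r.
by congr (F _ + F _ + F _); apply: val_inj.
Qed.

Fact vec_key : unit. Proof. exact: tt. Qed.

Section Vectors.
Variable R : comNzRingType.
Implicit Types u v w a b c : 'rV[R]_3.

Definition vec3 (x y z : R) : 'rV[R]_3 :=
  \row_i (if i == c0 then x else if i == c1 then y else z).

(* [dot] and [cross] are locked: comparing two of their values by conversion
   would compute in the polynomial ring. *)
Definition dot :=
  locked_with vec_key
    (fun u v => u 0 c0 * v 0 c0 + u 0 c1 * v 0 c1 + u 0 c2 * v 0 c2 : R).

Definition cross :=
  locked_with vec_key
    (fun u v => vec3 (u 0 c1 * v 0 c2 - u 0 c2 * v 0 c1)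
                     (u 0 c2 * v 0 c0 - u 0 c0 * v 0 c2)
                     (u 0 c0 * v 0 c1 - u 0 c1 * v 0 c0)).

Lemma dotE u v :
  dot u v = u 0 c0 * v 0 c0 + u 0 c1 * v 0 c1 + u 0 c2 * v 0 c2.
Proof. by rewrite /dot unlock. Qed.

Definition det3 u v w : R := dot u (cross v w).

Definition cross_mx u : 'M[R]_3 := \matrix_(i, j) cross u (delta_mx 0 j) 0 i.

Lemma rv3P u v :
  u 0 c0 = v 0 c0 -> u 0 c1 = v 0 c1 -> u 0 c2 = v 0 c2 -> u = v.
Proof. by move=> h0 h1 h2; apply/rowP; elim/ord3P. Qed.

Lemma crossE u v :
  (cross u v 0 c0 = u 0 c1 * v 0 c2 - u 0 c2 * v 0 c1) *
  (cross u v 0 c1 = u 0 c2 * v 0 c0 - u 0 c0 * v 0 c2) *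
  (cross u v 0 c2 = u 0 c0 * v 0 c1 - u 0 c1 * v 0 c0).
Proof. by rewrite /cross unlock !mxE. Qed.

Definition vE := (crossE, mxE).

End Vectors.

Ltac vring := rewrite /det3 ?dotE; (try apply: rv3P); rewrite ?vE; ring.

Section VectorIdentities.
Variable R : comNzRingType.
Implicit Types u v w a b c : 'rV[R]_3.

Lemma dotC u v : dot u v = dot v u. Proof. vring. Qed.
Lemma dotDl u v w : dot (u + v) w = dot u w + dot v w. Proof. vring. Qed.
Lemma dotDr u v w : dot u (v + w) = dot u v + dot u w. Proof. vring. Qed.
Lemma dotBl u v w : dot (u - v) w = dot u w - dot v w. Proof. vring. Qed.
Lemma dotZl s u v : dot (s *: u) v = s * dot u v. Proof. vring. Qed.
Lemma dotZr s u v : dot u (s *: v) = s * dot u v. Proof. vring. Qed.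
Lemma dot0l v : dot 0 v = 0. Proof. vring. Qed.
Lemma dot0r v : dot v 0 = 0. Proof. vring. Qed.
Lemma crossC u v : cross u v = - cross v u. Proof. vring. Qed.
Lemma crossvv u : cross u u = 0. Proof. vring. Qed.
Lemma crossDl u v w : cross (u + v) w = cross u w + cross v w.
Proof. vring. Qed.
Lemma crossDr u v w : cross u (v + w) = cross u v + cross u w.
Proof. vring. Qed.
Lemma crossBr u v w : cross u (v - w) = cross u v - cross u w.
Proof. vring. Qed.
Lemma crossBl u v w : cross (u - v) w = cross u w - cross v w.
Proof. vring. Qed.
Lemma crossZl s u v : cross (s *: u) v = s *: cross u v. Proof. vring. Qed.
Lemma crossZr s u v : cross u (s *: v) = s *: cross u v. Proof. vring. Qed.
Lemma cross0r u : cross u 0 = 0. Proof. vring. Qed.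
Lemma cross0l u : cross 0 u = 0. Proof. vring. Qed.
Lemma cross_cross u v w :
  cross u (cross v w) = dot u w *: v - dot u v *: w.
Proof. vring. Qed.
Lemma dot_crossl u v : dot u (cross u v) = 0. Proof. vring. Qed.
Lemma dot_crossr u v : dot v (cross u v) = 0. Proof. vring. Qed.
Lemma det3_rot u v w : det3 u v w = det3 v w u. Proof. vring. Qed.
Lemma det3vv u v : det3 u v v = 0. Proof. vring. Qed.

Lemma det3_expand v a b c :
  dot v a *: cross b c + dot v b *: cross c a + dot v c *: cross a b =
  det3 a b c *: v.
Proof. vring. Qed.

Lemma cross_mxE u v : cross_mx u *m v^T = (cross u v)^T.
Proof.
by apply/matrixP => i j; rewrite !ord1 !mxE sum3; elim/ord3P: i; rewrite !vE;
  rewrite ?eqxx /=; ring.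
Qed.

Lemma mul_cross_mx u : u *m cross_mx u = 0.
Proof.
by apply/rowP => j; rewrite !mxE sum3; elim/ord3P: j; rewrite !vE /=;
  ring.
Qed.

Lemma mul_trmx_row p u v (w : 'rV[R]_p) : (u *m (v^T *m w)) = dot u v *: w.
Proof.
rewrite mulmxA; apply/rowP => j; rewrite !mxE big_ord1 !mxE dotE sum3 !mxE //.
Qed.
End VectorIdentities.

(** * Homogeneous polynomials *)

Section Homogeneous.
Variable K : fieldType.
Local Notation S := {mpoly K[3]}.
Implicit Types (d e : int) (F G : S).

(** Degrees are integers because n - 3 and n - 2 may be negative for few lines; then only 0 is
    homogeneous, which settles the base cases. *)
Definition homz d F : bool := all (fun m : 'X_{1..3} => (mdeg m)%:Z == d) (msupp F).

Lemma homzP d F :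
  reflect (forall m, F@_m != 0 -> (mdeg m)%:Z = d) (homz d F).
Proof.
apply: (iffP allP) => h m.
  by rewrite -mcoeff_msupp => /h /eqP.
by rewrite mcoeff_msupp => /h /eqP.
Qed.

Lemma homz0 d : homz d 0. Proof. by apply/homzP => m; rewrite mcoeff0 eqxx. Qed.

Lemma homzD d F G : homz d F -> homz d G -> homz d (F + G).
Proof.
move=> /homzP hF /homzP hG; apply/homzP => m; rewrite mcoeffD => h.
have [F0|/hF //] := eqVneq F@_m 0.
by apply: hG; move: h; rewrite F0 add0r.
Qed.

Lemma homzN d F : homz d F -> homz d (- F).
Proof. by move=> /homzP h; apply/homzP => m; rewrite mcoeffN oppr_eq0; apply: h. Qed.

Lemma homzB d F G : homz d F -> homz d G -> homz d (F - G).
Proof. by move=> h1 h2; apply: homzD => //; apply: homzN. Qed.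

Lemma homz_sum d (I : Type) (r : seq I) (P : pred I) (F : I -> S) :
  (forall i, P i -> homz d (F i)) -> homz d (\sum_(i <- r | P i) F i).
Proof.
by move=> h; apply: (big_ind (homz d)) => //; [apply: homz0 | move=> x y; apply: homzD].
Qed.

Lemma homzM d e F G : homz d F -> homz e G -> homz (d + e) (F * G).
Proof.
move=> /homzP hF /homzP hG; apply/homzP => m; rewrite -mcoeff_msupp.
move=> /msuppM_le /allpairsP[[m1 m2] /= []].
rewrite !mcoeff_msupp => /hF h1 /hG h2 ->.
by rewrite mdegD -h1 -h2 PoszD.
Qed.

Lemma homzM_eq d e k F G : homz d F -> homz e G -> k = d + e -> homz k (F * G).
Proof. by move=> hF hG ->; apply: homzM. Qed.

Lemma homz_const (c : K) : homz 0 c%:MP.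
Proof.
apply/homzP => m; rewrite mcoeffC; have [->|_] := eqVneq m 0%MM; first by rewrite mdeg0.
by rewrite mulr0n mulr0 eqxx.
Qed.

Lemma homz1 : homz 0 1. Proof. exact: homz_const. Qed.

Lemma homzZ d (c : K) F : homz d F -> homz d (c *: F).
Proof. by move=> h; rewrite -mul_mpolyC -[d]add0r; apply: homzM => //; apply: homz_const. Qed.

Lemma homzX i : homz 1 'X_i.
Proof. by apply/homzP => m; rewrite mcoeffX; have [<-|_] := eqVneq U_(i)%MM m; rewrite ?mdeg1 ?eqxx. Qed.

Lemma homzXn d F k : homz d F -> homz (d *+ k) (F ^+ k).
Proof.
move=> h; elim: k => [|k IH]; first exact: homz1.
by rewrite exprS mulrS; apply: homzM.
Qed.

Lemma homz_prod (I : Type) (r : seq I) (P : pred I) (F : I -> S) :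
  (forall i, P i -> homz 1 (F i)) ->
  homz (count P r)%:Z (\prod_(i <- r | P i) F i).
Proof.
move=> h; elim: r => [|i r IH]; first by rewrite big_nil; apply: homz1.
rewrite big_cons /=; case: ifP => [Pi|_]; last by rewrite add0n.
by rewrite PoszD; apply: homzM; rewrite ?h.
Qed.

Lemma homz_neg d F : d < 0 -> homz d F -> F = 0.
Proof.
move=> d0 /homzP h; apply/mpolyP => m; rewrite mcoeff0.
apply/eqP; apply: contraLR d0 => /h <-; lia.
Qed.

Lemma homz_const_coeff d F : d != 0 -> homz d F -> F@_0%MM = 0.
Proof.
move=> d0 /homzP h; apply/eqP; apply: contraNT d0 => /h <-.
by rewrite mdeg0.
Qed.

Lemma homz0_const F : homz 0 F -> F = (F@_0%MM)%:MP.
Proof.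
move=> /homzP h; apply/mpolyP => m; rewrite mcoeffC.
have [->|m0] := eqVneq m 0%MM; first by rewrite mulr1n mulr1.
rewrite mulr0n mulr0; apply/eqP; apply: contraNT m0 => /h.
by rewrite -mdeg_eq0 => -[->].
Qed.

(** Each monomial is charged to one variable that divides it. This is how a vanishing constant term
    yields a preimage under the Koszul differential. *)
Lemma homz_decomp d F : homz d F -> F@_0%MM = 0 ->
  exists G : 'rV[S]_3, (forall k, homz (d - 1) (G 0 k)) /\
    F = \sum_k 'X_k * G 0 k.
Proof.
move=> /homzP hF F0.
pose Q (F : S) := exists G : 'rV[S]_3, (forall k, homz (d - 1) (G 0 k)) /\
    F = \sum_k 'X_k * G 0 k.
rewrite -/(Q F) [F]mpolyE big_seq; apply: (big_ind Q).
- exists 0; split=> [k|]; first by rewrite mxE homz0.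
  by rewrite big1 // => k _; rewrite mxE mulr0.
- move=> _ _ [G1 [h1 ->]] [G2 [h2 ->]]; exists (G1 + G2); split=> [k|].
    by rewrite mxE; apply: homzD.
  by rewrite -big_split; apply: eq_bigr => k _; rewrite mxE mulrDr.
- move=> m; rewrite mcoeff_msupp => hm.
  have [k mk] : exists k, (0 < m k)%N.
    have : m != 0%MM by apply: contraNneq hm => ->; rewrite F0.
    move=> m0; apply/existsP; apply: contraNT m0 => /existsPn h.
    apply/eqP/mnmP => i; rewrite mnmE; move: (h i); lia.
  have hU : (U_(k) <= m)%MM by rewrite lep1mP -lt0n.
  exists (\row_j if j == k then F@_m *: 'X_[m - U_(k)] else 0); split=> [j|].
    rewrite mxE; case: ifP => _; last exact: homz0.
    apply: homzZ; apply/homzP => m'; rewrite mcoeffX.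
    have [<- _|_] := eqVneq (m - U_(k))%MM m'; last by rewrite eqxx.
    move: (hF m hm); rewrite -{1}[m](submK hU) mdegD mdeg1; lia.
  rewrite (bigD1 k) //= big1 => [|j /negPf jk]; last by rewrite mxE jk mulr0.
  by rewrite mxE eqxx addr0 -scalerAr -mpolyXD addmC submK.
Qed.
End Homogeneous.

Section LinearForms.
Variable K : fieldType.
Local Notation S := {mpoly K[3]}.

Definition cvec :=
  locked_with vec_key (fun a : 'rV[K]_3 => map_mx (@mpolyC 3 K) a : 'rV[S]_3).
Definition xvec : 'rV[S]_3 := \row_i 'X_i.
Definition lin (a : 'rV[K]_3) : S := dot (cvec a) xvec.

Definition homv d (v : 'rV[S]_3) := forall i, homz d (v 0 i).

Lemma cvec_map a : cvec a = map_mx (@mpolyC 3 K) a.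
Proof. by rewrite /cvec unlock. Qed.
Lemma cvecE a i : cvec a 0 i = (a 0 i)%:MP. Proof. by rewrite cvec_map mxE. Qed.
Lemma cvec0 : cvec 0 = 0. Proof. by rewrite cvec_map map_mx0. Qed.
Lemma cvecD a b : cvec (a + b) = cvec a + cvec b.
Proof. by rewrite !cvec_map map_mxD. Qed.
Lemma cvecB a b : cvec (a - b) = cvec a - cvec b.
Proof. by rewrite !cvec_map map_mxB. Qed.
Lemma cvecZ s a : cvec (s *: a) = s%:MP *: cvec a.
Proof. by rewrite !cvec_map map_mxZ. Qed.
Lemma dot_cvec a b : dot (cvec a) (cvec b) = (dot a b)%:MP.
Proof. by rewrite !dotE !cvecE !rmorphD !rmorphM. Qed.
Lemma cross_cvec a b : cross (cvec a) (cvec b) = cvec (cross a b).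
Proof. by apply: rv3P; rewrite !crossE !cvecE crossE rmorphB !rmorphM. Qed.
Lemma cvec_inj : injective cvec.
Proof. by move=> a b; rewrite !cvec_map; apply: map_mx_inj; apply: mpolyC_inj. Qed.
Lemma linD a b : lin (a + b) = lin a + lin b.
Proof. by rewrite /lin cvecD dotDl. Qed.
Lemma linZ s a : lin (s *: a) = s%:MP * lin a.
Proof. by rewrite /lin cvecZ dotZl. Qed.
Lemma homz_lin a : homz 1 (lin a).
Proof.
rewrite /lin dotE !cvecE !mxE; do !apply: homzD; rewrite -[1]add0r;
  by apply: homzM; [apply: homz_const | apply: homzX].
Qed.
Lemma homvX : homv 1 xvec. Proof. by move=> i; rewrite mxE homzX. Qed.
Lemma homv_cvec a : homv 0 (cvec a).
Proof. by move=> i; rewrite cvecE homz_const. Qed.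
Lemma homvD d u v : homv d u -> homv d v -> homv d (u + v).
Proof. by move=> hu hv i; rewrite mxE; apply: homzD. Qed.
Lemma homvB d u v : homv d u -> homv d v -> homv d (u - v).
Proof. by move=> hu hv i; rewrite !mxE; apply: homzB. Qed.
Lemma homv0 d : homv d 0. Proof. by move=> i; rewrite mxE homz0. Qed.
Lemma homvZ d e k F v : homz d F -> homv e v -> k = d + e -> homv k (F *: v).
Proof. by move=> hF hv -> i; rewrite mxE; apply: homzM. Qed.
Lemma homz_dot d e k u v : homv d u -> homv e v -> k = d + e -> homz k (dot u v).
Proof. by move=> hu hv ->; rewrite dotE; do !apply: homzD; apply: homzM. Qed.
Lemma homv_cross d e k u v : homv d u -> homv e v -> k = d + e -> homv k (cross u v).
Proof. by move=> hu hv -> ; elim/ord3P; rewrite !vE; apply: homzB; apply: homzM. Qed.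
Lemma homv_neg d v : d < 0 -> homv d v -> v = 0.
Proof. by move=> d0 h; apply/rowP => i; rewrite (homz_neg d0 (h i)) mxE. Qed.
End LinearForms.
Arguments xvec {K}.

(** * Restriction to a line *)

Definition dual_bases (K : fieldType) (A T B o w n : 'rV[K]_3) : Prop :=
  [/\ [/\ dot A o = 1, dot T o = 0 & dot B o = 0],
      [/\ dot A w = 0, dot T w = 1 & dot B w = 0],
      dot B n = 1
    & forall v, v = dot A v *: o + dot T v *: w + dot B v *: n].

(** A coordinate form [T] completes [A], [B] to a basis, and Cramer's rule gives the dual basis by
    cross products. *)
Lemma dual_bases_ex (K : fieldType) (A B : 'rV[K]_3) : cross A B != 0 ->
  exists T o w n, dual_bases A T B o w n.
Proof.
move=> AB; have [k hk] : exists k, cross B A 0 k != 0.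
  apply/existsP; apply: contraNT AB => /existsPn h.
  rewrite crossC oppr_eq0; apply/eqP/rowP => k; rewrite [RHS]mxE.
  by apply/eqP; move: (h k); rewrite negbK.
pose T : 'rV[K]_3 := delta_mx 0 k; pose D := det3 A T B.
have D0 : D != 0.
  suff -> : D = cross B A 0 k by [].
  rewrite /D det3_rot /det3 /T.
  by move: (cross B A) => u; rewrite dotE; elim/ord3P: k {hk T D}; rewrite !mxE /=; ring.
exists T, (D^-1 *: cross T B), (D^-1 *: cross B A), (D^-1 *: cross A T).
have e1 : D^-1 * D = 1 by rewrite mulVf.
split; [split|split| |]; rewrite ?dotZr.
- by [].
- by rewrite dot_crossl mulr0.
- by rewrite dot_crossr mulr0.
- by rewrite dot_crossr mulr0.
- by rewrite -[dot _ _]/(det3 T B A) -det3_rot.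
- by rewrite dot_crossl mulr0.
- by rewrite -[dot _ _]/(det3 B A T) det3_rot.
move=> v; rewrite !scalerA ![_ * D^-1]mulrC -!scalerA -!scalerDr.
by rewrite ![dot _ v]dotC det3_expand -/D scalerA e1 scale1r.
Qed.

Section Restriction.
Variable K : fieldType.
Local Notation S := {mpoly K[3]}.
Variables A T B o w n : 'rV[K]_3.
Hypothesis AB : dual_bases A T B o w n.

(* The restriction to the line [lin B = 0] in the chart [lin A = 1], which is
   parametrized by [o + 'X w]; [hmg d] homogenizes back to degree [d]. *)
Definition rho : S -> {poly K} :=
  mmap (@polyC K) (fun c => (o 0 c)%:P + w 0 c *: 'X).

HB.instance Definition _ := GRing.RMorphism.on rho.

Definition pvec (a : 'rV[K]_3) : 'rV[{poly K}]_3 := map_mx (@polyC K) a.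
Definition point : 'rV[{poly K}]_3 := pvec o + 'X *: pvec w.
Definition rhov (v : 'rV[S]_3) : 'rV[{poly K}]_3 := map_mx rho v.

Lemma rhoM F G : rho (F * G) = rho F * rho G. Proof. exact: rmorphM. Qed.
Lemma rhoD F G : rho (F + G) = rho F + rho G. Proof. exact: rmorphD. Qed.
Lemma rhoBr F G : rho (F - G) = rho F - rho G. Proof. exact: rmorphB. Qed.
Lemma rhoC c : rho c%:MP = c%:P. Proof. exact: mmapC. Qed.
Lemma rhov_dot u v : rho (dot u v) = dot (rhov u) (rhov v).
Proof. by rewrite !dotE !mxE !rmorphD !rmorphM. Qed.
Lemma rhov_cross u v : rhov (cross u v) = cross (rhov u) (rhov v).
Proof. by apply: rv3P; rewrite !vE rmorphB !rmorphM. Qed.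
Lemma rhov_cvec a : rhov (cvec a) = pvec a.
Proof. by apply/rowP => i; rewrite !mxE cvecE rhoC. Qed.
Lemma rhov_xvec : rhov xvec = point.
Proof.
by apply/rowP => i; rewrite !mxE /rho mmapX mmap1U -mul_polyC mulrC.
Qed.
Lemma rhovZ F v : rhov (F *: v) = rho F *: rhov v.
Proof. by apply/rowP => i; rewrite !mxE rmorphM. Qed.
Lemma rhovB u v : rhov (u - v) = rhov u - rhov v.
Proof. by apply/rowP => i; rewrite !mxE rmorphB. Qed.
Lemma pvec_dot a b : dot (pvec a) (pvec b) = (dot a b)%:P.
Proof. by rewrite !dotE !mxE !rmorphD !rmorphM. Qed.
Lemma pvec_cross a b : cross (pvec a) (pvec b) = pvec (cross a b).
Proof. by apply: rv3P; rewrite !vE !polyCB !polyCM. Qed.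
Lemma dot_pvec_point a : dot (pvec a) point = (dot a o)%:P + dot a w *: 'X.
Proof. by rewrite dotDr dotZr !pvec_dot mulrC mul_polyC. Qed.

Lemma rho_lin a : rho (lin a) = (dot a o)%:P + dot a w *: 'X.
Proof. by rewrite rhov_dot rhov_cvec rhov_xvec dot_pvec_point. Qed.

Lemma rhoA : rho (lin A) = 1.
Proof. by case: AB => -[a _ _] [b _ _] _ _; rewrite rho_lin a b scale0r addr0. Qed.
Lemma rhoT : rho (lin T) = 'X.
Proof.
by case: AB => -[_ a _] [_ b _] _ _; rewrite rho_lin a b scale1r add0r.
Qed.
Lemma rhoB : rho (lin B) = 0.
Proof.
by case: AB => -[_ _ a] [_ _ b] _ _; rewrite rho_lin a b scale0r addr0.
Qed.

Definition hmg (d : nat) (f : {poly K}) : S :=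
  \sum_(k < d.+1) (f`_k)%:MP * (lin T ^+ k * lin A ^+ (d - k)).

Lemma hmgD d f g : hmg d (f + g) = hmg d f + hmg d g.
Proof.
rewrite /hmg -big_split; apply: eq_bigr => k _.
by rewrite coefD rmorphD mulrDl.
Qed.
Lemma hmgZ d c (f : {poly K}) : hmg d (c *: f) = c%:MP * hmg d f.
Proof.
rewrite /hmg mulr_sumr; apply: eq_bigr => k _.
by rewrite coefZ rmorphM -mulrA.
Qed.
Lemma hmgX d (f : {poly K}) : hmg d.+1 ('X * f) = lin T * hmg d f.
Proof.
rewrite /hmg big_ord_recl coefXM /= mul0r add0r mulr_sumr.
apply: eq_bigr => k _; rewrite /bump leq0n add1n coefXM /= subSS exprS; ring.
Qed.
Lemma hmgS d (f : {poly K}) : (size f <= d.+1)%N -> hmg d.+1 f = lin A * hmg d f.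
Proof.
move=> h; rewrite /hmg big_ord_recr /= nth_default // mul0r addr0 mulr_sumr.
apply: eq_bigr => k _ /=; rewrite subSn ?exprS; last by rewrite -ltnS.
ring.
Qed.
Lemma homz_hmg (d : nat) f : homz d%:Z (hmg d f).
Proof.
apply: homz_sum => k _; rewrite -[d%:Z]add0r; apply: homzM; first exact: homz_const.
apply: (@homzM_eq _ ((1 : int) *+ k) ((1 : int) *+ (d - k))).
- exact/homzXn/homz_lin.
- exact/homzXn/homz_lin.
- rewrite !pmulrn !mulrzz; have := ltn_ord k; lia.
Qed.
Lemma rho_hmg d (f : {poly K}) : (size f <= d.+1)%N -> rho (hmg d f) = f.
Proof.
move=> h; rewrite rmorph_sum /=.
rewrite -[RHS](coefK f) poly_def (big_ord_widen _ (fun i => f`_i *: 'X^i) h).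
rewrite [RHS]big_mkcond /=; apply: eq_bigr => k _.
rewrite !rmorphM !rmorphXn /= rhoC rhoA rhoT expr1n mulr1 mul_polyC.
by case: ltnP => // hk; rewrite nth_default // scale0r.
Qed.

Lemma coordE k :
  'X_k = (o 0 k)%:MP * lin A + (w 0 k)%:MP * lin T + (n 0 k)%:MP * lin B :> S.
Proof.
have h j : o 0 k * A 0 j + w 0 k * T 0 j + n 0 k * B 0 j = (j == k)%:R.
  have [_ _ _ /(_ (delta_mx 0 j))/rowP/(_ k)] := AB.
  rewrite !mxE /= eq_sym => ->.
  have dd (a : 'rV[K]_3) : dot a (delta_mx 0 j) = a 0 j.
    by rewrite dotE; elim/ord3P: j; rewrite !mxE /=; ring.
  rewrite !dd; ring.
transitivity (\sum_j (o 0 k * A 0 j + w 0 k * T 0 j + n 0 k * B 0 j)%:MP * 'X_j : S).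
  rewrite (bigD1 k) //= h eqxx mul1r big1 ?addr0 // => j /negPf jk.
  by rewrite h jk mul0r.
by rewrite sum3 /lin !dotE !cvecE !mxE !rmorphD !rmorphM /=; ring.
Qed.

Lemma rho_coord k : rho 'X_k = (o 0 k)%:P + w 0 k *: 'X.
Proof. by rewrite /rho mmapX mmap1U. Qed.

(** Division by [lin B], the remainder being the homogenized restriction. Write [F] through the
    variables and expand each variable by [coordE]; [hmg] turns the factors ['X] and 1 into [lin T]
    and [lin A]. *)
Lemma rho_spec d (F : S) : homz d%:Z F ->
  (size (rho F) <= d.+1)%N /\
  exists2 G, homz (d%:Z - 1) G & F = hmg d (rho F) + lin B * G.
Proof.
elim: d F => [|d IH] F hF.
  rewrite (homz0_const hF) rhoC; split; first by rewrite size_polyC; case: eqP.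
  exists 0; first exact: homz0.
  by rewrite /hmg big_ord1 coefC !mulr1 mulr0 addr0.
have F0 : F@_0%MM = 0 by apply: homz_const_coeff hF.
have [G [hG eF]] := homz_decomp hF F0.
have {}hG k : homz d%:Z (G 0 k) by move: (hG k); congr (homz _ _); lia.
pose P (F : S) := (size (rho F) <= d.+2)%N /\
  exists2 G, homz d G & F = hmg d.+1 (rho F) + lin B * G.
suff : P F by case=> h [H hH eH]; split => //; exists H => //; move: hH; congr (homz _ _); lia.
rewrite eF; apply: (big_ind P).
- split; first by rewrite rmorph0 size_poly0.
  exists 0; first exact: homz0.
  rewrite rmorph0 mulr0 addr0 /hmg big1 // => i _.
  by rewrite coef0 mul0r.
- move=> F1 F2 [s1 [G1 h1 e1]] [s2 [G2 h2 e2]]; split.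
    by rewrite rmorphD; apply: leq_trans (size_polyD _ _) _; rewrite geq_max s1.
  exists (G1 + G2); first exact: homzD.
  by rewrite rmorphD hmgD {1}e1 {1}e2; ring.
move=> k _; have [s [H hH eH]] := IH _ (hG k).
have eXk : rho ('X_k * G 0 k) = o 0 k *: rho (G 0 k) + w 0 k *: ('X * rho (G 0 k)).
  by rewrite -mul_polyC scalerAl -mulrDl -rho_coord; apply: rmorphM.
rewrite /P eXk; split.
  apply: leq_trans (size_polyD _ _) _; rewrite geq_max.
  rewrite (leq_trans (size_scale_leq _ _)) ?(leq_trans s) //=.
  apply: leq_trans (size_scale_leq _ _) _.
  by apply: leq_trans (size_polyMleq _ _) _; rewrite size_polyX.
exists ('X_k * H + (n 0 k)%:MP * hmg d (rho (G 0 k))).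
  apply: homzD.
    by apply: (homzM_eq (homzX _ _) hH); lia.
  by rewrite -[d%:Z]add0r; apply: homzM; [apply: homz_const|apply: homz_hmg].
rewrite hmgD !hmgZ hmgX hmgS // {1}eH mulrDr {1}coordE; ring.
Qed.

(** Indexing by the size [N] instead of the degree includes degree -1, where both sides are 0. *)
Lemma size_rho N F : homz (N%:Z - 1) F -> (size (rho F) <= N)%N.
Proof.
case: N => [|N] hF; last first.
  by apply: (rho_spec _).1; move: hF; congr (homz _ _); lia.
by rewrite (homz_neg _ hF) // rmorph0 size_poly0.
Qed.

Lemma rho_lift N (f : {poly K}) : (size f <= N)%N -> exists2 F, homz (N%:Z - 1) F & rho F = f.
Proof.
case: N => [|N] hf; last first.
  exists (hmg N f); last exact: rho_hmg.
  by move: (homz_hmg N f); congr (homz _ _); lia.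
exists 0; first exact: homz0.
by move: hf; rewrite leqn0 size_poly_eq0 rmorph0 => /eqP ->.
Qed.

Lemma rho_eq0 d F : homz d F -> rho F = 0 ->
  exists2 G, homz (d - 1) G & F = lin B * G.
Proof.
case: d => d hF F0; last first.
  by exists 0; [apply: homz0 | rewrite mulr0 (homz_neg _ hF)].
have [_ [G hG]] := rho_spec hF; rewrite F0 => eF; exists G => //.
by rewrite eF /hmg big1 ?add0r // => i _; rewrite coef0 mul0r.
Qed.

Lemma rho_dvd F G : F = lin B * G -> rho F = 0.
Proof. by move=> ->; rewrite rhoM rhoB mul0r. Qed.
End Restriction.

(** * Fields tangent to a line and their trace on it *)

Section Tangency.
Variable K : fieldType.
Local Notation S := {mpoly K[3]}.
Implicit Types (F G : S) (eta : 'rV[S]_3).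

Definition ldvd (b : 'rV[K]_3) F := exists G, F = lin b * G.

Lemma ldvd0 b : ldvd b 0. Proof. by exists 0; rewrite mulr0. Qed.
Lemma ldvdD b F G : ldvd b F -> ldvd b G -> ldvd b (F + G).
Proof. by move=> [H ->] [L ->]; exists (H + L); rewrite mulrDr. Qed.
Lemma ldvdN b F : ldvd b F -> ldvd b (- F).
Proof. by move=> [H ->]; exists (- H); rewrite mulrN. Qed.
Lemma ldvdB b F G : ldvd b F -> ldvd b G -> ldvd b (F - G).
Proof. by move=> h1 h2; apply: ldvdD => //; apply: ldvdN. Qed.
Lemma ldvdMl b F G : ldvd b F -> ldvd b (F * G).
Proof. by move=> [H ->]; exists (H * G); rewrite mulrA. Qed.
Lemma ldvdMr b F G : ldvd b G -> ldvd b (F * G).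
Proof. by rewrite mulrC; apply: ldvdMl. Qed.
Lemma ldvd_lin b : ldvd b (lin b).
Proof. by exists 1; rewrite mulr1. Qed.
Lemma lin_ldvd b G : ldvd b (lin b * G).
Proof. by exists G. Qed.

(** [dot (cvec b) eta] is the derivation [eta] applied to [lin b], so this is the logarithmic
    condition along the line [b]. *)
Definition tangent (b : 'rV[K]_3) eta := ldvd b (dot (cvec b) eta).

Lemma tangentD b u v : tangent b u -> tangent b v -> tangent b (u + v).
Proof. by rewrite /tangent dotDr; apply: ldvdD. Qed.
Lemma tangentZ b F v : tangent b v -> tangent b (F *: v).
Proof. by rewrite /tangent dotZr; apply: ldvdMr. Qed.
Lemma tangentB b u v : tangent b u -> tangent b v -> tangent b (u - v).
Proof.
move=> h1 h2; apply: tangentD => //; rewrite -scaleN1r; exact: tangentZ.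
Qed.
Lemma tangentZl b F v : ldvd b F -> tangent b (F *: v).
Proof. by rewrite /tangent dotZr; apply: ldvdMl. Qed.
Lemma tangent0 b : tangent b 0.
Proof. by rewrite /tangent dot0r; apply: ldvd0. Qed.
Lemma tangent_cvec b q : dot b q = 0 -> tangent b (cvec q).
Proof. by move=> h; rewrite /tangent dot_cvec h; apply: ldvd0. Qed.

Variables A T B o w n : 'rV[K]_3.
Hypothesis AB : dual_bases A T B o w n.
Local Notation rho := (rho o w).
Local Notation rhov := (rhov o w).

Lemma ldvd_rho0 F : ldvd B F -> rho F = 0.
Proof. by case=> G; apply: (rho_dvd AB). Qed.

Lemma rho0_ldvd d F : homz d F -> rho F = 0 -> ldvd B F.
Proof. by move=> hF /(rho_eq0 AB hF)[G _ ->]; exists G. Qed.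

Lemma dot_pvecB_point : dot (pvec B) (point o w) = 0.
Proof.
by rewrite dot_pvec_point; case: AB => -[_ _ ->] [_ _ ->]; rewrite scale0r addr0.
Qed.

Lemma dot_pvecA_point : dot (pvec A) (point o w) = 1.
Proof.
by rewrite dot_pvec_point; case: AB => -[-> _ _] [-> _ _]; rewrite scale0r addr0.
Qed.

Lemma dot_pvecT_point : dot (pvec T) (point o w) = 'X.
Proof.
by rewrite dot_pvec_point; case: AB => -[_ -> _] [_ -> _]; rewrite scale1r add0r.
Qed.

(* Up to multiples of [xvec], the restriction of a tangent field to the line
   [lin B = 0] is determined by this scalar. *)
Definition transv eta : S := dot (cross xvec eta) (cvec n).

Lemma transvD u v : transv (u + v) = transv u + transv v.
Proof. by rewrite /transv crossDr dotDl. Qed.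
Lemma transvB u v : transv (u - v) = transv u - transv v.
Proof. by rewrite /transv crossBr dotBl. Qed.
Lemma transvZ F v : transv (F *: v) = F * transv v.
Proof. by rewrite /transv crossZr dotZl. Qed.
Lemma homz_transv d e eta : homv d eta -> e = d + 1 -> homz e (transv eta).
Proof.
move=> h ->; apply: (@homz_dot _ (d + 1) 0).
- by apply: (homv_cross (homvX _) h); rewrite addrC.
- exact: homv_cvec.
- by rewrite addr0.
Qed.

(** On the line both the point and the value of [eta] are orthogonal to [B], so their cross product
    is parallel to [B]; pairing with [n], where [dot B n = 1], reads off the factor. *)
Lemma rho_tangent eta : tangent B eta ->
  rhov (cross xvec eta) = rho (transv eta) *: pvec B.
Proof.
move=> /ldvd_rho0; rewrite rhov_dot rhov_cvec /transv rhov_dot rhov_cross rhov_xvec.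
rewrite rhov_cvec; set u := point o w; set v := rhov eta => h.
have h1 : cross (pvec B) (cross u v) = 0.
  by rewrite cross_cross h dot_pvecB_point !scale0r subr0.
have := cross_cross (pvec n) (pvec B) (cross u v).
rewrite h1 cross0r [dot (pvec n) (pvec B)]dotC pvec_dot.
case: AB => _ _ -> _; rewrite scale1r => /esym/eqP; rewrite subr_eq0 => /eqP e.
by rewrite -{1}e dotC.
Qed.

(** Zero trace makes [eta] parallel to [xvec] on the line. Once the factor is lifted to a form and
    that multiple of [xvec] subtracted, every coordinate vanishes on the line. *)
Lemma tangent_div d eta : homv d eta -> tangent B eta ->
    rho (transv eta) = 0 ->
  exists g eta', [/\ homz (d - 1) g, homv (d - 1) eta' &
    eta = g *: xvec + lin B *: eta'].
Proof.
move=> heta tB f0; have := rho_tangent tB; rewrite f0 scale0r rhov_cross rhov_xvec.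
set u := point o w; set v := rhov eta => uv0.
have ev : v = dot (pvec A) v *: u.
  have := cross_cross (pvec A) u v; rewrite uv0 cross0r dot_pvecA_point scale1r.
  by move=> /esym/eqP; rewrite subr_eq0 => /eqP.
case: d heta => d heta; last first.
  exists 0, 0; split; [exact: homz0 | exact: homv0|].
  by rewrite (homv_neg _ heta) // scale0r scaler0 addr0.
pose g : {poly K} := dot (pvec A) v.
(* The [T] coordinate of [eta] on the line is [g * 'X], which saves one degree over the bound for
   [g] itself. *)
have sg : (size g <= d)%N.
  have h : dot (pvec T) v = g * 'X by rewrite ev dotZr dot_pvecT_point.
  have {h} : (size (g * 'X : {poly K})%R <= d.+1)%N.
    rewrite -h -(rhov_cvec o w) -rhov_dot.
    apply: (size_rho AB); apply: (@homz_dot _ 0 d%:Z _ _ _ _ heta); last lia.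
    exact: homv_cvec.
  have [->|g0] := eqVneq g 0; first by rewrite size_poly0.
  by rewrite size_mulX.
have [G hG eG] := rho_lift AB sg.
pose tau : 'rV[S]_3 := eta - G *: xvec.
have htau : homv d tau.
  apply: homvB => //; apply: (homvZ hG (homvX _)); lia.
have : forall c, exists H, homz (d%:Z - 1) H /\ tau 0 c = lin B * H.
  move=> c; have : rho (tau 0 c) = 0.
    have -> : rho (tau 0 c) = rhov tau 0 c by rewrite [RHS]mxE.
    by rewrite /tau rhovB rhovZ rhov_xvec -/v eG {1}ev -/g subrr mxE.
  by case/(rho_eq0 AB (htau c)) => H hH ->; exists H.
case/fin_all_exists => H hH; exists G, (\row_c H c); split.
- exact: hG.
- by move=> c; rewrite mxE; case: (hH c).
- apply/rowP => c; have [_] := hH c; rewrite !mxE => <-; ring.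
Qed.
End Tangency.

(** * Gluing along the lines *)

Lemma cramer3 (R : comNzRingType) (b c d v : 'rV[R]_3) :
  det3 b c d *: v = det3 v c d *: b + det3 b v d *: c + det3 b c v *: d.
Proof. vring. Qed.

Section Arrangement.
Variables (K : fieldType) (n : nat) (a : 'I_n -> 'rV[K]_3) (a0 : 'rV[K]_3).
Local Notation S := {mpoly K[3]}.
Hypothesis a0_free : forall i, cross a0 (a i) != 0.
Hypothesis a0_generic : forall i j, i != j -> det3 a0 (a i) (a j) != 0.

Definition tangent_on (I : {set 'I_n}) (eta : 'rV[S]_3) :=
  forall i, i \in I -> tangent (a i) eta.

(** The left side is the first-order term of the determinant of the vectors [a i + lam i *: a0]; the
    higher terms contain [a0] twice and vanish. *)
Definition perspective (lam : 'I_n -> K) :=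
  forall i j k, det3 (a i) (a j) (a k) = 0 ->
    lam i * det3 a0 (a j) (a k) + lam j * det3 a0 (a k) (a i)
      + lam k * det3 a0 (a i) (a j) = 0.

(* On each line [i] of [I], the restriction of [psi] is [lam i] times the
   scalar [f_i] such that [cross xvec eta = f_i *: a i] on that line. *)
Definition glues (lam : 'I_n -> K) (I : {set 'I_n}) (eta : 'rV[S]_3) (psi : S) :=
  forall i, i \in I -> forall c,
    ldvd (a i) ((lam i)%:MP * cross xvec eta 0 c - psi * (a i 0 c)%:MP).

Lemma glueD lam I e1 e2 p1 p2 :
  glues lam I e1 p1 -> glues lam I e2 p2 -> glues lam I (e1 + e2) (p1 + p2).
Proof.
move=> h1 h2 i iI c; rewrite crossDr mxE.
rewrite mulrDr mulrDl opprD addrACA; exact: ldvdD (h1 i iI c) (h2 i iI c).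
Qed.

Lemma glueZ lam I e p F : glues lam I e p -> glues lam I (F *: e) (F * p).
Proof.
move=> h i iI c; rewrite crossZr mxE.
rewrite mulrCA -mulrA -mulrBr; exact: ldvdMr (h i iI c).
Qed.

(** Where [F] vanishes both sides of the gluing condition are 0, so [p] may be arbitrary. *)
Lemma glueZl lam (I : {set 'I_n}) e p F : (forall i, i \in I -> ldvd (a i) F) ->
  glues lam I (F *: e) (F * p).
Proof.
move=> h i iI c; rewrite crossZr mxE; apply: ldvdB.
  by apply: ldvdMr; apply: ldvdMl; apply: h.
by rewrite -mulrA; apply: ldvdMl; apply: h.
Qed.

(* The derivation [P *: (a m x a l)] is constant along the lines through the
   point where [m] and [l] meet. *)
Lemma glue_pencil (I : {set 'I_n}) lam m l (P : S) : perspective lam -> l != m ->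
    (forall i, i \in I -> det3 (a i) (a m) (a l) != 0 -> ldvd (a i) P) ->
  glues lam I (P *: cvec (cross (a m) (a l)))
    (P * ((lam m)%:MP * lin (a l) - (lam l)%:MP * lin (a m))).
Proof.
move=> hlam lm hI.
move=> i iI; have [h|h] := eqVneq (det3 (a i) (a m) (a l)) 0; last first.
  by apply: (@glueZl _ [set i]); rewrite ?inE // => k /set1P->; apply: hI.
suff : glues lam [set i] (cvec (cross (a m) (a l)))
          ((lam m)%:MP * lin (a l) - (lam l)%:MP * lin (a m)).
  by move/(glueZ P); apply; rewrite inE.
move=> _ /set1P -> c.
pose D := det3 a0 (a m) (a l).
have D0 : D != 0 by rewrite a0_generic // eq_sym.
(* Cramer coordinates of [a i] in the pencil of [a m] and [a l]. The condition on the triple says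
   that [lam i] is the same combination of [lam m] and [lam l]. *)
pose s := det3 a0 (a i) (a l) / D; pose t := det3 a0 (a m) (a i) / D.
have ea : a i = s *: a m + t *: a l.
  have := cramer3 a0 (a m) (a l) (a i); rewrite h scale0r add0r => e.
  by rewrite /s /t ![_ / D]mulrC -!scalerA -scalerDr -e scalerA mulVf ?scale1r.
have el : lam i = s * lam m + t * lam l.
  have := hlam _ _ _ h; rewrite -/D.
  have -> : det3 a0 (a l) (a i) = - (s * D) by rewrite /s divfK // /det3 crossC; vring.
  have -> : det3 a0 (a i) (a m) = - (t * D) by rewrite /t divfK // /det3 crossC; vring.
  move=> e; apply: (mulIf D0); apply/eqP; rewrite -subr_eq0 -{}e; apply/eqP; ring.
exists ((lam l)%:MP * (a m 0 c)%:MP - (lam m)%:MP * (a l 0 c)%:MP).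
have -> : lin (a i) = s%:MP * lin (a m) + t%:MP * lin (a l) by rewrite ea linD !linZ.
rewrite el -cross_cvec cross_cross [dot xvec (cvec (a m))]dotC -/(lin _).
rewrite [dot xvec _]dotC -/(lin _) ea !mxE !cvecE !rmorphD !rmorphM /=; ring.
Qed.

Section OneLine.
Variables (m : 'I_n) (T o w nn : 'rV[K]_3).
Hypothesis AB : dual_bases a0 T (a m) o w nn.
Local Notation rho := (rho o w).
Local Notation rhov := (rhov o w).
Local Notation transv := (transv nn).

(* The parameter of the point where the line [j] meets the line [m]. *)
Definition abscissa j : K := - (dot (a j) o / dot (a j) w).

(** [w] is the point at infinity of the line [m]; three independent forms cannot all vanish
    there. *)
Lemma dot_w_neq0 j : j != m -> dot (a j) w != 0.
Proof.
move=> jm; have := a0_generic jm; apply: contraNneq => h.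
case: AB => _ [h1 h2 h3] _ _.
have := det3_expand w a0 (a j) (a m); rewrite ![dot w _]dotC h1 h h3 !scale0r !addr0.
move/(congr1 (dot T)); rewrite dotZr h2 dot0r mulr1 => <-; exact: eqxx.
Qed.

Lemma rho_line j : j != m ->
  rho (lin (a j)) = dot (a j) w *: ('X - (abscissa j)%:P).
Proof.
move=> /dot_w_neq0 h; rewrite rho_lin /abscissa polyCN opprK scalerDr addrC.
by rewrite -[_ *: _%:P]mul_polyC -polyCM mulrC divfK.
Qed.

Lemma root_rho_line j t : j != m -> root (rho (lin (a j))) t = (t == abscissa j).
Proof. by move=> jm; rewrite rho_line // rootZ ?dot_w_neq0 // root_XsubC. Qed.

Lemma rho_line_neq0 j : j != m -> rho (lin (a j)) != 0.
Proof.
by move=> jm; rewrite rho_line // scaler_eq0 polyXsubC_eq0 (negPf (dot_w_neq0 jm)).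
Qed.

(** The meeting point [p] of [l] and [m] is [cross (a m) (a l)] up to a nonzero factor, so the
    determinant is, up to factors, the value of [a i] at [p]. *)
Lemma det3_abscissa i l : i != m -> l != m ->
  (det3 (a i) (a m) (a l) == 0) = (abscissa i == abscissa l).
Proof.
move=> im lm; have wi := dot_w_neq0 im; have wl := dot_w_neq0 lm.
case: AB => -[o0 _ om] [w0 _ wm] _ _.
pose p := o + abscissa l *: w.
have pl : dot (a l) p = 0 by rewrite dotDr dotZr /abscissa; field.
have := det3_expand p a0 (a m) (a l).
have -> : dot p a0 = 1 by rewrite dotC dotDr dotZr o0 w0 mulr0 addr0.
have -> : dot p (a m) = 0 by rewrite dotC dotDr dotZr om wm mulr0 addr0.
rewrite [dot p _]dotC pl !scale0r scale1r !addr0 => e.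
have -> : det3 (a i) (a m) (a l) =
    det3 a0 (a m) (a l) * (dot (a i) w * (abscissa l - abscissa i)).
  by rewrite /(det3 (a i)) e dotZr /p dotDr dotZr /abscissa; field; rewrite ?wi ?wl.
rewrite !mulf_eq0 (negPf wi) subr_eq0 /= [RHS]eq_sym.
by rewrite (negPf (a0_generic _)) // eq_sym.
Qed.

Lemma rho_line_factor j (f : {poly K}) N : j != m -> root f (abscissa j) ->
  (size f <= N.+1)%N ->
  exists2 g, f = rho (lin (a j)) * g & (size g <= N)%N.
Proof.
move=> jm /factor_theorem[g eg] sf; have w0 := dot_w_neq0 jm.
exists ((dot (a j) w)^-1 *: g).
  by rewrite rho_line // -scalerAl -scalerAr scalerA mulfV // scale1r mulrC.
apply: leq_trans (size_scale_leq _ _) _.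
have [->|g0] := eqVneq g 0; first by rewrite size_poly0.
by move: sf; rewrite eg size_Mmonic ?monicXsubC // size_XsubC addn2.
Qed.

(** At the common point of [j] and [m] the vector [cross xvec eta] is parallel to both [a j] and
    [a m], which are independent, so it is 0. *)
Lemma root_transv j eta : j != m -> tangent (a m) eta -> tangent (a j) eta ->
  root (rho (transv eta)) (abscissa j).
Proof.
move=> jm tm [H eH].
have := cross_cross (pvec (a j)) (rhov xvec) (rhov eta).
rewrite -rhov_cross (rho_tangent AB tm) crossZr -!(rhov_cvec o w) -!rhov_dot eH.
rewrite -/(lin _) rhoM -scalerA -scalerBr !rhov_cvec; set v := (_ - _) => e.
have [c hc] : exists c, cross (a j) (a m) 0 c != 0.
  apply/existsP; apply: contraNT (a0_generic jm) => /existsPn h.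
  suff e0 : cross (a j) (a m) = 0 by rewrite /det3 e0 dot0r.
  by apply/rowP => k; rewrite [RHS]mxE; apply/eqP; move: (h k); rewrite negbK.
rewrite pvec_cross in e.
have {e} : rho (transv eta) * (cross (a j) (a m) 0 c)%:P = rho (lin (a j)) * v 0 c.
  by have /rowP/(_ c) := e; rewrite [LHS]mxE [RHS]mxE [pvec _ _ _]mxE.
have : root (rho (lin (a j))) (abscissa j) by rewrite root_rho_line ?eqxx.
move: (rho (lin _)) (rho (transv _)) => f g /rootP f0.
move/(congr1 (fun f : {poly K} => f.[abscissa j])); rewrite !hornerM hornerC f0.
by move/eqP; rewrite mul0r mulf_eq0 (negPf hc) orbF => /eqP/rootP.
Qed.

Definition realized (I : {set 'I_n}) (N : nat) lam (eta : 'rV[S]_3) (f : {poly K}) :=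
  [/\ homv (N%:Z - 1) eta, tangent_on I eta, rho (transv eta) = f &
    exists2 psi, homz N%:Z psi & glues lam I eta psi].

Lemma realizedD I N lam e1 e2 f1 f2 :
  realized I N lam e1 f1 -> realized I N lam e2 f2 ->
  realized I N lam (e1 + e2) (f1 + f2).
Proof.
case=> h1 t1 r1 [p1 q1 g1] [h2 t2 r2 [p2 q2 g2]]; split.
- exact: homvD.
- by move=> i iI; apply: tangentD; [apply: t1 | apply: t2].
- by rewrite transvD rhoD r1 r2.
- by exists (p1 + p2); [apply: homzD | apply: glueD].
Qed.

Lemma realized_step I l N lam eta f : realized I N lam eta f ->
  realized (l |: I) N.+1 lam (lin (a l) *: eta) (rho (lin (a l)) * f).
Proof.
case=> h t r [p q g]; split.
- apply: (homvZ (homz_lin _) h); lia.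
- move=> i; rewrite in_setU1 => /predU1P[->|iI].
    exact/tangentZl/ldvd_lin.
  exact/tangentZ/t.
- by rewrite transvZ rhoM r.
- exists (lin (a l) * p).
    apply: (homzM_eq (homz_lin _) q); lia.
  move=> i; rewrite in_setU1 => /orP[/eqP->|iI].
    by apply: (@glueZl _ [set l]); rewrite ?inE // => k /set1P->; apply: ldvd_lin.
  exact: (glueZ _ g iI).
Qed.

(** The triple product gives [lin (a l) *: a m - lin (a m) *: a l], and the second term vanishes on
    [m]. *)
Lemma rho_transv_pencil l (P : S) :
  rho (transv (P *: cvec (cross (a m) (a l)))) = rho (P * lin (a l)).
Proof.
have [_ _ nm _] := AB; have B0 := rhoB AB.
rewrite transvZ /transv -cross_cvec cross_cross dotBl !dotZl !dot_cvec nm.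
rewrite [dot xvec (cvec (a m))]dotC -/(lin _) [dot xvec _]dotC -/(lin _).
by rewrite !(rhoM, rhoBr) B0 mul0r subr0 !rhoC mulr1.
Qed.

Lemma realized_pencil (I : {set 'I_n}) N lam l (P : S) : perspective lam -> l != m ->
    homz (N%:Z - 1) P ->
    (forall i, i \in I -> det3 (a i) (a m) (a l) != 0 -> ldvd (a i) P) ->
  realized I N lam (P *: cvec (cross (a m) (a l))) (rho (P * lin (a l))).
Proof.
move=> hlam lm hP hI; split.
- apply: (homvZ hP (homv_cvec _)); lia.
- move=> i iI; have [h|h] := eqVneq (det3 (a i) (a m) (a l)) 0.
    exact/tangentZ/tangent_cvec.
  exact/tangentZl/hI.
- exact: rho_transv_pencil.
exists (P * ((lam m)%:MP * lin (a l) - (lam l)%:MP * lin (a m))).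
  apply: (homzM_eq hP (e := 1)); last lia.
  by apply: homzB; rewrite -[1]add0r; apply: homzM; do ?apply: homz_const; apply: homz_lin.
exact: glue_pencil.
Qed.

(** Interpolation on [m]. Split off from [f] the factor of a line [l] of [J]. If no other line of
    [J] meets [m] in the same point, recurse on the quotient and multiply back by [lin (a l)].
    Otherwise the quotient need not vanish at that point, and a pencil field centred there first
    corrects its value. *)
Lemma realize (lam : 'I_n -> K) (J : {set 'I_n}) N (f : {poly K}) :
    perspective lam -> m \notin J -> J != set0 -> (#|J| <= N.+1)%N ->
    (size f <= N.+1)%N -> (forall j, j \in J -> root f (abscissa j)) ->
  exists eta, realized (m |: J) N lam eta f.
Proof.
move=> hlam; elim: {J}_.+1 {-2}J (ltnSn #|J|) N f => // k IH J hk N f mJ J0 JN sf rf.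
have [l lJ] := set0Pn _ J0.
have lm : l != m by apply: contraNneq mJ => <-.
have mJ' : m \notin J :\ l by apply: contra mJ => /setD1P[].
have cJ : #|J| = (#|J :\ l|).+1 by rewrite (cardsD1 l J) lJ.
have [g eg sg] := rho_line_factor lm (rf _ lJ) sf.
have [J'0|J'0] := eqVneq (J :\ l) set0.
  have [G hG eG] := rho_lift AB sg.
  exists (G *: cvec (cross (a m) (a l))).
  have := @realized_pencil (m |: J) N lam l G hlam lm hG.
  rewrite rhoM eG mulrC -eg; apply => i.
  have -> : J = [set l] by rewrite -(setD1K lJ) J'0 setU0.
  by rewrite !inE => /orP[] /eqP ->; rewrite /det3 ?dot_crossl ?dot_crossr eqxx.
have J'1 : (0 < #|J :\ l|)%N by rewrite card_gt0.
case: N => [|N] in JN sf sg *; first by move: JN J'1; rewrite cJ; case: #|_|.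
have cJ' : (#|J :\ l| < k)%N by rewrite cJ ltnS in hk.
have cJN : (#|J :\ l| <= N.+1)%N by rewrite cJ ltnS in JN.
have eJ : m |: J = l |: (m |: J :\ l) by rewrite setUCA setD1K.
have rg j : j \in J -> abscissa j != abscissa l -> root g (abscissa j).
  move=> jJ jl; have := rf j jJ; rewrite eg rootM root_rho_line //.
  by rewrite (negPf jl).
have [/existsP[j /andP[jJ /eqP jl]]|/existsPn hd] :=
  boolP [exists j, (j \in J :\ l) && (abscissa j == abscissa l)]; last first.
  have rg' j : j \in J :\ l -> root g (abscissa j).
    move=> jJ; apply: rg; first by case/setD1P: jJ.
    by have := hd j; rewrite jJ.
  have [eta h] := IH _ cJ' N g mJ' J'0 cJN sg rg'.
  by rewrite eJ eg; exists (lin (a l) *: eta); apply: realized_step.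
(* The lines of [J] missing the multiple point. Both [l] and [j] are left out, which keeps the
   degree of [P] within bounds. *)
pose Z := [set i in J | abscissa i != abscissa l].
have cZ : (#|Z| <= N)%N.
  suff : (#|Z| < #|J :\ l|)%N by lia.
  apply: proper_card; apply/properP; split; last first.
    by exists j => //; rewrite inE jl eqxx andbF.
  apply/subsetP => i; rewrite !inE => /andP[-> h]; rewrite andbT.
  by apply: contraNneq h => ->.
(* The power of [lin a0] only adjusts the degree: it restricts to 1 on the chart. *)
pose P : S := \prod_(i in Z) lin (a i) * lin a0 ^+ (N - #|Z|).
have hP : homz (N.+1%:Z - 1) P.
  apply: (@homzM_eq _ #|Z|%:Z ((1 : int) *+ (N - #|Z|))).
  - rewrite cardE -sum1_size big_enum /= sum1_card.
    have := @homz_prod K _ (index_enum 'I_n) (mem Z) (fun i => lin (a i)) (fun i _ => homz_lin _).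
    by rewrite -sum1_count sum1_card.
  - exact/homzXn/homz_lin.
  - rewrite pmulrn mulrzz; move: cZ; lia.
have rP : rho P = \prod_(i in Z) rho (lin (a i)).
  by rewrite rhoM rmorphXn /= [rho (lin a0)](rhoA AB) expr1n mulr1 rmorph_prod.
have Zm i : i \in Z -> i != m.
  by rewrite inE => /andP[iJ _]; apply: contraNneq mJ => <-.
have Pl : (rho P).[abscissa l] != 0.
  rewrite rP horner_prod; apply/prodf_neq0 => i iZ; rewrite -rootE.
  by rewrite root_rho_line ?Zm // eq_sym; move: iZ; rewrite inE => /andP[].
(* Chosen so that [g - c *: rho P] vanishes at the multiple point; at the other points [rho P] is 0
   already. *)
pose c := g.[abscissa l] / (rho P).[abscissa l].
pose g1 := g - c *: rho P.
have sg1 : (size g1 <= N.+1)%N.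
  apply: leq_trans (size_polyD _ _) _; rewrite geq_max sg size_polyN /=.
  by apply: leq_trans (size_scale_leq _ _) _; apply: (size_rho AB).
have rg1 i : i \in J :\ l -> root g1 (abscissa i).
  move=> /setD1P[_ iJ]; rewrite rootE hornerD hornerN hornerZ.
  have [->|il] := eqVneq (abscissa i) (abscissa l).
    by rewrite /c divfK // subrr.
  have /rootP -> := rg i iJ il; rewrite rP horner_prod (bigD1 i) /=; last first.
    by rewrite inE iJ.
  have : root (rho (lin (a i))) (abscissa i).
    by rewrite root_rho_line // Zm // inE iJ.
  by move/rootP => ->; rewrite mul0r mulr0 subr0.
have [eta h] := IH _ cJ' N g1 mJ' J'0 cJN sg1 rg1.
have hcP : homz (N.+1%:Z - 1) (c%:MP * P).
  by rewrite -[_ - 1]add0r; apply: homzM => //; apply: homz_const.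
exists (lin (a l) *: eta + (c%:MP * P) *: cvec (cross (a m) (a l))).
have -> : f = rho (lin (a l)) * g1 + rho (c%:MP * P * lin (a l)).
  rewrite /g1 2!rhoM rhoC eg; move: (rho P) (rho (lin _)) => p q.
  by rewrite mul_polyC mulrBr [X in _ + X]mulrC subrK.
rewrite eJ; apply: realizedD; first exact: realized_step.
apply: realized_pencil => // i; rewrite -eJ => /setU1P[->|iJ].
  by rewrite /det3 dot_crossl eqxx.
have im : i != m by apply: contraNneq mJ => <-.
rewrite det3_abscissa // => il; apply/ldvdMr/ldvdMl.
by rewrite (bigD1 i) /= ?inE ?iJ //; apply: lin_ldvd.
Qed.
End OneLine.
End Arrangement.

Section Gluing.
Variables (K : fieldType) (n : nat) (a : 'I_n -> 'rV[K]_3) (a0 : 'rV[K]_3).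
Local Notation S := {mpoly K[3]}.
Hypothesis a0_free : forall i, cross a0 (a i) != 0.
Hypothesis a0_generic : forall i j, i != j -> det3 a0 (a i) (a j) != 0.

Lemma ldvd_line_cancel i j d (F : S) : i != j -> homz d F ->
  ldvd (a i) (lin (a j) * F) -> ldvd (a i) F.
Proof.
move=> ij hF; have [T [o [w [nn AB]]]] := dual_bases_ex (a0_free i).
move=> /(ldvd_rho0 AB); rewrite rhoM => /eqP; rewrite mulf_eq0.
have ji : j != i by rewrite eq_sym.
rewrite (negPf (rho_line_neq0 a0_generic AB ji)) /= => /eqP.
exact: (rho0_ldvd AB hF).
Qed.

Lemma homz_ldvd i d (F : S) : homz d F -> ldvd (a i) F ->
  exists2 G, homz (d - 1) G & F = lin (a i) * G.
Proof.
move=> hF; have [T [o [w [nn AB]]]] := dual_bases_ex (a0_free i).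
by move/(ldvd_rho0 AB); apply: (rho_eq0 AB hF).
Qed.

Lemma lin_neq0 i : lin (a i) != 0.
Proof.
apply/eqP => h; have : cvec (a i) = 0.
  apply/rowP => k; rewrite cvecE mxE; have := congr1 (mcoeff U_(k)) h.
  rewrite /lin dotE !mcoeffD !cvecE !mxE !mcoeffCM !mcoeffXU mcoeff0 => e.
  rewrite -[RHS](rmorph0 (@mpolyC 3 K)) -{}e; congr (_%:MP).
  by elim/ord3P: k; rewrite /= !(mulr1, mulr0, addr0, add0r).
rewrite -[0]cvec0 => /cvec_inj a_0.
by have := a0_free i; rewrite a_0 cross0r eqxx.
Qed.

(** Multiples of [xvec] are tangent to every line, and [lin (a m)] does not vanish identically on
    any other line. *)
Lemma tangent_on_div (I : {set 'I_n}) m d g (eta eta' : 'rV[S]_3) :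
  homv d eta' -> tangent_on a I eta -> eta = g *: xvec + lin (a m) *: eta' ->
  tangent_on a (I :\ m) eta'.
Proof.
move=> h t e i /setD1P[im iI]; have := t i iI; rewrite /tangent e dotDr !dotZr.
move=> h1; have /(ldvdB h1) : ldvd (a i) (g * dot (cvec (a i)) xvec).
  exact/ldvdMr/ldvd_lin.
rewrite addrAC subrr add0r; apply: ldvd_line_cancel im _.
by apply: (homz_dot (homv_cvec _) h); rewrite add0r.
Qed.

Lemma glue_xvec lam (I : {set 'I_n}) g eta p :
  glues a lam I eta p -> glues a lam I (g *: xvec + eta) p.
Proof.
by move=> h i iI c; rewrite crossDr crossZr crossvv scaler0 add0r; apply: h.
Qed.

(** Subtract a field with the same trace on [m] that comes with its glued polynomial. The difference
    is [lin (a m) *: eta'] modulo [xvec], and [eta'] has again the degree of the statement for one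
    line fewer. *)
Lemma glue_ex lam (I : {set 'I_n}) (eta : 'rV[S]_3) : perspective a a0 lam ->
    homv (#|I|%:Z - 3) eta -> tangent_on a I eta ->
  exists2 psi, homz (#|I|%:Z - 2) psi & glues a lam I eta psi.
Proof.
move=> hlam; elim: {I}_.+1 {-2}I (ltnSn #|I|) eta => // k IH I hk eta heta teta.
case: (ltnP #|I| 3) => hI.
  exists 0; first exact: homz0.
  have -> : eta = 0 by apply: homv_neg heta; lia.
  by move=> i _ c; rewrite cross0r !mxE mulr0 mul0r subrr; apply: ldvd0.
have [m mI] : exists m, m \in I by apply/card_gt0P; lia.
have cI : #|I| = (#|I :\ m|).+1 by rewrite (cardsD1 m I) mI.
have [T [o [w [nn AB]]]] := dual_bases_ex (a0_free m).
have eI : m |: I :\ m = I by rewrite setD1K.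
pose N := (#|I| - 2)%N.
have hN : (#|I| = N.+2)%N by rewrite /N; lia.
(* The trace has degree at most [N] and there are [N.+1] other lines: exactly the limit case of
   [realize]. *)
have [eta1] : exists eta1, realized a o w nn (m |: I :\ m) N lam eta1 (rho o w (transv nn eta)).
  apply: (realize a0_generic AB hlam).
  - by rewrite !inE eqxx.
  - by rewrite -card_gt0; move: hI; rewrite cI; lia.
  - by move: hN; rewrite cI => -[->].
  - apply: (size_rho AB); apply: (homz_transv _ heta); lia.
  - move=> j /setD1P[jm jI]; apply: (root_transv a0_generic AB) => //; exact: teta.
rewrite eI => -[h1 t1 r1 [p1 q1 g1]].
have hd : homv (#|I|%:Z - 3) (eta - eta1).
  apply: homvB => // i; move: (h1 i); congr (homz _ _); lia.
have td : tangent_on a I (eta - eta1).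
  by move=> i iI; apply: tangentB; [apply: teta | apply: t1].
have [g [eta' [_ h' e']]] : exists g eta', [/\ homz (#|I|%:Z - 3 - 1) g,
     homv (#|I|%:Z - 3 - 1) eta' & eta - eta1 = g *: xvec + lin (a m) *: eta'].
  apply: (tangent_div AB hd (td m mI)).
  by rewrite transvB rhoBr r1 subrr.
have [|i|psi hpsi gpsi] := IH (I :\ m) _ eta' _ (tangent_on_div h' td e').
- by rewrite cI ltnS in hk.
- by move: (h' i); congr (homz _ _); rewrite cI; lia.
exists (p1 + lin (a m) * psi).
  apply: homzD; first by move: q1; congr (homz _ _); lia.
  by apply: (homzM_eq (homz_lin _) hpsi); rewrite cI; lia.
have -> : eta = eta1 + (g *: xvec + lin (a m) *: eta').
  by rewrite -e' addrC subrK.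
apply: glueD => //; apply: glue_xvec => i iI.
have [->|im] := eqVneq i m; last first.
  by apply: (glueZ _ gpsi); apply/setD1P.
apply: (@glueZl _ _ _ lam [set m]); last by rewrite inE.
by move=> j /set1P ->; apply: ldvd_lin.
Qed.
End Gluing.

(** * Koszul cycles of linear relations *)

Lemma cycle_splitting (R : comNzRingType) (A T B : 'cV[R]_3)
    (x e1 e2 y0 yT ym v : 'rV[R]_3) (la lt lb g0 gT gm t : R) :
  A *m (g0 *: x + lb *: y0 - lb *: e2 - lt *: e1) + T *m (gT *: x + lb *: yT + la *: e1)
    + B *m (gm *: x + lb *: ym + t *: v + la *: e2) =
  (T *m (la *: e1) - A *m (lt *: e1) + (B *m (la *: e2) - A *m (lb *: e2)))
    + (t *: B) *m v + (g0 *: A + gT *: T + gm *: B) *m x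
    + lb *: (A *m y0 + T *m yT + B *m ym).
Proof. by apply/matrixP => i j; rewrite !mxE !big_ord1 !mxE; ring. Qed.

Lemma mul_row_cross_mx (R : comNzRingType) p (u : 'rV[R]_3) (N : 'M[R]_(3, p)) :
  u *m (cross_mx u *m N) = 0.
Proof. by rewrite mulmxA mul_cross_mx mul0mx. Qed.

Lemma mul_row_col_row (R : comNzRingType) p (u : 'rV[R]_3) (g : 'cV_3) (v : 'rV[R]_p) :
  u *m (g *m v) = (u *m g) 0 0 *: v.
Proof. by rewrite mulmxA {1}[u *m g]mx11_scalar mul_scalar_mx. Qed.

Lemma cycle_cancel (R : comNzRingType) (u v w : 'rV[R]_3) (l t L : R) :
  (t * l) *: (L *: u) + l *: w = (l * L) *: v -> l *: w = l *: (L *: (v - t *: u)).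
Proof.
move=> e; apply/rowP => i; have /rowP/(_ i) := e; rewrite !mxE => {}e.
by apply: (addrI (t * l * (L * u 0 i))); rewrite e; ring.
Qed.

Section Cycles.
Variables (K : fieldType) (n : nat) (a : 'I_n -> 'rV[K]_3) (a0 : 'rV[K]_3).
Local Notation S := {mpoly K[3]}.
Hypothesis a0_free : forall i, cross a0 (a i) != 0.
Hypothesis a0_generic : forall i j, i != j -> det3 a0 (a i) (a j) != 0.

Definition log_field (I : {set 'I_n}) d (eta : 'rV[S]_3) :=
  homv d eta /\ tangent_on a I eta.

Lemma log_fieldD I d u v : log_field I d u -> log_field I d v -> log_field I d (u + v).
Proof.
move=> [h1 t1] [h2 t2]; split; first exact: homvD.
by move=> i iI; apply: tangentD; [apply: t1 | apply: t2].
Qed.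

Lemma log_fieldZ I d e k F v : homz e F -> log_field I d v -> k = e + d ->
  log_field I k (F *: v).
Proof.
move=> hF [h t] ->; split; first exact: (homvZ hF h).
by move=> i iI; apply/tangentZ/t.
Qed.

Lemma log_fieldC I d c v : log_field I d v -> log_field I d (c%:MP *: v).
Proof. by move=> h; apply: (log_fieldZ (homz_const c) h); rewrite add0r. Qed.

Lemma log_fieldB I d u v : log_field I d u -> log_field I d v -> log_field I d (u - v).
Proof.
move=> h1 h2; apply: log_fieldD => //.
by have := log_fieldC (-1) h2; rewrite rmorphN rmorph1 scaleN1r.
Qed.

Lemma log_field_comb I d u (Th : 'M[S]_3) :
  (forall k, log_field I d (row k Th)) -> log_field I d (cvec u *m Th).
Proof.
move=> h; have -> : cvec u *m Th =
    (u 0 c0)%:MP *: row c0 Th + (u 0 c1)%:MP *: row c1 Th + (u 0 c2)%:MP *: row c2 Th.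
  by apply/rowP => j; rewrite !mxE sum3 !cvecE.
by do !apply: log_fieldD; apply: log_fieldC.
Qed.

Lemma row_trmx_mul (R : comNzRingType) p (u : 'rV[R]_3) (v : 'rV[R]_p) k :
  row k (u^T *m v) = u 0 k *: v.
Proof. by apply/rowP => j; rewrite !mxE big_ord1 !mxE. Qed.

Lemma log_field_row I d u v k : log_field I d v ->
  log_field I d (row k ((cvec u)^T *m v)).
Proof. by move=> h; rewrite row_trmx_mul cvecE; apply: log_fieldC. Qed.

(** [cross b c] stands for the wedge of [b] and [c]; this is the Koszul differential of the wedge
    tensored with [eta]. *)
Lemma cross_mx_wedge b c (eta : 'rV[S]_3) :
  cross_mx xvec *m ((cvec (cross b c))^T *m eta) =
  (cvec b)^T *m (lin c *: eta) - (cvec c)^T *m (lin b *: eta).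
Proof.
rewrite mulmxA cross_mxE -cross_cvec cross_cross.
rewrite [dot xvec (cvec c)]dotC [dot xvec (cvec b)]dotC -/(lin b) -/(lin c).
have -> : (lin c *: cvec b - lin b *: cvec c)^T = lin c *: (cvec b)^T - lin b *: (cvec c)^T.
  by apply/colP => i; rewrite !mxE.
by rewrite mulmxBl -!scalemxAl -!scalemxAr.
Qed.

Lemma xvec_trmx_mul p b (v : 'rV[S]_p) : xvec *m ((cvec b)^T *m v) = lin b *: v.
Proof. by rewrite mul_trmx_row dotC. Qed.

Lemma dual_bases_decomp T B o w nn (Th : 'M[S]_3) : dual_bases a0 T B o w nn ->
  Th = (cvec a0)^T *m (cvec o *m Th) + (cvec T)^T *m (cvec w *m Th)
       + (cvec B)^T *m (cvec nn *m Th).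
Proof.
move=> AB; rewrite !mulmxA -!mulmxDl -[LHS]mul1mx; congr (_ *m _).
have e : 1%:M = a0^T *m o + T^T *m w + B^T *m nn.
  apply/row_matrixP => k; have [_ _ _ /(_ (delta_mx 0 k))] := AB.
  have dd (b : 'rV[K]_3) : dot b (delta_mx 0 k) = b 0 k.
    by rewrite dotE; elim/ord3P: k; rewrite !mxE /=; ring.
  by rewrite !dd row1 !linearD /= !row_trmx_mul.
by rewrite !cvec_map !map_trmx -!map_mxM -!map_mxD -e map_mx1.
Qed.

Variable l0 : 'I_n.
Implicit Types I : {set 'I_n}.

Definition lines (I : {set 'I_n}) : S := \prod_(i in I) lin (a i).

Definition node_field I i : 'rV[S]_3 :=
  lines (I :\ i :\ l0) *: cvec (cross (a i) (a l0)).

(* A matrix is an element of V^* \otimes Der(S), and left multiplication by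
   [xvec] is the Koszul differential. *)
Definition dep_cycle I (mu : 'I_n -> K) : 'M[S]_3 :=
  \sum_(i in I :\ l0) (cvec (mu i *: a i))^T *m node_field I i.

Lemma linesD1 I i : i \in I -> lines I = lin (a i) * lines (I :\ i).
Proof. by move=> iI; rewrite /lines (big_setD1 i). Qed.

Lemma homz_lines I : homz #|I|%:Z (lines I).
Proof.
have := @homz_prod K _ (index_enum 'I_n) (mem I) (fun i => lin (a i)) (fun i _ => homz_lin _).
by rewrite -sum1_count sum1_card.
Qed.

Lemma lines_neq0 I : lines I != 0.
Proof. by apply/prodf_neq0 => i _; apply: (lin_neq0 a0_free). Qed.

Lemma ldvd_lines I i : i \in I -> ldvd (a i) (lines I).
Proof. by move=> iI; rewrite (linesD1 iI); apply: lin_ldvd. Qed.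

Lemma log_field_node I i : i \in I :\ l0 -> l0 \in I ->
  log_field I (#|I|%:Z - 2) (node_field I i).
Proof.
move=> /setD1P[il iI] lI; split.
  apply: (homvZ (homz_lines _) (homv_cvec _)).
  have e1 : #|I| = (#|I :\ i|).+1 by rewrite (cardsD1 i) iI.
  have e2 : #|I :\ i| = (#|I :\ i :\ l0|).+1.
    by rewrite (cardsD1 l0) !inE lI eq_sym il.
  by rewrite e1 e2; lia.
move=> j jI; have [->|ji] := eqVneq j i.
  by apply/tangentZ/tangent_cvec; rewrite dot_crossl.
have [->|jl] := eqVneq j l0.
  by apply/tangentZ/tangent_cvec; rewrite dot_crossr.
by apply/tangentZl/ldvd_lines; rewrite !inE jl ji.
Qed.

Lemma node_field_setD1 I m i : m \in I -> i != m -> l0 != m ->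
  lin (a m) *: node_field (I :\ m) i = node_field I i.
Proof.
move=> mI im lm; rewrite scalerA; congr (_ *: _).
rewrite [RHS](@linesD1 _ m); last by rewrite !inE mI eq_sym lm eq_sym im.
congr (_ * lines _); apply/setP => j; rewrite !inE; do !case: (_ == _); by [].
Qed.

Lemma mulr_lin_inj i (u v : 'rV[S]_3) : lin (a i) *: u = lin (a i) *: v -> u = v.
Proof.
move=> e; apply/rowP => k; have /rowP/(_ k) := e; rewrite !mxE.
exact: (mulfI (lin_neq0 a0_free i)).
Qed.

Lemma dep_cycle_setD1 I m mu mu' : m \in I -> m != l0 ->
    (forall i, i != m -> mu i = mu' i) ->
  dep_cycle I mu =
    (cvec (mu m *: a m))^T *m node_field I m + lin (a m) *: dep_cycle (I :\ m) mu'.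
Proof.
move=> mI ml e; rewrite /dep_cycle (big_setD1 m) /=; last by rewrite !inE ml.
congr (_ + _); rewrite scaler_sumr.
have -> : I :\ l0 :\ m = I :\ m :\ l0 by apply/setP => j; rewrite !inE andbCA.
apply: eq_bigr => i /setD1P[il /setD1P[im iI]].
by rewrite e // scalemxAr node_field_setD1 // eq_sym.
Qed.

(* Removing a line [m]: the restriction of a cycle to [m] is killed by
   subtracting a boundary and a multiple of the cycle of [m]; the rest is
   divisible by [lin (a m)]. *)
Lemma cycle_dep I (Th : 'M[S]_3) c : l0 \in I ->
    (forall k, log_field I (#|I|%:Z - 2) (row k Th)) ->
    cross xvec (xvec *m Th) =
      lines (I :\ l0) *: cross xvec (cvec (cross c (a l0))) ->
  exists mu N (g : 'cV_3), (forall k, log_field I (#|I|%:Z - 3) (row k N)) /\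
    Th = dep_cycle I mu + cross_mx xvec *m N + g *m xvec.
Proof.
elim: {I}_.+1 {-2}I (ltnSn #|I|) Th c => // k IH I hk Th c lI hTh hc.
(* For the single line [l0] the degree is -1, so [Th] is 0. *)
have [I1|I1] := eqVneq #|I| 1%N.
  exists (fun=> 0), 0, 0; split=> [j|].
    rewrite linear0; split; [exact: homv0 | by move=> i _; apply: tangent0].
  rewrite mulmx0 mul0mx !addr0 /dep_cycle big1 => [|i _]; last first.
    by rewrite scale0r cvec0 trmx0 mul0mx.
  apply/row_matrixP => j; rewrite row0.
  by apply: homv_neg (hTh j).1; rewrite I1.
have I0 : (0 < #|I|)%N by apply/card_gt0P; exists l0.
have [m] : exists m, m \in I :\ l0.
  by apply/card_gt0P; move: I0 I1; rewrite (cardsD1 l0) lI; case: #|_|.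
move=> /setD1P[ml mI].
have cI : #|I| = (#|I :\ m|).+1 by rewrite (cardsD1 m I) mI.
have cIl : (0 < #|I :\ m|)%N by apply/card_gt0P; exists l0; rewrite !inE lI eq_sym ml.
have [T [o [w [nn AB]]]] := dual_bases_ex (a0_free m).
have eI : m |: I :\ m = I by rewrite setD1K.
pose N := (#|I| - 2)%N.
have hN : (#|I| = N.+2)%N by rewrite /N; lia.
have h0 := log_field_comb o hTh; have hT := log_field_comb w hTh.
have hm := log_field_comb nn hTh; have eTh := dual_bases_decomp Th AB.
set th0 := cvec o *m Th in h0 eTh; set thT := cvec w *m Th in hT eTh.
set thm := cvec nn *m Th in hm eTh.
clearbody th0 thT thm.
have [f fE] : {f : 'rV[S]_3 -> {poly K} | forall eta, f eta = rho o w (transv nn eta)}.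
  by exists (fun eta => rho o w (transv nn eta)).
have fD u v : f (u + v) = f u + f v by rewrite !fE transvD rhoD.
have fB u v : f (u - v) = f u - f v by rewrite !fE transvB rhoBr.
have fZ F v : f (F *: v) = rho o w F * f v by rewrite !fE transvZ rhoM.
have hsize th : log_field I (#|I|%:Z - 2) th -> (size (f th) <= #|I|)%N.
  case=> h _; rewrite fE; apply: (size_rho AB); apply: (homz_transv _ h); lia.
have hroot th j : log_field I (#|I|%:Z - 2) th -> j \in I :\ m ->
    root (f th) (abscissa a o w j).
  case=> _ t /setD1P[jm jI]; rewrite fE; apply: (root_transv a0_generic AB) => //; exact: t.
have hreal (g : {poly K}) : (size g <= N.+1)%N ->
    (forall j, j \in I :\ m -> root g (abscissa a o w j)) ->
    exists2 eta, log_field I (#|I|%:Z - 3) eta & f eta = g.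
  (* With [lam = 0] the perspective conditions hold trivially and [realize] is plain
     interpolation. *)
  move=> sg rg; have [||||eta] := realize a0_generic AB (lam := fun=> 0) (J := I :\ m) _ _ _ _ sg rg.
  - by move=> *; rewrite !mul0r !addr0.
  - by rewrite !inE eqxx.
  - by rewrite -card_gt0.
  - by move: hN; rewrite cI => -[->].
  rewrite eI => -[he te fe _]; exists eta; last by rewrite fE.
  split=> // i.
  by move: (he i); congr (homz _ _); rewrite hN; lia.
have eX : xvec *m Th = lin a0 *: th0 + lin T *: thT + lin (a m) *: thm.
  by rewrite eTh !mulmxDr !xvec_trmx_mul.
(* The right side of [hc] contains the factor [lin (a m)], so the trace of [xvec *m Th] on [m] is
   0. *)
have ef : f th0 = - ('X * f thT).
  have : f (xvec *m Th) = 0.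
    rewrite fE /transv hc dotZl rhoM (ldvd_rho0 AB) ?mul0r //.
    by apply: ldvd_lines; rewrite !inE ml.
  rewrite eX !fD !fZ (rhoA AB) (rhoT AB) (rhoB AB) mul1r mul0r addr0 => /eqP.
  by rewrite addr_eq0 => /eqP.
(* The factor ['X] in [ef] brings this trace one degree below the general bound [hsize], into the
   range of [hreal]. *)
have sT : (size (f thT) <= N.+1)%N.
  have := hsize _ h0; rewrite ef size_polyN hN.
  have [->|p0] := eqVneq (f thT) 0; first by rewrite size_poly0.
  by rewrite mulrC size_mulX.
have [e1 he1 fe1] := hreal _ sT (fun j => hroot _ j hT).
pose P := rho o w (lines (I :\ m)).
(* By genericity each of the [N.+1] forms has degree exactly one in the chart. *)
have P0 : P`_N.+1 != 0.
  have eP : P = (\prod_(i in I :\ m) dot (a i) w) *: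
      \prod_(i <- enum (I :\ m)) ('X - (abscissa a o w i)%:P).
    rewrite big_enum /= -scaler_prod /P rmorph_prod; apply: eq_bigr => i /setD1P[im _].
    exact: (rho_line a0_generic AB im).
  rewrite eP coefZ mulf_neq0 //.
    by apply/prodf_neq0 => i /setD1P[im _]; apply: (dot_w_neq0 a0_generic AB im).
  have := monic_prod_XsubC (enum (I :\ m)) xpredT (abscissa a o w).
  rewrite qualifE /= /lead_coef size_prod_XsubC -cardE => /eqP.
  by move: hN; rewrite cI => -[->] ->; rewrite oner_eq0.
have sP : (size P <= N.+2)%N.
  apply: (size_rho AB); move: (homz_lines (I :\ m)); congr (homz _ _).
  by move: hN; rewrite cI => -[->]; lia.
(* The trace of [thm] may be one degree too large for [hreal]. The node field of [m] has trace [P]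
   of that exact degree and removes the top coefficient; [tau] becomes [mu m]. *)
pose tau := (f thm)`_N.+1 / P`_N.+1.
pose u := f thm - tau *: P.
have su : (size u <= N.+1)%N.
  apply/leq_sizeP => j; rewrite leq_eqVlt => /predU1P[<-|hj].
    by rewrite coefB coefZ divfK // subrr.
  rewrite coefB coefZ !nth_default ?mulr0 ?subr0 //; first exact: leq_trans sP hj.
  by apply: leq_trans hj; rewrite -hN; apply: hsize.
have ru j : j \in I :\ m -> root u (abscissa a o w j).
  move=> jI; rewrite rootE hornerD hornerN hornerZ.
  have /rootP -> := hroot thm j hm jI.
  have : root P (abscissa a o w j).
    rewrite /P (linesD1 jI) rhoM rootM (root_rho_line a0_generic AB) ?eqxx //.
    by case/setD1P: jI.
  by move/rootP ->; rewrite mulr0 subr0.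
have [e2 he2 fe2] := hreal _ su ru.
have lmI : l0 \in I :\ m by rewrite !inE lI eq_sym ml.
have fnode : f (node_field I m) = P.
  by rewrite fE (rho_transv_pencil AB) mulrC -linesD1.
(* The components of [Th] after subtracting the boundary of [B] below and [tau] times the term of
   [m]; all three have zero trace on [m]. *)
pose x0 := th0 + lin T *: e1 + lin (a m) *: e2.
pose xT := thT - lin a0 *: e1.
pose xm := thm - lin a0 *: e2 - tau%:MP *: node_field I m.
have up b e : log_field I (#|I|%:Z - 3) e -> log_field I (#|I|%:Z - 2) (lin b *: e).
  by move=> he; apply: (log_fieldZ (homz_lin b) he); lia.
have hnode : log_field I (#|I|%:Z - 2) (node_field I m).
  by apply: log_field_node => //; rewrite !inE ml.
have hdiv xi : log_field I (#|I|%:Z - 2) xi -> f xi = 0 ->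
    exists g xi', log_field (I :\ m) (#|I :\ m|%:Z - 2) xi' /\
      xi = g *: xvec + lin (a m) *: xi'.
  rewrite fE => -[hxi txi] fxi.
  have [g [xi' [_ hxi' exi]]] := tangent_div AB hxi (txi m mI) fxi.
  exists g, xi'; split=> //; split; last exact: (tangent_on_div a0_free a0_generic hxi' txi exi).
  by move=> i; move: (hxi' i); congr (homz _ _); rewrite cI; lia.
have [|| g0 [y0 [hy0 ey0]]] := hdiv x0.
- by apply: log_fieldD; [apply: log_fieldD => // | ]; apply: up.
- by rewrite /x0 !fD !fZ (rhoT AB) (rhoB AB) mul0r addr0 fe1 ef addNr.
have [|| gT [yT [hyT eyT]]] := hdiv xT.
- by apply: log_fieldB => //; apply: up.
- by rewrite /xT fB fZ (rhoA AB) mul1r fe1 subrr.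
have [|| gm [ym [hym eym]]] := hdiv xm.
- by do !apply: log_fieldB => //; [apply: up | apply: log_fieldC].
- rewrite /xm 2!fB 2!fZ (rhoA AB) mul1r fe2 fnode rhoC mul_polyC /u.
  by rewrite subKr subrr.
pose G : 'cV[S]_3 := g0 *: (cvec a0)^T + gT *: (cvec T)^T + gm *: (cvec (a m))^T.
pose Th' := (cvec a0)^T *m y0 + (cvec T)^T *m yT + (cvec (a m))^T *m ym.
pose B := (cvec (cross T a0))^T *m e1 + (cvec (cross (a m) a0))^T *m e2.
have E : Th = cross_mx xvec *m B + (cvec (tau *: a m))^T *m node_field I m
              + G *m xvec + lin (a m) *: Th'.
  have E0 : th0 = (g0 *: xvec + lin (a m) *: y0) - lin (a m) *: e2 - lin T *: e1.
    by rewrite -ey0 /x0 addrK addrK.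
  have ET : thT = (gT *: xvec + lin (a m) *: yT) + lin a0 *: e1.
    by rewrite -eyT /xT subrK.
  have Em : thm = (gm *: xvec + lin (a m) *: ym) + tau%:MP *: node_field I m + lin a0 *: e2.
    by rewrite -eym /xm subrK subrK.
  rewrite eTh E0 ET Em /B [cross_mx _ *m _]mulmxDr !cross_mx_wedge cvecZ /Th' /G.
  have -> : (tau%:MP *: cvec (a m))^T = tau%:MP *: (cvec (a m))^T :> 'cV[S]_3.
    by rewrite linearZ.
  exact: cycle_splitting.
have hTh' j : log_field (I :\ m) (#|I :\ m|%:Z - 2) (row j Th').
  by rewrite /Th' !linearD /=; do !apply: log_fieldD; apply: log_field_row.
have hB j : log_field I (#|I|%:Z - 3) (row j B).
  by rewrite /B linearD /=; apply: log_fieldD; apply: log_field_row.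
clearbody B G Th'.
(* A single term of [dep_cycle] need not be a cycle. Subtracting it shifts [c] by [tau *: a m],
   which is why the induction allows a general [c] and works modulo [xvec]. *)
have hc' : cross xvec (xvec *m Th') =
    lines (I :\ m :\ l0) *: cross xvec (cvec (cross (c - tau *: a m) (a l0))).
  apply: (@mulr_lin_inj m).
  have eL : lines (I :\ l0) = lin (a m) * lines (I :\ m :\ l0).
    rewrite (@linesD1 _ m); last by rewrite !inE ml.
    by congr (_ * lines _); apply/setP => j; rewrite !inE andbCA.
  have := hc; rewrite E !mulmxDr mul_row_cross_mx add0r xvec_trmx_mul.
  rewrite -scalemxAr mul_row_col_row.
  rewrite 2!crossDr ![cross _ (_ *: _)]crossZr crossvv scaler0 addr0 linZ eL.
  rewrite crossBl crossZl cvecB cvecZ crossBr [cross _ (_ *: _)]crossZr.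
  exact: cycle_cancel.
have hk' : (#|I :\ m| < k)%N by rewrite cI ltnS in hk.
have [mu' [N' [g' [hN' eTh']]]] := IH (I :\ m) hk' Th' _ lmI hTh' hc'.
pose mu i := if i == m then tau else mu' i.
have emu i : i != m -> mu i = mu' i by rewrite /mu => /negPf ->.
exists mu, (B + lin (a m) *: N'), (G + lin (a m) *: g'); split=> [j|].
  rewrite linearD linearZ /=; apply: log_fieldD => //.
  split; first by apply: (homvZ (homz_lin _) (hN' j).1); rewrite cI; lia.
  move=> i iI; have [->|im] := eqVneq i m; first exact/tangentZl/ldvd_lin.
  by apply/tangentZ; apply: (hN' j).2; apply/setD1P.
rewrite (dep_cycle_setD1 mI ml emu) {1}E eTh' /mu eqxx.
rewrite !mulmxDr !mulmxDl -!scalemxAr -!scalemxAl !scalerDr.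
by rewrite [LHS](AC (3*3) ((2*4)*(1*5)*(3*6))).
Qed.
End Cycles.

Lemma row_cross_mx (R : comNzRingType) p (u : 'rV[R]_3) (N : 'M[R]_(3, p)) :
  [/\ row c0 (cross_mx u *m N) = u 0 c1 *: row c2 N - u 0 c2 *: row c1 N,
      row c1 (cross_mx u *m N) = u 0 c2 *: row c0 N - u 0 c0 *: row c2 N &
      row c2 (cross_mx u *m N) = u 0 c0 *: row c1 N - u 0 c1 *: row c0 N].
Proof.
by split; apply/rowP => j; rewrite !mxE sum3 !vE /=; ring.
Qed.

(** The explicit boundary of a concurrent triple, with [b] in the role of [a l0]. The coefficients
    [- p], [- q], 1 of the relation, each times the product of the two other forms, give the
    differential of a multiple of the wedge of [ai], [aj] tensored with the pencil field
    [cross ai aj], modulo [x]. *)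
Lemma dependent_triple_cycle (R : comNzRingType) (ai aj b x : 'rV[R]_3) (p q : R) :
  let ak := p *: ai + q *: aj in
  (- p * (dot aj x * dot ak x)) *: (ai^T *m cross ai b)
  + (- q * (dot ai x * dot ak x)) *: (aj^T *m cross aj b)
  + (dot ai x * dot aj x) *: (ak^T *m cross ak b) =
  cross_mx x *m ((cross ai aj)^T *m ((- (p * q) * dot b x) *: cross ai aj))
  - ((p * dot aj x * det3 ai b ak) *: ai^T + (q * dot ai x * det3 aj b ak) *: aj^T) *m x.
Proof.
move=> ak; rewrite mulmxA cross_mxE cross_cross.
apply/matrixP => i j; rewrite /ak /det3 !(mxE, big_ord1) !dotE !mxE.
elim/ord3P: j; rewrite !vE; ring.
Qed.

Lemma sum_seq3 (V : nmodType) (I : Type) (F : I -> V) i j k :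
  \sum_(l <- [:: i; j; k]) F l = F i + F j + F k.
Proof. by rewrite !big_cons big_nil addr0 addrA. Qed.

Lemma cycle_wedge_scale (R : comNzRingType) (b c : 'cV[R]_3) (q : 'rV[R]_3) (s F G : R) :
  s *: (F *: (b *m q)) + s *: (- G *: (c *m q)) = b *m (F *: (s *: q)) - c *m (G *: (s *: q)).
Proof. by apply/matrixP => i j; rewrite !mxE !big_ord1 !mxE; ring. Qed.

(** * Concurrent triples give boundaries *)

Section Pairing.
Variables (K : fieldType) (n : nat) (a : 'I_n -> 'rV[K]_3) (a0 : 'rV[K]_3).
Local Notation S := {mpoly K[3]}.
Hypothesis a0_free : forall i, cross a0 (a i) != 0.
Hypothesis a0_generic : forall i j, i != j -> det3 a0 (a i) (a j) != 0.
Variable l0 : 'I_n.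
Implicit Types I : {set 'I_n}.

(* When the lines [i], [j], [k] are concurrent these are the coefficients of a
   linear relation between [a i], [a j] and [a k], by Cramer's rule. *)
Definition triple_dep i j k (l : 'I_n) : K :=
  det3 a0 (a j) (a k) *+ (l == i) + det3 a0 (a k) (a i) *+ (l == j)
  + det3 a0 (a i) (a j) *+ (l == k).

(* [cross_mx xvec *m N] is a Koszul boundary; the multiples of the Euler field
   [xvec] vanish in Der(S) / S xvec, which is where D_0 is embedded. *)
Definition bounding (Th : 'M[S]_3) :=
  exists N (g : 'cV[S]_3), (forall k, log_field a setT (n%:Z - 3) (row k N)) /\
    Th = cross_mx xvec *m N + g *m xvec.

Lemma triple_dep_rot i j k l : triple_dep i j k l = triple_dep j k i l.
Proof. by rewrite /triple_dep -addrA addrC. Qed.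

Lemma eq_dep_cycle I mu mu' : mu =1 mu' -> dep_cycle a l0 I mu = dep_cycle a l0 I mu'.
Proof. by move=> e; apply: eq_bigr => i _; rewrite e. Qed.

Lemma triple_combination i j k : i != j -> det3 (a i) (a j) (a k) = 0 ->
  exists p q, [/\ a k = p *: a i + q *: a j,
     det3 a0 (a j) (a k) = det3 a0 (a i) (a j) * - p &
     det3 a0 (a k) (a i) = det3 a0 (a i) (a j) * - q].
Proof.
move=> ij h; have D0 := a0_generic ij; set D := det3 a0 _ _ in D0 *.
exists (det3 a0 (a k) (a j) / D), (det3 a0 (a i) (a k) / D); split.
- have := cramer3 a0 (a i) (a j) (a k).
  rewrite [det3 (a k) _ _]det3_rot h scale0r add0r -/D => e.
  by rewrite ![_ / D]mulrC -!scalerA -scalerDr -e scalerA mulVf ?scale1r.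
- by rewrite mulrN mulrC divfK // /det3 crossC; vring.
- by rewrite mulrN mulrC divfK // /det3 crossC; vring.
Qed.

Lemma dep_cycle_support (J : seq 'I_n) mu : uniq J -> l0 \notin J ->
  (forall l, l != l0 -> l \notin J -> mu l = 0) ->
  dep_cycle a l0 setT mu = \sum_(i <- J) (cvec (mu i *: a i))^T *m node_field a l0 setT i.
Proof.
move=> uJ lJ h; rewrite [RHS]big_uniq //= /dep_cycle (bigID (mem J)) /=.
rewrite [X in _ + X]big1 ?addr0 => [|i /andP[/setD1P[il _] iJ]]; last first.
  by rewrite h // scale0r cvec0 trmx0 mul0mx.
apply: eq_bigl => i; rewrite !inE andbT andb_idl // => iJ.
by apply: contraNneq lJ => <-.
Qed.

Lemma trmx_cvecZ s b : (cvec (s *: b))^T = s%:MP *: (cvec b)^T :> 'cV[S]_3.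
Proof. by rewrite cvecZ linearZ. Qed.

Lemma bounding_wedge (P : S) (b q : 'rV[K]_3) (g : 'cV_3) Th :
    homz (n%:Z - 3) P -> (forall l, dot (a l) q != 0 -> ldvd (a l) P) ->
    Th = cross_mx xvec *m ((cvec b)^T *m (P *: cvec q)) + g *m xvec ->
  bounding Th.
Proof.
move=> hP hq ->; exists ((cvec b)^T *m (P *: cvec q)), g; split=> // k.
apply: log_field_row; split.
  by apply: (homvZ hP (homv_cvec _)); rewrite addr0.
move=> l _; have [h|h] := eqVneq (dot (a l) q) 0.
  exact/tangentZ/tangent_cvec.
exact/tangentZl/hq.
Qed.

Lemma cycle_term_scale c b F (G H : S) (u : 'rV[S]_3) : c%:MP * F = G * H ->
  (cvec (c *: b))^T *m (F *: u) = G *: (H *: ((cvec b)^T *m u)).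
Proof. by move=> e; rewrite trmx_cvecZ -scalemxAl -scalemxAr !scalerA e. Qed.

Lemma cycle_scale_sub (c d : S) (A : 'M[S]_3) (b g : 'cV[S]_3) (q x : 'rV[S]_3) :
  c *: (A *m (b *m (d *: q)) - g *m x) = A *m (b *m ((c * d) *: q)) + (- c *: g) *m x.
Proof.
rewrite scalerBr scaleNr mulNmx; congr (_ - _); last by rewrite scalemxAl.
by rewrite -!scalemxAr scalerA.
Qed.

(** Up to the common factor [P] this is [dependent_triple_cycle]. The bounding field is
    [cross (a i) (a j)], tangent to the three concurrent lines, times [P] and [lin (a l0)], which
    vanish on all the others; its degree is (n - 4) + 1. *)
Lemma bounding_triple i j k : uniq [:: i; j; k; l0] ->
    det3 (a i) (a j) (a k) = 0 ->
  bounding (dep_cycle a l0 setT (triple_dep i j k)).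
Proof.
rewrite /= !inE !negb_or => /and4P[/and3P[ij ik il] /andP[jk jl] kl _] h.
have ji : j != i by rewrite eq_sym.
have ki : k != i by rewrite eq_sym.
have kj : k != j by rewrite eq_sym.
have [p [q [ek ep eq]]] := triple_combination ij h.
set D := det3 a0 (a i) (a j) in ep eq.
rewrite (@dep_cycle_support [:: i; j; k]); first last.
- move=> l _; rewrite !inE !negb_or /triple_dep => /and3P[/negPf-> /negPf-> /negPf->].
  by rewrite !addr0.
- by rewrite !inE !negb_or ![l0 == _]eq_sym il jl kl.
- by rewrite /= !inE negb_or ij ik jk.
rewrite sum_seq3.
have ei : triple_dep i j k i = D * - p.
  by rewrite /triple_dep eqxx (negPf ij) (negPf ik) !addr0.
have ej : triple_dep i j k j = D * - q.
  by rewrite /triple_dep eqxx (negPf ji) (negPf jk) addr0 add0r.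
have ekk : triple_dep i j k k = D.
  by rewrite /triple_dep eqxx (negPf ki) (negPf kj) !add0r.
pose P := lines a (setT :\ l0 :\ i :\ j :\ k).
have set_eq (A B : {set 'I_n}) : A =i B -> lines a A = lines a B.
  by move=> /setP ->.
have ni : lines a (setT :\ i :\ l0) = lin (a j) * (lin (a k) * P).
  rewrite (@linesD1 _ _ _ _ j) ?inE ?ji ?jl //.
  rewrite (@linesD1 _ _ _ _ k) ?inE ?ki ?kj ?kl //.
  congr (_ * (_ * _)); apply: set_eq => l; rewrite !inE.
  by case: (l == i); case: (l == j); case: (l == k); case: (l == l0).
have nj : lines a (setT :\ j :\ l0) = lin (a i) * (lin (a k) * P).
  rewrite (@linesD1 _ _ _ _ i) ?inE ?ij ?il //.
  rewrite (@linesD1 _ _ _ _ k) ?inE ?ki ?kj ?kl //.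
  congr (_ * (_ * _)); apply: set_eq => l; rewrite !inE.
  by case: (l == i); case: (l == j); case: (l == k); case: (l == l0).
have nk : lines a (setT :\ k :\ l0) = lin (a i) * (lin (a j) * P).
  rewrite (@linesD1 _ _ _ _ i) ?inE ?ik ?il //.
  rewrite (@linesD1 _ _ _ _ j) ?inE ?ji ?jk ?jl //.
  congr (_ * (_ * _)); apply: set_eq => l; rewrite !inE.
  by case: (l == i); case: (l == j); case: (l == k); case: (l == l0).
have cE : n%:Z = #|setT :\ l0 :\ i :\ j :\ k|%:Z + 4.
  have e1 : #|[set: 'I_n]| = (#|setT :\ l0|).+1 by rewrite (cardsD1 l0 setT) in_setT.
  have e2 : #|setT :\ l0| = (#|setT :\ l0 :\ i|).+1 by rewrite (cardsD1 i) !inE il.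
  have e3 : #|setT :\ l0 :\ i| = (#|setT :\ l0 :\ i :\ j|).+1.
    by rewrite (cardsD1 j) !inE jl ji.
  have e4 : #|setT :\ l0 :\ i :\ j| = (#|setT :\ l0 :\ i :\ j :\ k|).+1.
    by rewrite (cardsD1 k) !inE kl ki kj.
  by rewrite -[X in X%:Z = _]card_ord -cardsT e1 e2 e3 e4 -addn4.
have hP := homz_lines a (setT :\ l0 :\ i :\ j :\ k); rewrite -/P in hP.
have := dependent_triple_cycle (cvec (a i)) (cvec (a j)) (cvec (a l0)) xvec p%:MP q%:MP.
rewrite /= -!cvecZ -cvecD -ek !cross_cvec -!/(lin _) => E.
rewrite ei ej ekk /node_field ni nj nk.
rewrite (@cycle_term_scale _ _ _ (D%:MP * P) (- p%:MP * (lin (a j) * lin (a k)))); last first.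
  by rewrite rmorphM rmorphN /=; ring.
rewrite (@cycle_term_scale _ _ _ (D%:MP * P) (- q%:MP * (lin (a i) * lin (a k)))); last first.
  by rewrite rmorphM rmorphN /=; ring.
rewrite (@cycle_term_scale _ _ _ (D%:MP * P) (lin (a i) * lin (a j))); last by ring.
rewrite -!scalerDr E cycle_scale_sub.
apply: (@bounding_wedge (D%:MP * P * (- (p%:MP * q%:MP) * lin (a l0)))); last by [].
  apply: (@homzM_eq _ (0 + #|setT :\ l0 :\ i :\ j :\ k|%:Z) (0 + 1)).
  - by apply: homzM hP; apply: homz_const.
  - by apply: homzM (homz_lin _); rewrite -mpolyCM -mpolyCN; apply: homz_const.
  - by rewrite cE; ring.
move=> l hl; have [->|ll] := eqVneq l l0; first by apply/ldvdMr/ldvdMr/ldvd_lin.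
apply/ldvdMl/ldvdMr/ldvd_lines; rewrite !inE ll !andbT.
apply/and3P; split; apply: contraNneq hl => ->.
- by rewrite -/(det3 _ _ _) det3_rot h.
- by rewrite dot_crossr.
- by rewrite dot_crossl.
Qed.

(** Both remaining node fields are multiples of [cross (a i) (a j)], because [a l0] lies in the
    pencil, so the cycle is the differential of a single wedge. *)
Lemma bounding_triple_last i j : uniq [:: i; j; l0] ->
    det3 (a i) (a j) (a l0) = 0 ->
  bounding (dep_cycle a l0 setT (triple_dep i j l0)).
Proof.
rewrite /= !inE !negb_or => /and3P[/andP[ij il] jl _] h.
have ji : j != i by rewrite eq_sym.
have [p [q [ek ep eq]]] := triple_combination ij h.
set D := det3 a0 (a i) (a j) in ep eq.
rewrite (@dep_cycle_support [:: i; j]); first last.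
- by move=> l /negPf ll; rewrite !inE !negb_or /triple_dep ll => /andP[/negPf-> /negPf->];
    rewrite !addr0.
- by rewrite !inE !negb_or ![l0 == _]eq_sym il jl.
- by rewrite /= !inE ij.
rewrite big_cons big_seq1.
have ei : triple_dep i j l0 i = D * - p.
  by rewrite /triple_dep eqxx (negPf ij) (negPf il) !addr0.
have ej : triple_dep i j l0 j = D * - q.
  by rewrite /triple_dep eqxx (negPf ji) (negPf jl) addr0 add0r.
pose P := lines a (setT :\ l0 :\ i :\ j).
have set_eq (A B : {set 'I_n}) : A =i B -> lines a A = lines a B.
  by move=> /setP ->.
have ni : lines a (setT :\ i :\ l0) = lin (a j) * P.
  rewrite (@linesD1 _ _ _ _ j) ?inE ?ji ?jl //.
  congr (_ * _); apply: set_eq => l; rewrite !inE.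
  by case: (l == i); case: (l == j); case: (l == l0).
have nj : lines a (setT :\ j :\ l0) = lin (a i) * P.
  rewrite (@linesD1 _ _ _ _ i) ?inE ?ij ?il //.
  congr (_ * _); apply: set_eq => l; rewrite !inE.
  by case: (l == i); case: (l == j); case: (l == l0).
have cE : n%:Z = #|setT :\ l0 :\ i :\ j|%:Z + 3.
  have e1 : #|[set: 'I_n]| = (#|setT :\ l0|).+1 by rewrite (cardsD1 l0 setT) in_setT.
  have e2 : #|setT :\ l0| = (#|setT :\ l0 :\ i|).+1 by rewrite (cardsD1 i) !inE il.
  have e3 : #|setT :\ l0 :\ i| = (#|setT :\ l0 :\ i :\ j|).+1.
    by rewrite (cardsD1 j) !inE jl ji.
  by rewrite -[X in X%:Z = _]card_ord -cardsT e1 e2 e3 -addn3.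
have hP := homz_lines a (setT :\ l0 :\ i :\ j); rewrite -/P in hP.
have eil : cross (a i) (a l0) = q *: cross (a i) (a j).
  by rewrite ek crossDr !crossZr crossvv scaler0 add0r.
have ejl : cross (a j) (a l0) = - p *: cross (a i) (a j).
  by rewrite ek crossDr !crossZr crossvv scaler0 addr0 scaleNr -scalerN -crossC.
rewrite ei ej /node_field ni nj eil ejl [cvec (q *: _)]cvecZ [cvec (- p *: _)]cvecZ !scalerA.
rewrite (@cycle_term_scale _ _ _ (- (D * (p * q))%:MP * P) (lin (a j))); last first.
  by rewrite !rmorphM !rmorphN /=; ring.
rewrite (@cycle_term_scale _ _ _ (- (D * (p * q))%:MP * P) (- lin (a i))); last first.
  by rewrite !rmorphM !rmorphN /=; ring.
apply: (@bounding_wedge (- (D * (p * q))%:MP * P) (cross (a i) (a j)) (cross (a i) (a j)) 0).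
- apply: (homzM_eq _ hP); first by rewrite -mpolyCN; apply: homz_const.
  by rewrite cE; ring.
- move=> l hl; apply/ldvdMr/ldvd_lines; rewrite !inE andbT.
  apply/and3P; split; apply: contraNneq hl => ->.
  + by rewrite dot_crossr.
  + by rewrite dot_crossl.
  + by rewrite -/(det3 _ _ _) det3_rot h.
- by rewrite mul0mx addr0 cross_mx_wedge cycle_wedge_scale.
Qed.

Lemma bounding0 : bounding 0.
Proof.
exists 0, 0; split=> [k|]; last by rewrite mulmx0 mul0mx addr0.
by rewrite linear0; split; [apply: homv0 | move=> i _; apply: tangent0].
Qed.

(** Repeated indices give the zero relation, and rotation moves [l0], if it occurs, to the last
    place. *)
Lemma bounding_triple_dep i j k : det3 (a i) (a j) (a k) = 0 ->
  bounding (dep_cycle a l0 setT (triple_dep i j k)).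
Proof.
have dep0 (mu : 'I_n -> K) : (forall l, mu l = 0) -> bounding (dep_cycle a l0 setT mu).
  move=> h; rewrite /dep_cycle big1 => [|l _]; first exact: bounding0.
  by rewrite h scale0r cvec0 trmx0 mul0mx.
have same u v l : triple_dep u u v l = 0.
  rewrite /triple_dep -mulrnDl.
  have -> : det3 a0 (a u) (a v) + det3 a0 (a v) (a u) = 0 by vring.
  have -> : det3 a0 (a u) (a u) = 0 by vring.
  by rewrite !mul0rn addr0.
move=> h; have hr : det3 (a j) (a k) (a i) = 0 by rewrite -det3_rot.
have hrr : det3 (a k) (a i) (a j) = 0 by rewrite -det3_rot.
have [<-|ij] := eqVneq i j; first by apply: dep0 => l; apply: same.
have [<-|jk] := eqVneq j k.
  by apply: dep0 => l; rewrite triple_dep_rot same.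
have [<-|ki] := eqVneq k i.
  by apply: dep0 => l; rewrite 2!triple_dep_rot same.
have u3 u v : u != v -> u != l0 -> v != l0 -> uniq [:: u; v; l0].
  by move=> uv ul vl; rewrite /= !inE negb_or uv ul vl.
have rot u v w : bounding (dep_cycle a l0 setT (triple_dep v w u)) ->
    bounding (dep_cycle a l0 setT (triple_dep u v w)).
  by rewrite (eq_dep_cycle _ (triple_dep_rot u v w)).
have [e|kl] := eqVneq k l0.
  by subst k; apply: bounding_triple_last => //; apply: u3; rewrite // eq_sym.
have [e|il] := eqVneq i l0.
  by subst i; apply: rot; apply: bounding_triple_last => //; apply: u3; rewrite // eq_sym.
have [e|jl] := eqVneq j l0.
  by subst j; apply: (rot i l0 k); apply: (rot l0 k i); apply: bounding_triple_last => //; apply: u3.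
apply: bounding_triple => //.
by rewrite /= !inE !negb_or ij [i == k]eq_sym ki il jk jl kl.
Qed.
End Pairing.

(** * Boundaries are orthogonal to perspective vectors *)

Section Orthogonality.
Variables (K : fieldType) (n : nat) (a : 'I_n -> 'rV[K]_3) (a0 : 'rV[K]_3).
Local Notation S := {mpoly K[3]}.
Hypothesis a0_free : forall i, cross a0 (a i) != 0.
Hypothesis a0_generic : forall i j, i != j -> det3 a0 (a i) (a j) != 0.
Variable l0 : 'I_n.
Implicit Types I : {set 'I_n}.

Lemma vanish_on_lines I d (F : S) : homz d F -> d < #|I|%:Z ->
  (forall i, i \in I -> ldvd (a i) F) -> F = 0.
Proof.
elim: {I}_.+1 {-2}I (ltnSn #|I|) d F => // k IH I hk d F hF hd h.
have [I0|[m mI]] := set_0Vmem I.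
  by apply: homz_neg hF; move: hd; rewrite I0 cards0.
have cI : #|I| = (#|I :\ m|).+1 by rewrite (cardsD1 m I) mI.
have [G hG eF] := homz_ldvd a0_free hF (h m mI).
suff G0 : G = 0 by rewrite eF G0 mulr0.
apply: (IH (I :\ m) _ _ _ hG); first by rewrite cI ltnS in hk.
  by move: hd; rewrite cI; lia.
move=> i /setD1P[im iI]; apply: (ldvd_line_cancel a0_free a0_generic im hG).
by rewrite -eF; apply: h.
Qed.

Lemma line_coef_neq0 i : exists c, a i 0 c != 0.
Proof.
apply/existsP; apply: contraNT (a0_free i) => /existsPn h.
suff e : a i = 0 by rewrite e cross0r.
by apply/rowP => k; rewrite [RHS]mxE; apply/eqP; move: (h k); rewrite negbK.
Qed.

Lemma glue_unique lam (eta : 'rV[S]_3) p q :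
  homz (n%:Z - 1) p -> homz (n%:Z - 1) q ->
  glues a lam setT eta p -> glues a lam setT eta q -> p = q.
Proof.
move=> hp hq gp gq; apply/eqP; rewrite -subr_eq0; apply/eqP.
apply: (@vanish_on_lines setT (n%:Z - 1)); first exact: homzB.
  by rewrite cardsT card_ord; lia.
move=> i _; have [c hc] := line_coef_neq0 i.
have [G eG] := ldvdB (gq i (in_setT i) c) (gp i (in_setT i) c).
exists (((a i 0 c)^-1)%:MP * G).
have e : p - q = ((a i 0 c)^-1)%:MP * ((p - q) * (a i 0 c)%:MP).
  by rewrite mulrCA -rmorphM mulVf // rmorph1 mulr1.
rewrite e [RHS]mulrCA -eG; congr (_ * _).
move: (_%:MP * cross _ _ _ _) (a i 0 c)%:MP => x y; ring.
Qed.

Lemma glue_node lam i : perspective a a0 lam -> i != l0 ->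
  glues a lam setT (node_field a l0 setT i)
    (lines a (setT :\ i :\ l0) *
     ((lam i)%:MP * lin (a l0) - (lam l0)%:MP * lin (a i))).
Proof.
move=> hlam il; apply: (glue_pencil a0_generic) => //; first by rewrite eq_sym.
move=> l _ hl; apply: ldvd_lines; rewrite !inE andbT.
apply/andP; split; apply: contraNneq hl => ->.
- by rewrite det3_rot det3vv.
- by rewrite /det3 dot_crossl.
Qed.

Lemma glue_sum lam I (J : {set 'I_n}) (e : 'I_n -> 'rV[S]_3) (p : 'I_n -> S) :
  (forall i, i \in J -> glues a lam I (e i) (p i)) ->
  glues a lam I (\sum_(i in J) e i) (\sum_(i in J) p i).
Proof.
move=> h; elim/big_rec2: _ => [|i F eta iJ g].
  by move=> i _ c; rewrite cross0r mxE mulr0 mul0r subrr; apply: ldvd0.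
by apply: glueD => //; apply: h.
Qed.

(** The rows of the cycle are glued twice: by [phi], from the node fields, and by [cross xvec v],
    from the rows of [N]. Both have degree n - 1 and agree on n lines, hence coincide. Now
    [dot xvec] kills the second and turns the first into [lines a setT] times the sum. *)
Lemma dep_cycle_orthogonal mu lam N (g : 'cV[S]_3) : perspective a a0 lam ->
    \sum_i mu i *: a i = 0 ->
    (forall k, log_field a setT (n%:Z - 3) (row k N)) ->
    dep_cycle a l0 setT mu = cross_mx xvec *m N + g *m xvec ->
  \sum_i mu i * lam i = 0.
Proof.
move=> hlam hmu hN hE.
have hpsi k : exists psi, homz (n%:Z - 2) psi /\ glues a lam setT (row k N) psi.
  have := @glue_ex _ _ _ _ a0_free a0_generic lam setT (row k N) hlam.
  by rewrite cardsT card_ord => /(_ (hN k).1 (hN k).2)[psi h1 h2]; exists psi.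
have [psi hp] := fin_all_exists hpsi.
pose v : 'rV[S]_3 := \row_k psi k.
have gv k : glues a lam setT (row k N) (v 0 k) by rewrite mxE; case: (hp k).
have hv : homv (n%:Z - 2) v by move=> k; rewrite mxE; case: (hp k).
pose P i := lines a (setT :\ i :\ l0) *
     ((lam i)%:MP * lin (a l0) - (lam l0)%:MP * lin (a i)).
pose phi : 'rV[S]_3 := \sum_(i in setT :\ l0) P i *: cvec (mu i *: a i).
have hrow k : row k (dep_cycle a l0 setT mu) =
    row k (cross_mx xvec *m N) + (g k 0) *: xvec.
  by rewrite hE linearD /=; congr (_ + _); apply/rowP => j; rewrite !mxE big_ord1 !mxE.
have g1 k : glues a lam setT (row k (dep_cycle a l0 setT mu)) (phi 0 k).
  rewrite /dep_cycle linear_sum /phi summxE; apply: glue_sum => i /setD1P[il _].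
  rewrite /= row_trmx_mul mxE mulrC; apply: glueZ; exact: glue_node.
have g2 k : glues a lam setT (row k (dep_cycle a l0 setT mu)) (cross xvec v 0 k).
  rewrite hrow addrC; apply: glue_xvec.
  have [r0 r1 r2] := row_cross_mx xvec N.
  have sub s F t G : glues a lam setT (row s N) (v 0 s) -> glues a lam setT (row t N) (v 0 t) ->
      glues a lam setT (F *: row s N - G *: row t N) (F * v 0 s - G * v 0 t).
    move=> h1 h2; rewrite -scaleNr -mulNr; apply: glueD; exact: glueZ.
  by elim/ord3P: k; rewrite ?r0 ?r1 ?r2 !crossE; exact: (sub _ _ _ _ (gv _) (gv _)).
have hphi : homv (n%:Z - 1) phi.
  move=> k; rewrite summxE; apply: homz_sum => i /setD1P[il _].
  rewrite mxE cvecE -[_ - 1]addr0; apply: homzM (homz_const _).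
  apply: (homzM_eq (homz_lines _ _) (e := 1)).
    by apply: homzB; rewrite -[1]add0r; apply: homzM (homz_lin _); apply: homz_const.
  have e1 : #|[set: 'I_n]| = (#|setT :\ i|).+1 by rewrite (cardsD1 i setT) in_setT.
  have e2 : #|setT :\ i| = (#|setT :\ i :\ l0|).+1 by rewrite (cardsD1 l0) !inE eq_sym il.
  have en : n%:Z = #|setT :\ i :\ l0|%:Z + 2.
    by rewrite -[X in X%:Z = _]card_ord -cardsT e1 e2 -addn2.
  by rewrite en; ring.
have ephi : phi = cross xvec v.
  apply/rowP => k; apply: glue_unique (g1 k) (g2 k); first exact: hphi.
  by apply: (homv_cross (homvX _) hv); lia.
have : dot xvec phi = 0 by rewrite ephi dot_crossl.
pose s := \sum_(i in setT :\ l0) mu i * lam i.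
have e0 : \sum_(i in setT :\ l0) mu i *: a i = - (mu l0 *: a l0).
  apply/eqP; rewrite -addr_eq0 addrC; apply/eqP; rewrite -[RHS]hmu [RHS](bigD1 l0) //=.
  by congr (_ + _); apply: eq_bigl => i; rewrite !inE andbT.
have -> : dot xvec phi = lines a setT * (s + mu l0 * lam l0)%:MP.
  have dsum (F : 'I_n -> 'rV[S]_3) :
      dot xvec (\sum_(i in setT :\ l0) F i) = \sum_(i in setT :\ l0) dot xvec (F i).
    by elim/big_rec2: _ => [|i x y _ <-]; rewrite ?dot0r ?dotDr.
  have lsum : lin (\sum_(i in setT :\ l0) mu i *: a i) =
      \sum_(i in setT :\ l0) (mu i)%:MP * lin (a i).
    elim/big_rec2: _ => [|i x y _ <-]; last by rewrite linD linZ.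
    by rewrite /lin cvec0 dot0l.
  have lT : lines a setT = lin (a l0) * lines a (setT :\ l0) by apply: linesD1.
  rewrite dsum.
  transitivity (lines a (setT :\ l0) * (lin (a l0) * s%:MP - (lam l0)%:MP *
     \sum_(i in setT :\ l0) (mu i)%:MP * lin (a i))).
    rewrite rmorph_sum /= mulr_sumr mulr_sumr -sumrB mulr_sumr; apply: eq_bigr => i il.
    rewrite dotZr cvecZ dotZr dotC -/(lin _) /P (linesD1 _ il).
    have -> : setT :\ l0 :\ i = setT :\ i :\ l0 by apply/setP => l; rewrite !inE andbCA.
    by rewrite rmorphM /=; ring.
  rewrite -lsum e0 lT -scaleNr linZ rmorphN rmorphD !rmorphM /=; ring.
move/eqP; rewrite mulf_eq0 (negPf (lines_neq0 a0_free _)) /= mpolyC_eq0 => /eqP.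
move=> sE; rewrite -[RHS]sE [LHS](bigD1 l0) //= addrC; congr (_ + _).
by apply: eq_bigl => i; rewrite !inE andbT.
Qed.
End Orthogonality.

(** * Syzygies *)

Section Koszul.
Variable K : fieldType.
Local Notation S := {mpoly K[3]}.

Lemma mpolyX_neq0 (k : 'I_3) : 'X_k != 0 :> S.
Proof.
apply/eqP => /(congr1 (mcoeff U_(k))); rewrite mcoeffXU mcoeff0 eqxx => /eqP.
by rewrite oner_eq0.
Qed.

(** Modulo ['X_c2] the relation determines a form [G] with [u 0 c0] equal to [- 'X_c1 * G] and
    [u 0 c1] to ['X_c0 * G]. The quotients of the differences by ['X_c2] are the other entries of
    [y], and the last coordinate follows by cancelling ['X_c2]. *)
Lemma koszul_exact d (u : 'rV[S]_3) : homv d u -> dot xvec u = 0 ->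
  exists2 y, homv (d - 1) y & u = cross xvec y.
Proof.
case: d => d hu; last first.
  by exists 0; [apply: homv0 | rewrite cross0r (homv_neg _ hu)].
pose e k : 'rV[K]_3 := delta_mx 0 k.
have de k v : dot (e k) v = v 0 k.
  by rewrite /e dotE; elim/ord3P: k; rewrite !mxE /=; ring.
have AB : dual_bases (e c0) (e c1) (e c2) (e c0) (e c1) (e c2).
  split.
  - by split; rewrite de /e mxE.
  - by split; rewrite de /e mxE.
  - by rewrite de /e mxE.
  - by move=> v; rewrite !de /e; apply: rv3P; rewrite !mxE /=; ring.
have le k : lin (e k) = 'X_k :> S.
  rewrite /lin dotE !cvecE /e; elim/ord3P: k;
    by rewrite !mxE /= !(rmorph1, rmorph0); ring.
rewrite dotE [xvec _ _]mxE [xvec 0 c1]mxE [xvec 0 c2]mxE => E.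
set r := rho (e c0) (e c1).
have rD F G : r (F + G) = r F + r G by apply: rhoD.
have rM F G : r (F * G) = r F * r G by apply: rhoM.
have rB F G : r (F - G) = r F - r G by apply: rhoBr.
have r0 : r 'X_c0 = 1 by rewrite -le; apply: rhoA AB.
have r1 : r 'X_c1 = 'X by rewrite -le; apply: rhoT AB.
have r2 : r 'X_c2 = 0 by rewrite -le; apply: rhoB AB.
have rE : r (u 0 c0) = - ('X * r (u 0 c1)).
  have := congr1 r E; rewrite !rD !rM r0 r1 r2 mul1r mul0r addr0.
  by rewrite [r 0]rmorph0 => /eqP; rewrite addr_eq0 => /eqP.
have su (k : 'I_3) : (size (r (u ord0 k)) <= d.+1)%N.
  by apply: (size_rho AB); move: (hu k); congr (homz _ _); lia.
have s1 : (size (r (u ord0 c1)) <= d)%N.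
  have := su c0; rewrite rE size_polyN.
  have [->|p0] := eqVneq (r (u 0 c1)) 0; first by rewrite size_poly0.
  by rewrite mulrC size_mulX.
have [G hG eG] := rho_lift AB s1; rewrite -/r in eG.
have hX k : homz d ('X_k * G) by apply: (homzM_eq (homzX _ _) hG); lia.
have [|H1 hH1 eH1] := rho_eq0 AB (homzB (hu c1) (hX c0)).
  by rewrite -/r rB rM r0 mul1r eG subrr.
have [|H0 hH0 eH0] := rho_eq0 AB (homzD (hu c0) (hX c1)).
  by rewrite -/r rD rM r1 eG rE addNr.
rewrite le in eH0; rewrite le in eH1.
have u0 : u 0 c0 = 'X_c2 * H0 - 'X_c1 * G by rewrite -eH0 addrK.
have u1 : u 0 c1 = 'X_c2 * H1 + 'X_c0 * G by rewrite -eH1 subrK.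
have u2 : u 0 c2 = - ('X_c0 * H0 + 'X_c1 * H1).
  apply: (mulfI (mpolyX_neq0 c2)); apply/eqP; rewrite -subr_eq0 -[X in _ == X]E u0 u1.
  by apply/eqP; ring.
exists (vec3 H1 (- H0) (- G)).
  by elim/ord3P; rewrite mxE /=; [exact: hH1 | apply: homzN | apply: homzN].
apply: rv3P; rewrite !vE /= ?u0 ?u1 ?u2; ring.
Qed.

Lemma koszul_exact_mx r (D : 'I_r -> int) (s : 'M[S]_(3, r)) :
    (forall k j, homz (D j) (s k j)) -> xvec *m s = 0 ->
  exists2 Y : 'M[S]_(3, r), (forall k j, homz (D j - 1) (Y k j)) & s = cross_mx xvec *m Y.
Proof.
move=> hs Xs; have h j : exists y, homv (D j - 1) y /\ (col j s)^T = cross xvec y.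
  have hu : homv (D j) (col j s)^T by move=> k; rewrite !mxE.
  have [|y] := koszul_exact hu; last by exists y.
  have /rowP/(_ j) := Xs; rewrite !mxE sum3 => <-.
  by rewrite dotE ![(col j s)^T _ _]mxE ![col j s _ _]mxE.
have [y hy] := fin_all_exists h.
exists (\matrix_(k, j) y j 0 k) => [k j|]; first by rewrite mxE; apply: (hy j).1.
apply/matrixP => k j; have [_ /rowP/(_ k)] := hy j.
rewrite [_^T _ _]mxE [col _ _ _ _]mxE => ->.
have := cross_mxE xvec (y j) => /colP/(_ k); rewrite [_^T _ _ in RHS]mxE => <-.
by rewrite !mxE; apply: eq_bigr => i _; rewrite !mxE.
Qed.
End Koszul.

(** * Passing between D_0 and logarithmic fields modulo [xvec] *)

Section Derivations.
Variables (K : fieldType) (n : nat) (a : 'I_n -> 'rV[K]_3) (a0 : 'rV[K]_3).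
Local Notation S := {mpoly K[3]}.
Hypothesis a0_free : forall i, cross a0 (a i) != 0.
Hypothesis a0_generic : forall i j, i != j -> det3 a0 (a i) (a j) != 0.
Variable l0 : 'I_n.

Lemma der_app_lin (theta : 'rV[S]_3) b : der_app theta (lin b) = dot (cvec b) theta.
Proof.
have dX (i k : 'I_3) : ('X_k : S)^`M(i) = (k == i)%:R.
  rewrite mderivX mnmE; case: eqP => [->|_]; last by rewrite scale0r.
  by rewrite scale1r (_ : (U_(i) - U_(i))%MM = 0%MM) ?mpolyX0 //; apply/mnmP => l; rewrite !mnmE subnn.
rewrite /der_app /lin !dotE sum3 !cvecE ![xvec _ _]mxE !mul_mpolyC !mderivD !mderivZ !dX.
by rewrite /= -!mul_mpolyC; ring.
Qed.

Lemma der_app1 (theta : 'rV[S]_3) : der_app theta 1 = 0.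
Proof. by rewrite /der_app big1 // => i _; rewrite -mpolyC1 mderivC mulr0. Qed.

Lemma der_app_subZ (u v : 'rV[S]_3) g F :
  der_app (u - g *: v) F = der_app u F - g * der_app v F.
Proof.
rewrite /der_app mulr_sumr -sumrB; apply: eq_bigr => i _.
by rewrite !mxE; ring.
Qed.

Lemma der_app_lines (I : {set 'I_n}) (theta : 'rV[S]_3) (c : 'I_n -> S) :
  (forall i, dot (cvec (a i)) theta = lin (a i) * c i) ->
  der_app theta (lines a I) = (\sum_(i in I) c i) * lines a I.
Proof.
move=> h; rewrite /lines; elim/big_rec2: _ => [|i x y _ e].
  by rewrite der_app1 mul0r.
by rewrite der_app_leibniz der_app_lin h e; ring.
Qed.

Lemma der_app_xvec_lines (I : {set 'I_n}) : der_app xvec (lines a I) = #|I|%:R * lines a I.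
Proof.
rewrite (@der_app_lines _ _ (fun=> 1)) => [|i]; last by rewrite mulr1.
by rewrite sumr_const.
Qed.

(** On the line [i] the Leibniz rule leaves only the derivative of [lin (a i)] times the other
    forms, whose product is nonzero there. *)
Lemma D0_tangent d (theta : 'rV[S]_3) : homv d theta ->
  der_app theta (lines a setT) = 0 -> tangent_on a setT theta.
Proof.
move=> ht h i _; have [T [o [w [nn AB]]]] := dual_bases_ex (a0_free i).
apply: (rho0_ldvd AB (d := d)); first by apply: (homz_dot (homv_cvec _) ht); rewrite add0r.
move: h; rewrite (linesD1 a (in_setT i)) der_app_leibniz der_app_lin => h.
have := congr1 (rho o w) h.
rewrite rhoD [X in _ + X]rhoM (rhoB AB) mul0r addr0 [rho o w 0]rmorph0 => /eqP.
rewrite rhoM mulf_eq0 => /orP[/eqP //|].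
rewrite [rho o w (lines _ _)]rmorph_prod prodf_seq_eq0 => /hasP[j _ /andP[/setD1P[ji _]]].
by rewrite (negPf (rho_line_neq0 a0_generic AB ji)).
Qed.

Hypothesis charK : [pchar K] =i pred0.

Lemma natr_neq0 : n%:R != 0 :> S.
Proof.
have n0 : (0 < n)%N by case: n l0 => [[]|].
rewrite -(rmorph_nat (@mpolyC 3 K)) mpolyC_eq0.
by have /pcharf0P -> := charK; rewrite -lt0n.
Qed.

Lemma euler_D0_eq0 g : der_app (g *: xvec) (lines a setT) = 0 -> g = 0.
Proof.
have -> : g *: xvec = 0 - (- g) *: xvec by rewrite scaleNr opprK add0r.
rewrite der_app_subZ der_app_xvec_lines cardsT card_ord.
have -> : der_app (0 : 'rV[S]_3) (lines a setT) = 0.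
  by rewrite /der_app big1 // => i _; rewrite mxE mul0r.
rewrite mulNr opprK add0r mulrA => /eqP; rewrite mulf_eq0 (negPf (lines_neq0 a0_free _)) orbF.
by rewrite mulf_eq0 (negPf natr_neq0) orbF => /eqP.
Qed.

(** If [theta] multiplies each [lin (a i)] by [c i], it multiplies the product by their sum, while
    [xvec] multiplies it by [n]; characteristic zero permits subtracting the average. *)
Lemma D0_projection d (theta : 'rV[S]_3) : log_field a setT d theta ->
  exists2 g, homz (d - 1) g & der_app (theta - g *: xvec) (lines a setT) = 0.
Proof.
move=> [ht tt].
have hc i : exists c, homz (d - 1) c /\ dot (cvec (a i)) theta = lin (a i) * c.
  have hd : homz d (dot (cvec (a i)) theta).
    by apply: (homz_dot (homv_cvec _) ht); rewrite add0r.
  by have [c h1 h2] := homz_ldvd a0_free hd (tt i (in_setT i)); exists c.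
have [c cP] := fin_all_exists hc.
have nE : n%:R = (n%:R : K)%:MP :> S by rewrite rmorph_nat.
have n0 : (n%:R : K) != 0 by rewrite -(mpolyC_eq0 3) -nE natr_neq0.
exists ((n%:R^-1)%:MP * \sum_(i in setT) c i).
  rewrite -[d - 1]add0r; apply: homzM; first exact: homz_const.
  by apply: homz_sum => i _; case: (cP i).
rewrite der_app_subZ der_app_xvec_lines (@der_app_lines _ _ c) => [|i]; last by case: (cP i).
rewrite cardsT card_ord mulrA -[_ * _ * n%:R]mulrA [_ * n%:R]mulrC mulrA nE -rmorphM mulVf //.
by rewrite rmorph1 mul1r subrr.
Qed.

Lemma xvec_dep_cycle (I : {set 'I_n}) mu :
  xvec *m dep_cycle a l0 I mu =
    lines a (I :\ l0) *: cvec (cross (\sum_(i in I :\ l0) mu i *: a i) (a l0)).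
Proof.
rewrite /dep_cycle mulmx_sumr.
have -> : lines a (I :\ l0) *: cvec (cross (\sum_(i in I :\ l0) mu i *: a i) (a l0)) =
   \sum_(i in I :\ l0) lines a (I :\ l0) *: cvec (cross (mu i *: a i) (a l0)).
  rewrite -scaler_sumr; congr (_ *: _).
  elim/big_rec2: _ => [|i x y _ e]; first by rewrite cross0l cvec0.
  by rewrite crossDl cvecD e.
apply: eq_bigr => i il; rewrite xvec_trmx_mul linZ crossZl cvecZ (linesD1 a il) /node_field.
have -> : I :\ l0 :\ i = I :\ i :\ l0 by apply/setP => l; rewrite !inE andbCA.
by rewrite !scalerA; congr (_ *: _); ring.
Qed.

Lemma xvec_dep_cycle0 mu : \sum_i mu i *: a i = 0 ->
  xvec *m dep_cycle a l0 setT mu = 0.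
Proof.
move=> h; rewrite xvec_dep_cycle.
have -> : \sum_(i in setT :\ l0) mu i *: a i = - mu l0 *: a l0.
  apply/eqP; rewrite scaleNr -addr_eq0 addrC; apply/eqP.
  rewrite -[RHS]h [RHS](bigD1 l0) //=.
  by congr (_ + _); apply: eq_bigl => i; rewrite !inE andbT.
by rewrite crossZl crossvv scaler0 cvec0 scaler0.
Qed.

Lemma cross_xvec_cvec_eq0 (u : 'rV[K]_3) : cross xvec (cvec u) = 0 -> u = 0.
Proof.
move=> h; have E (i j : 'I_3) (p q : K) : i != j ->
    ('X_i * p%:MP - 'X_j * q%:MP : S) = 0 -> p = 0 /\ q = 0.
  move=> ij e; have := congr1 (mcoeff U_(i)) e; have := congr1 (mcoeff U_(j)) e.
  rewrite !mcoeffB ![_ * _%:MP]mulrC !mcoeffCM !mcoeffXU !eqxx mcoeff0.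
  rewrite (negPf ij) eq_sym (negPf ij) !(mulr0, mulr1, subr0, sub0r) => /eqP.
  by rewrite oppr_eq0 mcoeff0 => /eqP -> ->.
move: h => /rowP h.
have := h c0; have := h c1; rewrite !crossE !cvecE !mxE.
move=> /(E c2 c0 _ _ isT)[u0 u2] /(E c1 c2 _ _ isT)[_ u1].
by apply: rv3P; rewrite [RHS]mxE.
Qed.

(** [cycle_dep] with [c = 0] gives a relation only up to a multiple of [a l0]. The value [mu l0]
    does not enter [dep_cycle] and is reset to absorb that multiple. *)
Lemma cycle_dep_T (Th : 'M[S]_3) :
    (forall k, log_field a setT (n%:Z - 2) (row k Th)) -> xvec *m Th = 0 ->
  exists mu N (g : 'cV_3), [/\ \sum_i mu i *: a i = 0,
    forall k, log_field a setT (n%:Z - 3) (row k N) &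
    Th = dep_cycle a l0 setT mu + cross_mx xvec *m N + g *m xvec].
Proof.
move=> hTh XTh.
have hT : #|[set: 'I_n]| = n by rewrite cardsT card_ord.
have := @cycle_dep _ _ _ _ a0_free a0_generic l0 setT Th 0 (in_setT _).
rewrite hT => /(_ hTh); rewrite XTh cross0r cross0l cvec0 cross0r scaler0.
case=> // mu [N [g [hN eTh]]].
pose b := \sum_(i in setT :\ l0) mu i *: a i.
have cb : cross b (a l0) = 0.
  apply: cross_xvec_cvec_eq0.
  have : cross xvec (xvec *m Th) = 0 by rewrite XTh cross0r.
  rewrite eTh !mulmxDr mul_row_cross_mx addr0 mul_row_col_row crossDr [cross _ (_ *: xvec)]crossZr.
  rewrite crossvv scaler0 addr0 xvec_dep_cycle crossZr => h.
  apply/rowP => k; have /rowP/(_ k) := h; rewrite [LHS]mxE [RHS]mxE => /eqP.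
  by rewrite mulf_eq0 (negPf (lines_neq0 a0_free _)) [RHS]mxE => /eqP.
have [c hc] := line_coef_neq0 a0_free l0.
pose t := b 0 c / a l0 0 c.
have bE : b = t *: a l0.
  have h k : b 0 k * a l0 0 c = b 0 c * a l0 0 k.
    have := cb => /rowP e; have := e c0; have := e c1; have := e c2.
    rewrite !crossE !mxE => /eqP; rewrite subr_eq0 => /eqP e2 /eqP.
    rewrite subr_eq0 => /eqP e1 /eqP; rewrite subr_eq0 => /eqP e0.
    by clear hc t; elim/ord3P: k; elim/ord3P: c; rewrite ?e0 ?e1 ?e2.
  apply/rowP => k; rewrite mxE /t; apply: (mulIf hc).
  by rewrite h mulrAC divfK.
pose mu' i := if i == l0 then - t else mu i.
have mu'E i : i != l0 -> mu' i = mu i by rewrite /mu' => /negPf ->.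
have eD : dep_cycle a l0 setT mu' = dep_cycle a l0 setT mu.
  by apply: eq_bigr => i /setD1P[il _]; rewrite mu'E.
exists mu', N, g; split; [|exact: hN|by rewrite eD].
rewrite (bigD1 l0) //= {1}/mu' eqxx scaleNr -bE addrC; apply/eqP; rewrite subr_eq0; apply/eqP.
by apply: eq_big => i; [rewrite !inE andbT | move=> il; rewrite mu'E].
Qed.
End Derivations.

Section GradedParts.
Variable K : fieldType.
Local Notation S := {mpoly K[3]}.

Definition hpart (k : int) (F : S) : S :=
  if k is Posz d then pihomog mdeg d F else 0.

Lemma hpartD k : {morph hpart k : F G / F + G}.
Proof. by case: k => d F G /=; rewrite ?pihomogD ?addr0. Qed.

Lemma hpart0 k : hpart k 0 = 0.
Proof. by case: k => d //=; rewrite pihomog0. Qed.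

Lemma hpart_sum k (I : Type) (r : seq I) (P : pred I) (F : I -> S) :
  hpart k (\sum_(i <- r | P i) F i) = \sum_(i <- r | P i) hpart k (F i).
Proof.
elim/big_rec2: _ => [|i x y _ <-]; [exact: hpart0 | exact: hpartD].
Qed.

Lemma homz_homog (d : nat) (F : S) : homz d F = (F \is d.-homog).
Proof. by rewrite dhomogE; apply: eq_all => m. Qed.

Lemma hpart_homz k d (F : S) : homz d F -> hpart k F = if d == k then F else 0.
Proof.
case: d => d hF; last first.
  by rewrite (homz_neg _ hF) // hpart0 if_same.
case: k => k //=; rewrite homz_homog in hF.
case: eqP => [[<-]|dk]; first exact: pihomog_dE.
by apply: pihomog_ne0 hF; apply/eqP => e; apply: dk; rewrite e.
Qed.

Lemma homz_hpart k F : homz k (hpart k F).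
Proof.
case: k => k /=; last exact: homz0.
by rewrite homz_homog; apply: pihomogP.
Qed.

Lemma hpartM k d (F G : S) : homz d G -> hpart k (F * G) = hpart (k - d) F * G.
Proof.
move=> hG; elim/mpolyind: F => [|c m F _ _ IH]; first by rewrite mul0r !hpart0 mul0r.
have hm : homz (mdeg m)%:Z (c *: 'X_[m] : S).
  apply: homzZ; rewrite homz_homog; by rewrite dhomogX.
rewrite mulrDl !hpartD mulrDl IH; congr (_ + _).
rewrite (hpart_homz _ hm) (hpart_homz _ (homzM hm hG)).
have -> : ((mdeg m)%:Z + d == k) = ((mdeg m)%:Z == k - d) by rewrite -subr_eq opprK.
by case: ifP; rewrite ?mul0r.
Qed.

Lemma homogeneous_eltE m (e : 'I_m -> int) d (f : 'rV[S]_m) :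
  homogeneous_elt e d f <-> forall i, homz (d - e i) (f 0 i).
Proof.
split=> [/forallP h i|h].
  have := h i; congr is_true; apply: eq_all => mon.
  by rewrite -subr_eq opprK.
apply/forallP => i; have := h i; congr is_true; apply: eq_all => mon.
by rewrite -subr_eq opprK.
Qed.

(** Preimages supplied by exactness need not be homogeneous; keeping the part of the right degree in
    each coordinate does not change the image. *)
Lemma graded_lift r m (e : 'I_m -> int) (D : 'I_r -> int) (A : 'M[S]_(r, m)) d
    (f : 'rV[S]_r) :
  (forall j i, homz (D j - e i) (A j i)) -> (forall i, homz (d - e i) ((f *m A) 0 i)) ->
  exists2 s : 'rV[S]_r, (forall j, homz (d - D j) (s 0 j)) & s *m A = f *m A.
Proof.
move=> hA hf; exists (\row_j hpart (d - D j) (f 0 j)) => [j|].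
  by rewrite mxE homz_hpart.
apply/rowP => i; have := hpart_homz (d - e i) (hf i); rewrite eqxx => <-.
rewrite !mxE hpart_sum; apply: eq_bigr => j _; rewrite mxE (hpartM _ _ (hA j i)).
by congr (hpart _ _ * _); rewrite opprB addrA subrK.
Qed.
End GradedParts.

(** * From linear relations to minimal syzygies *)

Section Resolution.
Variables (K : fieldType) (n : nat) (a : 'I_n -> 'rV[K]_3) (a0 : 'rV[K]_3).
Local Notation S := {mpoly K[3]}.
Hypothesis a0_free : forall i, cross a0 (a i) != 0.
Hypothesis a0_generic : forall i j, i != j -> det3 a0 (a i) (a j) != 0.
Variable l0 : 'I_n.
Hypothesis charK : [pchar K] =i pred0.
Variables (M : 'rV[S]_3 -> Prop) (F : free_complex K 3 3).
Hypothesis ME : forall v, M v <-> der_app v (lines a setT) = 0.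
Hypothesis FP : minimal_graded_free_resolution (fun=> 0) M F.

Local Notation r0 := (rk F 0).
Local Notation r1 := (rk F 1).
Local Notation d0 := (@diff K 3 3 F 0).

Lemma aug_homz b k : homz (deg F 0 b) (aug F b k).
Proof.
have /homogeneous_eltE/(_ k) := aug_homogeneous FP b.
by rewrite mxE subr0.
Qed.

Lemma d0_homz b c : homz (deg F 1 b - deg F 0 c) (d0 b c).
Proof.
have /homogeneous_eltE/(_ c) := diff_homogeneous FP b.
by rewrite mxE.
Qed.

Lemma d0_aug : d0 *m aug F = 0.
Proof.
apply/row_matrixP => b; rewrite row_mul row0.
by apply/(exact_at_0 FP); exists (delta_mx 0 b); rewrite -rowE.
Qed.

Definition const0 (f : S) : K := f@_0%MM.

Lemma const0M f g : const0 (f * g) = const0 f * const0 g.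
Proof. exact: (rmorphM (mcoeff 0%MM)). Qed.

Lemma const0_sum (I : Type) (r : seq I) (P : pred I) (f : I -> S) :
  const0 (\sum_(i <- r | P i) f i) = \sum_(i <- r | P i) const0 (f i).
Proof. exact: (raddf_sum (mcoeff 0%MM)). Qed.

Lemma const0X k : const0 'X_k = 0.
Proof. by rewrite /const0 mcoeffX -mdeg_eq0 mdeg1. Qed.

Lemma const0_xvec p (H : 'M[S]_(3, p)) b : const0 ((xvec *m H) 0 b) = 0.
Proof.
rewrite mxE const0_sum big1 // => k _.
by rewrite const0M [xvec _ _]mxE const0X mul0r.
Qed.

(** By exactness two lifts differ by the image of the next differential, whose entries lie in the
    irrelevant ideal by minimality. So a syzygy has a well-defined class in F_1 tensored with K. *)
Lemma const_unique (g h : 'rV[S]_r1) : g *m d0 = h *m d0 ->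
  forall b, const0 (g 0 b) = const0 (h 0 b).
Proof.
move=> e b; have : (g - h) *m d0 = 0 by rewrite mulmxBl e subrr.
move/(exact_at_S FP) => [k /rowP/(_ b)].
rewrite !mxE => /(congr1 const0); rewrite const0_sum big1 => [|j _]; last first.
  by rewrite const0M /const0 (diff_minimal FP) mulr0.
by rewrite /const0 mcoeffB => /eqP; rewrite subr_eq0 => /eqP.
Qed.

Lemma M_homog_tangent d v : homv d v -> M v -> log_field a setT d v.
Proof. by move=> h /ME Mv; split=> //; apply: D0_tangent Mv. Qed.

Lemma aug_M (f : 'rV[S]_r0) : M (f *m aug F).
Proof. by apply/(aug_image FP); exists f. Qed.

Lemma aug_lift d v : homv d v -> M v ->
  exists2 s : 'rV[S]_r0, (forall j, homz (d - deg F 0 j) (s 0 j)) & v = s *m aug F.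
Proof.
move=> hv /(aug_image FP)[f ef].
have [||s hs es] := @graded_lift _ _ _ (fun=> 0) (deg F 0) (aug F) d f.
- by move=> j i; rewrite subr0 aug_homz.
- by move=> i; rewrite subr0 -ef.
by exists s => //; rewrite es.
Qed.

Lemma log_lift d v : log_field a setT d v ->
  exists2 s : 'rV[S]_r0, (forall j, homz (d - deg F 0 j) (s 0 j)) &
    exists g, s *m aug F = v - g *: xvec.
Proof.
move=> hv; have [g hg eg] := D0_projection a0_free l0 charK hv.
have hvg : homv d (v - g *: xvec).
  apply: homvB; first exact: hv.1.
  by apply: (homvZ hg (homvX _)); rewrite subrK.
have [|s hs es] := aug_lift hvg; first exact/ME.
by exists s => //; exists g.
Qed.

Lemma M_euler g : M (g *: xvec) -> g = 0.
Proof. by move/ME; apply: euler_D0_eq0. Qed.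

(** Lift [N] to [Y]. Then [s - cross_mx xvec *m Y] maps to multiples of [xvec] in [M], hence to 0,
    so it equals [H *m d0]. As [xvec] annihilates the subtracted term, [h = xvec *m H] works. *)
Lemma bounding_syzygy (s : 'M[S]_(3, r0)) : bounding a (s *m aug F) ->
  exists2 h : 'rV[S]_r1, xvec *m s = h *m d0 & forall b, const0 (h 0 b) = 0.
Proof.
move=> [N [g [hN es]]].
have hY k : exists y : 'rV[S]_r0, exists g', y *m aug F = row k N - g' *: xvec.
  by have [y _ [g' ey]] := log_lift (hN k); exists y, g'.
have [y /fin_all_exists[g' ey]] := fin_all_exists hY.
pose Y := \matrix_k y k; pose G : 'cV[S]_3 := \col_k g' k.
have eY : Y *m aug F = N - G *m xvec.
  apply/row_matrixP => k; rewrite row_mul rowK ey linearB /=; congr (_ - _).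
  by rewrite row_mul; apply/rowP => j; rewrite !mxE big_ord1 !mxE.
pose z := s - cross_mx xvec *m Y.
have ez : z *m aug F = (g + cross_mx xvec *m G) *m xvec.
  rewrite mulmxBl -mulmxA eY es mulmxBr mulmxDl [cross_mx xvec *m (G *m xvec)]mulmxA.
  by rewrite opprB addrC addrA subrK addrC.
have hz k : exists h : 'rV[S]_r1, row k z = h *m d0.
  apply/(exact_at_0 FP); have := aug_M (row k z).
  rewrite -row_mul ez row_mul.
  have -> : row k (g + cross_mx xvec *m G) *m xvec = (g + cross_mx xvec *m G) k 0 *: xvec.
    by apply/rowP => j; rewrite !mxE big_ord1 !mxE.
  by move/M_euler => ->; rewrite scale0r.
have [H eH] := fin_all_exists hz.
exists (xvec *m (\matrix_k H k)); last by move=> b; apply: const0_xvec.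
rewrite -mulmxA; have -> : \matrix_k H k *m d0 = z.
  by apply/row_matrixP => k; rewrite row_mul rowK eH.
by rewrite mulmxBr mul_row_cross_mx subr0.
Qed.

Lemma node_lifts : exists s : 'I_n -> 'rV[S]_r0, forall i, i != l0 ->
  (forall j, homz (n%:Z - 2 - deg F 0 j) (s i 0 j)) /\
  exists g, s i *m aug F = node_field a l0 setT i - g *: xvec.
Proof.
have h i : exists s : 'rV[S]_r0, i != l0 ->
    (forall j, homz (n%:Z - 2 - deg F 0 j) (s 0 j)) /\
    exists g, s *m aug F = node_field a l0 setT i - g *: xvec.
  have [il|il] := eqVneq i l0; first by exists 0.
  have hi : log_field a setT (n%:Z - 2) (node_field a l0 setT i).
    have := @log_field_node _ _ a l0 setT i; rewrite cardsT card_ord; apply.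
      by rewrite !inE il.
    by rewrite inE.
  by have [s hs eg] := log_lift hi; exists s.
by have [s hs] := fin_all_exists h; exists s.
Qed.

Section Lifts.
Variable s : 'I_n -> 'rV[S]_r0.
Hypothesis sP : forall i, i != l0 ->
  (forall j, homz (n%:Z - 2 - deg F 0 j) (s i 0 j)) /\
  exists g, s i *m aug F = node_field a l0 setT i - g *: xvec.

(** A lift of the Koszul cycle to F_0. For a relation [mu], multiplying by [xvec] lands in the
    kernel of [aug F], the image of [d0]: the zigzag between the two computations of Tor_1. *)
Definition dep_lift (mu : 'I_n -> K) : 'M[S]_(3, r0) :=
  \sum_(i in setT :\ l0) (cvec (mu i *: a i))^T *m s i.

Lemma dep_lift_homz mu k j : homz (n%:Z - 2 - deg F 0 j) (dep_lift mu k j).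
Proof.
rewrite /dep_lift summxE; apply: homz_sum => i /setD1P[il _].
rewrite mxE big_ord1 mxE cvecE -[_ - deg F 0 j]add0r.
by apply: homzM; [apply: homz_const | apply: (sP il).1].
Qed.

Lemma dep_lift_aug mu : exists g : 'cV[S]_3,
  dep_lift mu *m aug F = dep_cycle a l0 setT mu - g *m xvec.
Proof.
have h i : exists g, i != l0 -> s i *m aug F = node_field a l0 setT i - g *: xvec.
  have [il|il] := eqVneq i l0; first by exists 0.
  by have [_ [g eg]] := sP il; exists g.
have [g hg] := fin_all_exists h.
exists (\sum_(i in setT :\ l0) g i *: (cvec (mu i *: a i))^T).
rewrite /dep_lift /dep_cycle !mulmx_suml -sumrB; apply: eq_bigr => i /setD1P[il _].
by rewrite -mulmxA hg // mulmxBr -scalemxAl scalemxAr.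
Qed.

Lemma dep_lift_linear c mu nu :
  dep_lift (fun i => c * mu i + nu i) = c%:MP *: dep_lift mu + dep_lift nu.
Proof.
rewrite /dep_lift scaler_sumr -big_split /=; apply: eq_bigr => i _.
rewrite scalerDl -scalerA cvecD [cvec (c *: _)]cvecZ scalemxAl -mulmxDl.
by congr (_ *m _); apply/colP => k; rewrite !mxE.
Qed.

(* The coefficients of the syzygy attached to [mu] at the generators of degree
   [n - 1] of F_1. *)
Definition top_coeffs mu (v : 'I_r1 -> K) :=
  exists2 h : 'rV[S]_r1, xvec *m dep_lift mu = h *m d0 &
    forall b, deg F 1 b = n%:Z - 1 -> const0 (h 0 b) = v b.

Lemma top_coeffs_unique mu v w : top_coeffs mu v -> top_coeffs mu w ->
  forall b, deg F 1 b = n%:Z - 1 -> v b = w b.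
Proof.
move=> [h eh hv] [h' eh' hw] b db; rewrite -hv // -hw //.
by apply: const_unique; rewrite -eh -eh'.
Qed.

Lemma top_coeffs_linear c mu nu v w : top_coeffs mu v -> top_coeffs nu w ->
  top_coeffs (fun i => c * mu i + nu i) (fun b => c * v b + w b).
Proof.
move=> [h eh hv] [h' eh' hw]; exists (c%:MP *: h + h') => [|b db].
  by rewrite dep_lift_linear mulmxDr -scalemxAr mulmxDl -scalemxAl eh eh'.
rewrite !mxE -hv // -hw // -[in RHS](mpolyCK 3 c).
by rewrite -const0M /const0 mcoeffD.
Qed.

Lemma top_coeffs_ex mu : \sum_i mu i *: a i = 0 -> exists v, top_coeffs mu v.
Proof.
move=> hmu; have [g eg] := dep_lift_aug mu.
have [h eh] : exists h : 'rV[S]_r1, xvec *m dep_lift mu = h *m d0.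
  apply/(exact_at_0 FP); rewrite -mulmxA eg mulmxBr xvec_dep_cycle0 // mul_row_col_row.
  rewrite sub0r -scaleNr; have := aug_M (xvec *m dep_lift mu).
  rewrite -mulmxA eg mulmxBr xvec_dep_cycle0 // mul_row_col_row sub0r -scaleNr.
  by move/M_euler => ->; rewrite scale0r.
by exists (fun b => const0 (h 0 b)), h.
Qed.

Lemma top_coeffs_bounding mu : bounding a (dep_cycle a l0 setT mu) -> top_coeffs mu (fun=> 0).
Proof.
move=> [N [g [hN eN]]]; have [g' eg'] := dep_lift_aug mu.
have [|h eh h0] := @bounding_syzygy (dep_lift mu).
  by exists N, (g - g'); split=> //; rewrite eg' eN mulmxBl addrA.
by exists h.
Qed.

(** By minimality row [b] of [d0] is some [xvec *m t], and [t *m aug F] is a Koszul cycle of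
    logarithmic fields of degree n - 2; [cycle_dep_T] supplies [mu], and the remaining boundary adds
    no constant terms. *)
Lemma top_coeffs_surj b : deg F 1 b = n%:Z - 1 ->
  exists2 mu, \sum_i mu i *: a i = 0 & top_coeffs mu (fun c => (c == b)%:R).
Proof.
move=> db.
have hG j : exists G : 'rV[S]_3, (forall k, homz (n%:Z - 2 - deg F 0 j) (G 0 k)) /\
    d0 b j = \sum_k 'X_k * G 0 k.
  have [G [h1 h2]] := homz_decomp (d0_homz b j) (diff_minimal FP b j).
  exists G; split=> // k; move: (h1 k); congr (homz _ _); rewrite db.
  by rewrite addrAC -[_ - 1 - 1]addrA.
have [G hGP] := fin_all_exists hG.
pose t : 'M[S]_(3, r0) := \matrix_(k, j) G j 0 k.
have et : xvec *m t = row b d0.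
  apply/rowP => j; rewrite [RHS]mxE (hGP j).2 mxE; apply: eq_bigr => k _.
  by rewrite [t _ _]mxE [xvec _ _]mxE.
have hTh k : log_field a setT (n%:Z - 2) (row k (t *m aug F)).
  apply: M_homog_tangent; last by rewrite row_mul; apply: aug_M.
  move=> c; rewrite !mxE; apply: homz_sum => j _; rewrite [t _ _]mxE.
  by apply: (homzM_eq ((hGP j).1 k) (aug_homz j c)); rewrite subrK.
have [|mu [N [g [hmu hN eTh]]]] := cycle_dep_T a0_free a0_generic l0 hTh.
  by rewrite mulmxA et -row_mul d0_aug linear0.
have [g' eg'] := dep_lift_aug mu.
have [|h eh h0] := @bounding_syzygy (t - dep_lift mu).
  exists N, (g + g'); split=> //; rewrite mulmxBl eTh eg' mulmxDl.
  by rewrite opprB -!addrA [LHS]addrC -!addrA addNr addr0.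
exists mu => //; exists (delta_mx 0 b - h) => [|c _].
  by rewrite mulmxBl -eh mulmxBr et -rowE opprB addrC subrK.
rewrite !mxE eqxx /= /const0 mcoeffB -/(const0 (h 0 c)) h0 subr0.
by case: eqP => _; rewrite ?mcoeff0 // mcoeff1 eqxx.
Qed.

(** Without constant terms [h] is [xvec *m Hm], so [dep_lift mu - Hm *m d0] is a Koszul cycle over
    the free module F_0 and thus a boundary. Applying [aug F] bounds the cycle of [mu] modulo
    [xvec]. *)
Lemma top_coeffs0_orthogonal mu lam : perspective a a0 lam ->
  \sum_i mu i *: a i = 0 -> top_coeffs mu (fun=> 0) -> \sum_i mu i * lam i = 0.
Proof.
move=> hlam hmu [f ef f0].
have hf j : homz (n%:Z - 1 - deg F 0 j) ((f *m d0) 0 j).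
  rewrite -ef mxE; apply: homz_sum => k _; rewrite [xvec _ _]mxE.
  apply: (homzM_eq (homzX _ _) (dep_lift_homz mu k j)); ring.
have [h hh eh] := graded_lift d0_homz hf.
(* At generators of degree other than n - 1 the constant term vanishes by degree, since [h] is
   homogeneous. *)
have h0 b : const0 (h 0 b) = 0.
  have [db|db] := eqVneq (deg F 1 b) (n%:Z - 1).
    by rewrite (const_unique eh) f0.
  apply: homz_const_coeff (hh b); apply: contraNneq db => e.
  by rewrite eq_sym -subr_eq0 e.
have hH b : exists H : 'rV[S]_3, (forall k, homz (n%:Z - 1 - deg F 1 b - 1) (H 0 k)) /\
    h 0 b = \sum_k 'X_k * H 0 k.
  exact: homz_decomp (hh b) (h0 b).
have [H HP] := fin_all_exists hH.
pose Hm : 'M[S]_(3, r1) := \matrix_(k, b) H b 0 k.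
have eHm : h = xvec *m Hm.
  apply/rowP => b; rewrite (HP b).2 mxE; apply: eq_bigr => k _.
  by rewrite [Hm _ _]mxE [xvec _ _]mxE.
have hz k j : homz (n%:Z - 2 - deg F 0 j) ((dep_lift mu - Hm *m d0) k j).
  rewrite mxE [X in homz _ (_ + X)]mxE; apply: homzB; first exact: dep_lift_homz.
  rewrite mxE; apply: homz_sum => b _; rewrite [Hm _ _]mxE.
  by apply: (homzM_eq ((HP b).1 k) (d0_homz b j)); ring.
have Xz : xvec *m (dep_lift mu - Hm *m d0) = 0.
  by rewrite mulmxBr ef -eh eHm mulmxA subrr.
have [Y hY eY] := koszul_exact_mx hz Xz.
have [g eg] := dep_lift_aug mu.
apply: (dep_cycle_orthogonal a0_free a0_generic (N := Y *m aug F) (g := g) hlam hmu) => [k|].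
  apply: M_homog_tangent; last by rewrite row_mul; apply: aug_M.
  move=> c; rewrite !mxE; apply: homz_sum => j _.
  by apply: (homzM_eq (hY k j) (aug_homz j c)); ring.
have := congr1 (mulmx^~ (aug F)) eY; rewrite /= mulmxBl -[Hm *m _ *m _]mulmxA d0_aug.
rewrite mulmx0 subr0 eg -mulmxA => <-; by rewrite subrK.
Qed.

Lemma eq_top_coeffs mu nu v w : mu =1 nu -> v =1 w -> top_coeffs mu v -> top_coeffs nu w.
Proof.
move=> e1 e2 [h eh hv]; exists h => [|b db]; last by rewrite hv.
by rewrite -eh; congr (_ *m _); apply: eq_bigr => i _; rewrite e1.
Qed.
End Lifts.
End Resolution.

(** * The rank count *)

Section Ranks.
Variables (K : fieldType) (n : nat) (a : 'I_n -> 'rV[K]_3) (a0 : 'rV[K]_3).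
Local Notation S := {mpoly K[3]}.
Hypothesis a0_free : forall i, cross a0 (a i) != 0.
Hypothesis a0_generic : forall i j, i != j -> det3 a0 (a i) (a j) != 0.

Definition line_mx : 'M[K]_(n, 3) := \matrix_i a i.

Definition triple_row (t : 'I_n * 'I_n * 'I_n) : 'rV[K]_n :=
  \row_l triple_dep a a0 t.1.1 t.1.2 t.2 l.

Definition triple_mx : 'M[K]_n :=
  (\sum_(t : 'I_n * 'I_n * 'I_n | det3 (a t.1.1) (a t.1.2) (a t.2) == 0)
     <<triple_row t>>)%MS.

Lemma mul_line_mx (mu : 'rV[K]_n) : mu *m line_mx = \sum_i mu 0 i *: a i.
Proof. by rewrite mulmx_sum_row; apply: eq_bigr => i _; rewrite rowK. Qed.

Lemma triple_row_mul t (lam : 'rV[K]_n) :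
  (triple_row t *m lam^T) 0 0 =
    lam 0 t.1.1 * det3 a0 (a t.1.2) (a t.2) + lam 0 t.1.2 * det3 a0 (a t.2) (a t.1.1)
    + lam 0 t.2 * det3 a0 (a t.1.1) (a t.1.2).
Proof.
rewrite mxE.
have pick (i : 'I_n) c : \sum_l c *+ (l == i) * lam 0 l = lam 0 i * c.
  rewrite (bigD1 i) //= eqxx big1 ?addr0 1?mulrC // => l /negPf ->.
  by rewrite mul0r.
rewrite -!pick -!big_split; apply: eq_bigr => l _ /=.
by rewrite !mxE /triple_dep; ring.
Qed.

Lemma triple_mx_perp m (C : 'M[K]_(n, m)) :
  (forall t, det3 (a t.1.1) (a t.1.2) (a t.2) = 0 -> triple_row t *m C = 0) ->
  triple_mx *m C = 0.
Proof.
move=> h; apply/sub_kermxP; apply/sumsmx_subP => t /eqP ht.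
by rewrite genmxE; apply/sub_kermxP; apply: h.
Qed.

Lemma triple_row_sub t : det3 (a t.1.1) (a t.1.2) (a t.2) = 0 -> (triple_row t <= triple_mx)%MS.
Proof. by move=> /eqP ht; rewrite (sumsmx_sup t) // genmxE. Qed.

Lemma perspectiveP (lam : 'rV[K]_n) :
  perspective a a0 (lam 0) <-> triple_mx *m lam^T = 0.
Proof.
split=> [h|h i j k hd].
  apply: triple_mx_perp => t ht; apply/rowP => j; rewrite ord1 triple_row_mul mxE.
  exact: h.
have /submxP[D eD] := triple_row_sub (t := (i, j, k)) hd.
by have := triple_row_mul (i, j, k) lam; rewrite eD -mulmxA h mulmx0 mxE => <-.
Qed.

Lemma triple_mx_line_mx : triple_mx *m line_mx = 0.
Proof.
apply: triple_mx_perp => -[[i j] k] /= h.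
rewrite mul_line_mx.
have pick (p : 'I_n) c : \sum_l (c *+ (l == p)) *: a l = c *: a p.
  rewrite (bigD1 p) //= eqxx big1 ?addr0 // => l /negPf ->.
  by rewrite scale0r.
transitivity (det3 a0 (a j) (a k) *: a i + det3 a0 (a k) (a i) *: a j
     + det3 a0 (a i) (a j) *: a k).
  rewrite -!pick -!big_split; apply: eq_bigr => l _ /=.
  by rewrite mxE /triple_dep /= !scalerDl.
transitivity (det3 (a i) (a j) (a k) *: a0); last by rewrite h scale0r.
vring.
Qed.

(** Double annihilator: the columns of [cokermx triple_mx] are perspective vectors, and they detect
    the row space. *)
Lemma sub_triple_mx (x : 'rV[K]_n) :
  (forall lam : 'rV[K]_n, perspective a a0 (lam 0) -> \sum_i x 0 i * lam 0 i = 0) ->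
  (x <= triple_mx)%MS.
Proof.
move=> h; rewrite submxE; apply/eqP/rowP => j.
rewrite !mxE; transitivity (\sum_i x 0 i * (col j (cokermx triple_mx))^T 0 i).
  by apply: eq_bigr => i _; rewrite !mxE.
apply: h; apply/perspectiveP; rewrite trmxK colE mulmxA mulmx_coker.
by rewrite mul0mx.
Qed.

Variable l0 : 'I_n.
Hypothesis charK : [pchar K] =i pred0.
Variables (M : 'rV[S]_3 -> Prop) (F : free_complex K 3 3).
Hypothesis ME : forall v, M v <-> der_app v (lines a setT) = 0.
Hypothesis FP : minimal_graded_free_resolution (fun=> 0) M F.

(** Rank-nullity for the map from relations, the left kernel of [line_mx], to constant terms at the
    generators of degree n - 1: it is onto, with kernel the row space of [triple_mx]. *)
Lemma betti_rank :
  (betti F 1 (n%:Z - 1) + \rank line_mx + \rank triple_mx)%N = n.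
Proof.
rewrite /betti; set top := [set b | _]; pose b := #|top|; rewrite -/b.
have [s sP] := node_lifts a0_free l0 charK ME FP.
pose TC := @top_coeffs K n a l0 F s.
have topP (j : 'I_b) : deg F 1 (enum_val j) = n%:Z - 1.
  by have := enum_valP j; rewrite inE => /eqP.
have [B eqB Bfree] : exists2 B : 'M[K]_(\rank (kermx line_mx), n),
    (B :=: kermx line_mx)%MS & row_free B.
  by exists (row_base (kermx line_mx)); [apply: eq_row_base | apply: row_base_free].
have BA : B *m line_mx = 0 by apply/sub_kermxP; rewrite eqB.
have hB t : exists v, TC (B t) v.
  apply: (@top_coeffs_ex _ _ _ _ a0_free _ charK _ _ ME FP _ sP (B t)).
  have e : row t B *m line_mx = 0 by rewrite -row_mul BA linear0.
  rewrite -[RHS]e mul_line_mx.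
  by apply: eq_bigr => i _; rewrite mxE.
have [v hv] := fin_all_exists hB.
pose C := \matrix_(t < \rank (kermx line_mx), j < b) v t (enum_val j).
have TCb mu : bounding a (dep_cycle a l0 setT mu) -> TC mu (fun=> 0).
  exact: (@top_coeffs_bounding _ _ _ _ a0_free _ charK _ _ ME FP _ sP mu).
have TC0 : TC (fun=> 0) (fun=> 0).
  apply: TCb.
  rewrite /dep_cycle big1 => [|i _]; first exact: bounding0.
  by rewrite scale0r cvec0 trmx0 mul0mx.
have TCsum (u : 'rV_(\rank (kermx line_mx))) :
    TC ((u *m B) 0) (fun c => \sum_t u 0 t * v t c).
  have : TC (fun i => \sum_t u 0 t * B t i) (fun c => \sum_t u 0 t * v t c).
    elim: (index_enum _) => [|t r IH].
      by apply: eq_top_coeffs TC0 => i; rewrite big_nil.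
    have := top_coeffs_linear (u 0 t) (hv t) IH.
    by apply: eq_top_coeffs => i; rewrite big_cons.
  by apply: eq_top_coeffs => i //; rewrite mxE.
have BAu (u : 'rV_(\rank (kermx line_mx))) : \sum_i (u *m B) 0 i *: a i = 0.
  by rewrite -mul_line_mx -mulmxA BA mulmx0.
(* One direction is orthogonality to every perspective vector, the other that concurrent triples
   give boundaries. *)
have kerP (u : 'rV_(\rank (kermx line_mx))) : (u *m C == 0) = (u *m B <= triple_mx)%MS.
  apply/eqP/idP => [uC|uB].
    apply: sub_triple_mx => lam hlam.
    apply: (@top_coeffs0_orthogonal _ _ _ _ a0_free a0_generic _ _ _ ME FP _ sP _ _ hlam (BAu u)).
    have [h eh hh] := TCsum u; exists h => // c dc; rewrite hh //.
    have ct : c \in top by rewrite inE dc.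
    have /rowP/(_ (enum_rank_in ct c)) := uC; rewrite [LHS]mxE [RHS]mxE => e.
    rewrite -[RHS]e.
    by apply: eq_bigr => t _; rewrite mxE enum_rankK_in.
  apply/rowP => j; rewrite [LHS]mxE [RHS]mxE.
  have h0 : TC ((u *m B) 0) (fun=> 0).
    have lin_TC (x y : 'rV[K]_n) c : TC (x 0) (fun=> 0) -> TC (y 0) (fun=> 0) ->
        TC ((c *: x + y) 0) (fun=> 0).
      move=> hx hy; have := top_coeffs_linear c hx hy.
      by apply: eq_top_coeffs => i; rewrite ?mxE // mulr0 addr0.
    have /sub_sumsmxP[w ->] := uB.
    elim/big_rec: _ => [|t x ht hx].
      by apply: eq_top_coeffs TC0 => i //; rewrite mxE.
    have : (w t *m <<triple_row t>> <= triple_row t)%MS by rewrite -(genmxE (triple_row t)) submxMl.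
    case/sub_rVP => c ->; apply: (lin_TC _ _ _ _ hx).
    apply: eq_top_coeffs (TCb _ (bounding_triple_dep a0_generic l0 (eqP ht))) => i //.
    by rewrite mxE.
  have /= e := top_coeffs_unique FP (TCsum u) h0 (topP j); rewrite -[RHS]e.
  by apply: eq_bigr => t _; rewrite mxE.
have fullC : row_full C.
  apply/row_fullP.
  have hu j : exists u : 'rV_(\rank (kermx line_mx)), u *m C = delta_mx 0 j.
    have [mu hmu hTC] := @top_coeffs_surj _ _ _ _ a0_free a0_generic _ charK _ _ ME FP _ sP _ (topP j).
    have /submxP[u eu] : (\row_i mu i <= B)%MS.
      rewrite eqB; apply/sub_kermxP; rewrite mul_line_mx -[RHS]hmu.
      by apply: eq_bigr => i _; rewrite mxE.
    exists u; apply/rowP => k; rewrite !mxE.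
    have hTC' : TC ((u *m B) 0) (fun c => (c == enum_val j)%:R).
      by apply: eq_top_coeffs hTC => i //; rewrite -eu mxE.
    have /= e := top_coeffs_unique FP (TCsum u) hTC' (topP k).
    rewrite (inj_eq enum_val_inj) in e.
    transitivity ((k == j)%:R : K); last by rewrite ?eqxx.
    rewrite -[RHS]e.
    by apply: eq_bigr => t _; rewrite mxE.
  have [u eu] := fin_all_exists hu; exists (\matrix_j u j).
  by apply/row_matrixP => j; rewrite row_mul rowK eu row1.
have eR : (kermx C *m B :=: triple_mx)%MS.
  apply/eqmxP/andP; split; apply/row_subP => i.
    by rewrite row_mul -kerP -row_mul mulmx_ker linear0.
  have /submxP[u eu] : (row i triple_mx <= B)%MS.
    by rewrite eqB; apply/sub_kermxP; rewrite -row_mul triple_mx_line_mx linear0.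
  rewrite eu; apply: submxMr; apply/sub_kermxP/eqP.
  by rewrite kerP -eu row_sub.
have := mxrankMfree (kermx C) Bfree; rewrite eR mxrank_ker.
have /eqP -> : \rank C == b by exact: fullC.
have bk : (b <= \rank (kermx line_mx))%N.
  by have := fullC; rewrite /row_full => /eqP <-; apply: rank_leq_row.
have := mxrank_ker line_mx; have := rank_leq_row line_mx.
move: bk; lia.
Qed.
End Ranks.

(** * Weak perspective representations *)

Lemma row_space_vspace (K : fieldType) m n (A : 'M[K]_(m, n)) :
  exists2 V : {vspace 'rV[K]_n}, \dim V = \rank A & forall v, (v \in V) = (v <= A)%MS.
Proof.
pose X := [tuple row i (row_base A) | i < \rank A].
have XE (i : 'I_(\rank A)) : X`_i = row i (row_base A) by rewrite -tnth_nth tnth_mktuple.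
have comb (k : 'I_(\rank A) -> K) :
    \sum_i k i *: X`_i = (\row_i k i) *m row_base A.
  by rewrite mulmx_sum_row; apply: eq_bigr => i _; rewrite XE mxE.
have fX : free X.
  apply/freeP => k; rewrite comb => k0 i.
  have /rowP/(_ i) : \row_i k i = 0 by apply: (row_free_inj (row_base_free A)); rewrite k0 mul0mx.
  by rewrite !mxE.
exists <<X>>%VS; first by move: fX; rewrite /free size_tuple => /eqP.
move=> v; apply/idP/idP => [/coord_span ->|].
  by rewrite comb -(eq_row_base A) submxMl.
rewrite -(eq_row_base A) => /submxP[u ->].
have -> : u = \row_i u 0 i by apply/rowP => i; rewrite mxE.
rewrite -comb; apply: memv_suml => i _; apply/memvZ/memv_span.
by rewrite mem_nth // size_tuple.
Qed.

Lemma free_imageP (K : fieldType) (vT : vectType K) n (v : 'I_n -> vT) (I : {set 'I_n}) :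
  free [seq v i | i in I] <->
  forall c : 'I_n -> K, \sum_(i in I) c i *: v i = 0 -> forall i, i \in I -> c i = 0.
Proof.
have -> : [seq v i | i in I] = image_tuple v I by [].
have nE (i : 'I_#|I|) : (image_tuple v I)`_i = v (enum_val i).
  by rewrite -tnth_nth (tnth_nth 0) /= nth_image.
split=> [/freeP h c hc i iI|h].
  have := h (fun j => c (enum_val j)) _ (enum_rank_in iI i).
  rewrite enum_rankK_in //; apply.
  by rewrite -[RHS]hc [RHS]big_enum_val /=; apply: eq_bigr => j _; rewrite nE.
apply/freeP => k hk i.
pose c j := if insub (index j (enum I)) is Some t then k t else 0.
have cE t : c (enum_val t) = k t.
  rewrite /c (enum_val_nth (enum_val t)) index_uniq ?enum_uniq -?cardE //.
  by rewrite valK.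
rewrite -cE; apply: h; last exact: enum_valP.
by rewrite -[RHS]hk big_enum_val /=; apply: eq_bigr => j _; rewrite nE cE.
Qed.

Section Forms.
Variable K : fieldType.
Local Notation form := 'Hom('rV[K]_3, K^o).

Definition coefs (f : form) : 'rV[K]_3 := \row_c (f (delta_mx 0 c) : K).

Lemma formE (f : form) v : f v = dot (coefs f) v :> K.
Proof.
rewrite {1}[v]row_sum_delta linear_sum /= sum3 !linearZ /= dotE ![coefs f _ _]mxE.
by rewrite ![_ *: _]mulrC.
Qed.

Lemma form_polyE (f : form) : form_poly f = lin (coefs f).
Proof.
rewrite /form_poly /lin dotE sum3 !cvecE ![coefs f _ _]mxE ![xvec _ _]mxE.
by rewrite !mul_mpolyC.
Qed.

Lemma coefs_inj : injective coefs.
Proof. by move=> f g e; apply/lfunP => v; rewrite !formE e. Qed.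

Lemma coefsD (f g : form) : coefs (f + g) = coefs f + coefs g.
Proof. by apply/rowP => c; rewrite !mxE lfunE. Qed.

Lemma coefsZ s (f : form) : coefs (s *: f) = s *: coefs f.
Proof. by apply/rowP => c; rewrite !mxE lfunE. Qed.

Lemma coefs0 : coefs 0 = 0.
Proof. by apply/rowP => c; rewrite !mxE lfunE. Qed.

Lemma coefs_sum (I : finType) (P : pred I) (c : I -> K) (f : I -> form) :
  coefs (\sum_(i | P i) c i *: f i) = \sum_(i | P i) c i *: coefs (f i).
Proof.
by elim/big_rec2: _ => [|i x y _ e]; rewrite ?coefs0 // coefsD coefsZ e.
Qed.

Lemma cross_eq0_lker (f g : form) : f != 0 -> g != 0 ->
  cross (coefs f) (coefs g) = 0 -> lker f = lker g.
Proof.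
move=> f0 g0 h.
have half (f' g' : form) : f' != 0 -> cross (coefs f') (coefs g') = 0 -> (lker f' <= lker g')%VS.
  move=> f'0 h'; apply/subvP => v; rewrite !memv_ker => /eqP fv.
  have p0 : coefs f' != 0 by apply: contraNneq f'0 => e; apply/eqP/coefs_inj; rewrite coefs0.
  have := cross_cross v (coefs f') (coefs g'); rewrite h' cross0r.
  rewrite ![dot v _]dotC -(formE f' v) fv scale0r subr0 => /esym/eqP.
  by rewrite scaler_eq0 (negPf p0) orbF -formE.
apply/eqP; rewrite eqEsubv !half //.
by rewrite crossC h oppr0.
Qed.
End Forms.

Lemma det3_eq0_dep (K : fieldType) (u v w : 'rV[K]_3) : det3 u v w = 0 ->
  exists x y z, x *: u + y *: v + z *: w = 0 /\ [|| x != 0, y != 0 | z != 0].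
Proof.
move=> h; have [uv0|uv] := eqVneq (cross u v) 0.
  have [u0|u0] := eqVneq u 0.
    by exists 1, 0, 0; rewrite u0 scaler0 !scale0r !addr0 oner_eq0.
  have [c hc] : exists c, u 0 c != 0.
    apply/existsP; apply: contraNT u0 => /existsPn e.
    by apply/eqP/rowP => k; rewrite [RHS]mxE; apply/eqP; move: (e k); rewrite negbK.
  exists (v 0 c), (- u 0 c), 0; rewrite oppr_eq0 hc orbT; split=> //.
  have := cross_cross (delta_mx 0 c) u v; rewrite uv0 cross0r.
  have dd b : dot (delta_mx 0 c) b = b 0 c :> K.
    by rewrite dotE; elim/ord3P: c {hc}; rewrite !mxE /=; ring.
  by rewrite !dd scale0r addr0 scaleNr => <-.
have [b hb] : exists b, det3 b u v != 0.
  have [c hc] : exists c, cross u v 0 c != 0.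
    apply/existsP; apply: contraNT uv => /existsPn e.
    by apply/eqP/rowP => k; rewrite [RHS]mxE; apply/eqP; move: (e k); rewrite negbK.
  exists (delta_mx 0 c); apply: contraNneq hc; rewrite /det3.
  by move: (cross u v) => q; rewrite dotE; elim/ord3P: c; rewrite !mxE /= => <-; apply/eqP; ring.
have := cramer3 b u v w; rewrite [det3 w u v]det3_rot h scale0r add0r => e.
exists (det3 b w v), (det3 b u w), (- det3 b u v).
by rewrite oppr_eq0 hb !orbT scaleNr e subrr.
Qed.

Lemma dep_det3_eq0 (K : fieldType) (u v w : 'rV[K]_3) x y z :
  x *: u + y *: v + z *: w = 0 -> [|| x != 0, y != 0 | z != 0] -> det3 u v w = 0.
Proof.
have key (p q r : 'rV[K]_3) s t k : s != 0 -> s *: p + t *: q + k *: r = 0 -> det3 p q r = 0.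
  move=> s0 e; apply: (mulfI s0); rewrite mulr0.
  have -> : s * det3 p q r = det3 (s *: p + t *: q + k *: r) q r by vring.
  by rewrite e /det3 dot0l.
move=> e /or3P[] h; first exact: key h e.
  by rewrite det3_rot; apply: (key _ _ _ _ z x h); rewrite -[RHS]e addrC addrA.
by rewrite -det3_rot; apply: (key _ _ _ _ x y h); rewrite -[RHS]e -addrA addrC.
Qed.

Section WeakPerspective.
Variables (K : fieldType) (n : nat).
Local Notation form := 'Hom('rV[K]_3, K^o).

Lemma big_set3 (V : nmodType) (F : 'I_n -> V) i j k : uniq [:: i; j; k] ->
  \sum_(l in i |: (j |: [set k])) F l = F i + (F j + F k).
Proof.
rewrite /= !inE !negb_or => /and3P[/andP[ij ik] jk _].
by rewrite !big_setU1 ?big_set1 //= !inE ?negb_or ?ij ?ik.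
Qed.

Lemma free_triple (f : 'I_n -> form) i j k : uniq [:: i; j; k] ->
  free [seq f l | l in i |: (j |: [set k])] =
    (det3 (coefs (f i)) (coefs (f j)) (coefs (f k)) != 0).
Proof.
move=> u; have := u; rewrite /= !inE !negb_or => /and3P[/andP[ij ik] jk _].
have lin3 (c : 'I_n -> K) :
    coefs (\sum_(l in i |: (j |: [set k])) c l *: f l) =
    c i *: coefs (f i) + c j *: coefs (f j) + c k *: coefs (f k).
  by rewrite coefs_sum big_set3 // addrA.
apply/idP/idP => [/free_imageP h|h].
  apply/eqP => /det3_eq0_dep[x [y [z [e]]]].
  pose c l := if l == i then x else if l == j then y else z.
  have ci : c i = x by rewrite /c eqxx.
  have cj : c j = y by rewrite /c eq_sym (negPf ij) eqxx.
  have ck : c k = z by rewrite /c ![k == _]eq_sym (negPf ik) (negPf jk).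
  have c0 : forall l, l \in i |: (j |: [set k]) -> c l = 0.
    by apply: h; apply: coefs_inj; rewrite lin3 coefs0 ci cj ck.
  by rewrite -ci -cj -ck !c0 ?inE ?eqxx ?orbT.
apply/free_imageP => c /(congr1 (@coefs K)); rewrite lin3 coefs0 => e.
have : ~~ [|| c i != 0, c j != 0 | c k != 0].
  by apply: contraNN h => h; apply/eqP; apply: dep_det3_eq0 e h.
rewrite !negb_or !negbK => /and3P[/eqP ci /eqP cj /eqP ck] l.
by rewrite !inE => /or3P[] /eqP ->.
Qed.

Variables (alpha : 'I_n -> form) (alpha0 : form).
Hypothesis alphaP : line_arrangement alpha.
Hypothesis alpha0P : generic_line alpha alpha0.
Local Notation a := (fun i => coefs (alpha i)).
Local Notation a0 := (coefs alpha0).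

Lemma line_cross_neq0 i j : i != j -> cross (a i) (a j) != 0.
Proof.
case: alphaP => nz inj; apply: contraNneq => h.
by apply/eqP; apply: inj; apply: cross_eq0_lker.
Qed.

Lemma generic_cross_neq0 i : cross a0 (a i) != 0.
Proof.
case: alphaP => nz _; case: alpha0P => nz0 ker0 _.
by apply: contra (ker0 i) => /eqP h; apply/eqP; apply: cross_eq0_lker.
Qed.

Lemma generic_det3_neq0 i j : i != j -> det3 a0 (a i) (a j) != 0.
Proof.
move=> ij; case: alpha0P => _ _ /(_ i j ij) h.
apply: contraNneq (line_cross_neq0 ij) => d0.
rewrite -memv0 -h !memv_cap !memv_ker !formE -/(det3 _ _ _) d0.
by rewrite dot_crossl dot_crossr eqxx.
Qed.

(** Only triples impose conditions: larger sets are dependent after truncation, and smaller ones are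
    independent for [alpha], whose lines are distinct. *)
Lemma weak_perspectiveE (lam : 'rV[K]_n) :
  weak_perspective alpha alpha0 lam <-> perspective a a0 (lam 0).
Proof.
pose beta j := alpha j + lam 0 j *: alpha0.
have detE i j k : det3 (coefs (beta i)) (coefs (beta j)) (coefs (beta k)) =
    det3 (a i) (a j) (a k) +
    (lam 0 i * det3 a0 (a j) (a k) + lam 0 j * det3 a0 (a k) (a i)
      + lam 0 k * det3 a0 (a i) (a j)).
  by rewrite /beta !coefsD !coefsZ; vring.
have card3 i j k : uniq [:: i; j; k] -> #|i |: (j |: [set k])| = 3%N.
  rewrite /= !inE !negb_or => /and3P[/andP[ij ik] jk _].
  by rewrite !cardsU1 cards1 !inE negb_or ij ik jk.
split=> [hw i j k hd|hp I hI].
  have [u|] := boolP (uniq [:: i; j; k]); last first.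
    rewrite /= !inE andbT negb_and !negbK -orbA.
    by case/or3P => /eqP e; subst; vring.
  have := hw (i |: (j |: [set k])); rewrite !inE !free_triple // hd eqxx /= => /(_ isT).
  by rewrite card3 // andbT negbK detE hd add0r => /eqP.
apply: contra hI; rewrite !inE => /andP[fb cI]; rewrite cI andbT.
have [I0|[i iI]] := set_0Vmem I.
  by apply/free_imageP => c _ l; rewrite I0 inE.
have cE : #|I| = (#|I :\ i|).+1 by rewrite (cardsD1 i) iI.
have eI := setD1K iI.
have [J0|[j jJ]] := set_0Vmem (I :\ i).
  apply/free_imageP => c; rewrite -eI J0 setU0 big_set1 => /eqP.
  rewrite scaler_eq0 => /orP[/eqP c0 l /set1P -> //|].
  by case: alphaP => nz _; rewrite (negPf (nz i)).
have eJ := setD1K jJ; have ji : j != i by case/setD1P: jJ.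
have [L0|[k kL]] := set_0Vmem (I :\ i :\ j).
  apply/free_imageP => c; rewrite -eI -eJ L0 setU0 big_setU1 ?inE 1?eq_sym // big_set1.
  move=> /(congr1 (@coefs K)); rewrite coefsD !coefsZ coefs0 => e.
  have n0 := line_cross_neq0 ji.
  have := congr1 (cross (a j)) e; have := congr1 (cross (a i)) e.
  rewrite !crossDr !crossZr !crossvv !cross0r !scaler0 add0r addr0 => /eqP.
  rewrite scaler_eq0 [cross (a i) _]crossC oppr_eq0 (negPf n0) orbF => /eqP cj /eqP.
  rewrite scaler_eq0 (negPf n0) orbF => /eqP ci l.
  by rewrite !inE => /orP[] /eqP ->.
have kj : k != j by case/setD1P: kL.
have ki : k != i by case/setD1P: kL => _ /setD1P[].
have eI3 : I = i |: (j |: [set k]).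
  apply/eqP; rewrite eq_sym eqEcard; apply/andP; split.
    apply/subsetP => l; rewrite !inE => /or3P[] /eqP -> //.
      by case/setD1P: jJ.
    by case/setD1P: kL => _ /setD1P[].
  by rewrite card3 // /= !inE negb_or ![i == _]eq_sym [j == k]eq_sym ji ki kj.
have u : uniq [:: i; j; k].
  by rewrite /= !inE negb_or ![i == _]eq_sym [j == k]eq_sym ji ki kj.
move: fb; rewrite eI3 !free_triple // detE; apply: contraNneq => hd.
by rewrite hd add0r; apply/eqP; exact: (hp i j k hd).
Qed.
End WeakPerspective.

(** * Vanishing in negative degrees, for the arrangement without lines *)

Section EmptyArrangement.
Variables (K : fieldType) (M : 'rV[{mpoly K[3]}]_3 -> Prop) (F : free_complex K 3 3).
Hypothesis FP : minimal_graded_free_resolution (fun=> 0) M F.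

Lemma deg_generator_ge0 b : 0 <= deg F 0 b.
Proof.
rewrite leNgt; apply/negP => db.
have : (delta_mx 0 b : 'rV_(rk F 0)) *m aug F = 0.
  rewrite -rowE; apply/rowP => k; rewrite [LHS]mxE [RHS]mxE.
  exact: homz_neg db (aug_homz FP b k).
move/(exact_at_0 FP) => [g /rowP/(_ b)]; rewrite !mxE !eqxx /=.
move/(congr1 (@const0 K)); rewrite const0_sum big1 => [|j _]; last first.
  by rewrite const0M /const0 (diff_minimal FP) mulr0.
by rewrite /const0 mcoeff1 eqxx => /eqP; rewrite oner_eq0.
Qed.

(** A generator of negative degree would map to 0, as F_0 starts in degree 0 or later; exactness
    would put it into the image of the next differential, which has no constant terms. *)
Lemma betti_neg d : d < 0 -> betti F 1 d = 0%N.
Proof.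
move=> d0; apply: eq_card0 => b; rewrite inE; apply/negP => /eqP db.
have : (delta_mx 0 b : 'rV_(rk F 1)) *m diff F 0 = 0.
  rewrite -rowE; apply/rowP => k; rewrite [LHS]mxE [RHS]mxE.
  apply: homz_neg (d0_homz FP b k); rewrite db subr_lt0.
  exact: lt_le_trans d0 (deg_generator_ge0 k).
move/(exact_at_S FP) => [g /rowP/(_ b)]; rewrite !mxE !eqxx /=.
move/(congr1 (@const0 K)); rewrite const0_sum big1 => [|j _]; last first.
  by rewrite const0M /const0 (diff_minimal FP) mulr0.
by rewrite /const0 mcoeff1 eqxx => /eqP; rewrite oner_eq0.
Qed.
End EmptyArrangement.

Unset Implicit Arguments.

Theorem corollary7p2 (K : fieldType) (charK : [pchar K] =i pred0)
    (n : nat) (alpha : 'I_n -> 'Hom('rV[K]_3, K^o))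
    (alphaP : line_arrangement alpha)
    (alpha0 : 'Hom('rV[K]_3, K^o)) (alpha0P : generic_line alpha alpha0)
    (F : free_complex K 3 3)
    (FP : minimal_graded_free_resolution (fun=> 0) (D0 alpha) F) :
  quotient_dim (weak_perspective alpha alpha0) (trivial_perspective alpha)
    (betti F 1 (n%:Z - 1)).
Proof.
pose a i := coefs (alpha i); pose a0 := coefs alpha0.
have a0_free : forall i, cross a0 (a i) != 0 := generic_cross_neq0 alphaP alpha0P.
have a0_generic : forall i j, i != j -> det3 a0 (a i) (a j) != 0 :=
  generic_det3_neq0 alphaP alpha0P.
have QE : defining_poly alpha = lines a setT.
  by apply: eq_big => i; rewrite ?inE // => _; rewrite form_polyE.
have ME v : D0 alpha v <-> der_app v (lines a setT) = 0 by rewrite /D0 QE.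
have rk_sum : (betti F 1 (n%:Z - 1) + \rank (line_mx a) + \rank (triple_mx a a0))%N = n.
  (* Without lines there is no [l0]; the degree is then -1 and all terms are 0. *)
  have [n0|n_gt0] := posnP n; last first.
    exact: (betti_rank a0_free a0_generic (Ordinal n_gt0) charK ME FP).
  rewrite (betti_neg FP); last by rewrite n0.
  have := rank_leq_row (line_mx a); have := rank_leq_row (triple_mx a a0).
  by move: (\rank _) (\rank _) => p q; rewrite n0; case: p q => [|p] [|q].
have [U dU UE] := row_space_vspace (kermx (triple_mx a a0)^T).
have [V dV VE] := row_space_vspace (line_mx a)^T.
have UP v : v \in U <-> weak_perspective alpha alpha0 v.
  rewrite UE; split=> [/sub_kermxP h|/(weak_perspectiveE alpha0 alphaP)/perspectiveP h].
    apply/(weak_perspectiveE alpha0 alphaP)/perspectiveP.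
    by rewrite -[LHS]trmxK trmx_mul trmxK h trmx0.
  by apply/sub_kermxP; rewrite -[LHS]trmxK trmx_mul trmxK h trmx0.
exists U, V; split=> //.
- move=> v; rewrite VE; split=> [/submxP[D ->]|[w ->]].
    exists D; apply/rowP => j; rewrite !mxE formE dotE sum3 !mxE -/(a j).
    by ring.
  apply/submxP; exists w; apply/rowP => j; rewrite !mxE formE dotE sum3 !mxE -/(a j).
  by ring.
- apply/subvP => v; rewrite UE VE => /submxP[D ->]; apply/sub_kermxP.
  by rewrite -mulmxA -trmx_mul triple_mx_line_mx trmx0 mulmx0.
(* The two dimensions are n minus the rank of [triple_mx] and the rank of [line_mx]; [rk_sum] gives
   their difference. *)
- by rewrite dU dV mxrank_ker !mxrank_tr -{1}rk_sum addnK addnC.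
Qed.
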